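(* Let $p_1,p_2\in(0,1)$ be constants and let $G_{N,p_1}$, $G_{N,p_2}$ be independent binomial random graphs. Let $I_N$ be the size (number of vertices) of their maximum common induced subgraph. Then $$\lim_{N\to\infty}\Pr\bigl(I_N\in\{\lfloor n_N-\varepsilon_N\rfloor,\lfloor n_N+\varepsilon_N\rfloor\}\bigr)=1,$$ where $\varepsilon_N:=(\log\log N)^2/\log N$ and the parameter $n_N=n_N(p_1,p_2)$ defined below satisfies $$n_N=\frac{4\log N+O(\log\log N)}{\min_{p\in[0,1]}\max\{\log b_0(p),\,2\log b_1(p),\,2\log b_2(p)\}}.$$
   Context: $G_{N,p}$ is the binomial random graph on $[N]$ with independent edges of probability $p$. The maximum common induced subgraph size of graphs $F,G$ is the largest $k$ such that there are $k$-vertex sets $S_1\subseteq V(F)$, $S_2\subseteq V(G)$ with $F[S_1]$ isomorphic to $G[S_2]$. Using the convention $0^0=1$, for $p\in[0,1]$ define $$b_0(p):=\Bigl(\frac{p}{p_1p_2}\Bigr)^p\Bigl(\frac{1-p}{(1-p_1)(1-p_2)}\Bigr)^{1-p},\qquad b_i(p):=\Bigl(\frac{p}{p_i}\Bigr)^p\Bigl(\frac{1-p}{1-p_i}\Bigr)^{1-p}\ (i\in\{1,2\}).$$ Define $x^{(0)}_N(p):=4\log_{b_0}N-2\log_{b_0}\log_{b_0}N-2\log_{b_0}(4/e)+1$ with $b_0=b_0(p)$, and for $i\in\{1,2\}$ let $x^{(i)}_N(p)$ be the unique solution $x$ of $eN=x\cdot b_i(p)^{(x-1)/2}$. Finally $n_N:=\max_{p\in[0,1]}\min\{x^{(0)}_N(p),x^{(1)}_N(p),x^{(2)}_N(p)\}$.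 *)

(* Defs.v *)
From HB Require Import structures.
From mathcomp Require Import all_boot all_order all_algebra.
From mathcomp Require Import all_classical all_reals all_analysis.

Set Implicit Arguments.
Unset Strict Implicit.
Unset Printing Implicit Defensive.

Import Order.TTheory GRing.Theory Num.Theory.
Import numFieldNormedType.Exports.

Local Open Scope ring_scope.

Definition sgraph (V : finType) :=
  {E : {set {set V}} | [forall e in E, #|e| == 2%N]}.

Definition edges (V : finType) (G : sgraph V) : {set {set V}} := sval G.

(* irreflexive because [set x; x] has only one element *)
Definition adj (V : finType) (G : sgraph V) : rel V :=
  fun x y => ([set x; y] \in edges G)%SET.

Definition induced_edges (V : finType) (G : sgraph V) (S : {set V}) :
    {set {set {x : V | x \in S}}} :=
  [set e : {set {x : V | x \in S}} | (val @: e)%SET \in edges G]%SET.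

Lemma induced_subproof (V : finType) (G : sgraph V) (S : {set V}) :
  [forall e in induced_edges G S, #|e| == 2%N].
Proof.
apply/forall_inP => e; rewrite inE => eG.
rewrite -(card_imset _ val_inj).
exact: (forall_inP (svalP G)).
Qed.

Definition induced (V : finType) (G : sgraph V) (S : {set V}) :
    sgraph {x : V | x \in S} :=
  exist _ (induced_edges G S) (induced_subproof G S).

Definition graph_iso (V W : finType) (F : sgraph V) (G : sgraph W) : Prop :=
  exists2 f : V -> W, bijective f & forall x y, adj G (f x) (f y) = adj F x y.

Definition common_induced (V W : finType) (F : sgraph V) (G : sgraph W)
    (k : nat) : Prop :=
  exists (S1 : {set V}) (S2 : {set W}),
    [/\ #|S1| = k, #|S2| = k & graph_iso (induced F S1) (induced G S2)].

Definition mcis (V W : finType) (F : sgraph V) (G : sgraph W) : nat :=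
  (\max_(k < #|V|.+1 | `[< common_induced F G k >]) k)%N.

Definition gnp_pmf (R : realType) (N : nat) (p : R) (G : sgraph 'I_N) : R :=
  \prod_(e : {set 'I_N} | #|e| == 2%N) (if e \in edges G then p else 1 - p).

(* probability of an event about an independent pair (G_{N,p1}, G_{N,p2}) *)
Definition gnp2_prob (R : realType) (N : nat) (p1 p2 : R)
    (A : pred (sgraph 'I_N * sgraph 'I_N)) : R :=
  \sum_(FG : sgraph 'I_N * sgraph 'I_N | A FG)
    gnp_pmf p1 FG.1 * gnp_pmf p2 FG.2.

Local Open Scope classical_set_scope.

Definition is_max (R : realType) (A : set R) (m : R) : Prop := A m /\ ubound A m.
Definition is_min (R : realType) (A : set R) (m : R) : Prop := A m /\ lbound A m.
Definition set_max (R : realType) (A : set R) : R := xget 0 (is_max A).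
Definition set_min (R : realType) (A : set R) : R := xget 0 (is_min A).

Definition log_base (R : realType) (b x : R) : R := ln x / ln b.

(* powR satisfies 0 `^ 0 = 1, as needed at p = 0 and p = 1 *)
Definition b0 (R : realType) (p1 p2 p : R) : R :=
  (p / (p1 * p2)) `^ p * ((1 - p) / ((1 - p1) * (1 - p2))) `^ (1 - p).

Definition bi (R : realType) (pi p : R) : R :=
  (p / pi) `^ p * ((1 - p) / (1 - pi)) `^ (1 - p).

Definition x0 (R : realType) (p1 p2 : R) (N : nat) (p : R) : R :=
  let b := b0 p1 p2 p in
  4 * log_base b N%:R - 2 * log_base b (log_base b N%:R)
  - 2 * log_base b (4 / expR 1) + 1.

(* For N >= 1 and pi in ]0, 1[ there is exactly one real solution, because
   bi pi p >= 1 (ln (bi pi p) is a relative entropy). *)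
Definition xi (R : realType) (pi : R) (N : nat) (p : R) : R :=
  xget 0 [set x : R | expR 1 * N%:R = x * bi pi p `^ ((x - 1) / 2)].

(* Continuity in p makes the maximum here (for N large) and the minimum in
   min_max_log attained, so the default value of xget plays no role. *)
Definition nN (R : realType) (p1 p2 : R) (N : nat) : R :=
  set_max [set Num.min (x0 p1 p2 N p) (Num.min (xi p1 N p) (xi p2 N p))
          | p in `[0, 1]].

Definition epsN (R : realType) (N : nat) : R := ln (ln N%:R) ^+ 2 / ln N%:R.

Definition min_max_log (R : realType) (p1 p2 : R) : R :=
  set_min [set Num.max (ln (b0 p1 p2 p))
                 (Num.max (2 * ln (bi p1 p)) (2 * ln (bi p2 p)))
          | p in `[0, 1]].

(* Main.v *)
(** A common induced copy of a graph H on n vertices with m = p 'C(n,2) edges is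
    a pair of injections [n] -> [N].  If E is the expected number of
    common copies, over all H of density p, counted up to relabelling, then
      log E <= 2 n log N - log n! - 'C(n,2) (D(p||p1) + D(p||p2) + h(p)),
    where D is the relative entropy, h the entropy and D(p||p1) + D(p||p2) + h(p)
    = log b_0(p).  Copies of one fixed H in G_{N,p_i} alone give instead
    n log N - log n! - 'C(n,2) D(p||p_i), and log b_i(p) = D(p||p_i).  So n_N is,
    up to epsilon_N, the largest n for which some density p keeps all three
    exponents nonnegative.

    Upper tail: first moment, summed over the 'C(n,2) + 1 possible edge numbers;
    at each density one of the three exponents is at most -c (log log N)^2.

    Lower tail: second moment at an optimal density p, which may be taken bounded
    away from 0 and 1, counting only copies of graphs H that are jumbled (every
    vertex subset induces about the expected number of edges) and asymmetric (no
    nontrivial partial injection with few missing points preserves adjacency).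
    Two pairs of embeddings overlap in partial injections th1, th2 of H.  The gain
    in covariance is governed by the same three exponents restricted to the
    overlaps, by jumbledness, and is convex in their sizes; for near-total
    overlaps asymmetry forces th1 = th2 on the common domain, so that few of them
    exist. *)

Require Import Defs.
From HB Require Import structures.
From mathcomp Require Import all_boot all_order all_algebra.
From mathcomp Require Import all_classical all_reals all_analysis.
From mathcomp Require Import ring lra zify perm.

Set Implicit Arguments.
Unset Strict Implicit.
Unset Printing Implicit Defensive.

Import Order.TTheory GRing.Theory Num.Theory.
Import numFieldNormedType.Exports.

Local Open Scope ring_scope.

(** * Random subsets of a finite set *)

Section RandomSubset.
Variables (R : realType) (E : finType).
Implicit Types (P Q S : {set E}) (p : R).

(** Write L = log N and l = log log N. Moving n by epsilon_N = l^2/L changes the relevant exponents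
    by a multiple of l^2, while all losses (the union over edge numbers, the choice of overlap
    sizes, the prescribed edge number, the rounding of the density) are at most polynomial in L,
    that is exp(O(l)). The obstacle in the second moment is the factor n!. Two nearly total overlaps
    could each be any of about n! partial injections, but the joint exponent contains log n! only
    once and pays for one of them. Asymmetry ties the second injection to the first and so removes
    the other n!. It is needed only while at most w points are missing, with w of order sqrt n:
    beyond that, n! <= n^n costs at most w log n per missing point, which is small against L. *)

Definition wt p (b : bool) : R := if b then p else 1 - p.
Definition wgt p P S : R := \prod_(e in P) wt p (e \in S).

Lemma sum_subsets_prod P (F : E -> bool -> R) :
  \sum_(S : {set E} | S \subset P) \prod_(e in P) F e (e \in S)
  = \prod_(e in P) (F e true + F e false).
Proof.
rewrite big_mkcond [RHS]big_mkcond /=.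
(* Outside [P] the factor is 0 for membership and 1 for non-membership, so in the expansion over all
   sets only subsets of [P] survive. *)
transitivity (\prod_e ((if e \in P then F e true else 0) +
                       (if e \in P then F e false else 1))).
  rewrite bigA_distr; apply: eq_big => // S _.
  case: ifPn => [sSP|].
    rewrite big_mkcond; apply: eq_bigr => e _.
    case: ifPn => [eP|eP]; first by case: ifP.
    by case: ifPn => // eS; rewrite (fintype.subsetP sSP _ eS) in eP.
  move=> /fintype.subsetPn [e eS eP].
  by rewrite (bigD1 e) //= eS (negbTE eP) mul0r.
by apply: eq_bigr => e _; case: ifP => // _; rewrite add0r.
Qed.

Lemma wt_sum p : wt p true + wt p false = 1.
Proof. by rewrite /wt addrC subrK. Qed.

Lemma wgt_total p P : \sum_(S : {set E} | S \subset P) wgt p P S = 1.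
Proof.
rewrite (sum_subsets_prod P (fun _ => wt p)).
by under eq_bigr do rewrite wt_sum; rewrite big1.
Qed.

Lemma wt_ge0 p b : 0 <= p <= 1 -> 0 <= wt p b.
Proof. by move=> /andP[p0 p1]; case: b => //=; rewrite /wt subr_ge0. Qed.

Lemma wt_gt0 p b : 0 < p < 1 -> 0 < wt p b.
Proof. by move=> /andP[p0 p1]; case: b => //=; rewrite /wt subr_gt0. Qed.

Lemma wgt_ge0 p P S : 0 <= p <= 1 -> 0 <= wgt p P S.
Proof. by move=> hp; apply: prodr_ge0 => e _; exact: wt_ge0. Qed.

Definition agrees Q (pat : pred E) S := [forall e in Q, (e \in S) == pat e].

Lemma Pr_agrees p P Q (pat : pred E) : Q \subset P ->
  \sum_(S : {set E} | S \subset P) wgt p P S * (agrees Q pat S)%:R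
  = \prod_(e in Q) wt p (pat e).
Proof.
move=> sQP.
pose F e b := if e \in Q then (if b == pat e then wt p b else 0) else wt p b.
transitivity (\prod_(e in P) (F e true + F e false)).
  rewrite -sum_subsets_prod; apply: eq_bigr => S sSP; rewrite /F.
  rewrite /agrees; case: forall_inP => [h|h].
    rewrite mulr1; apply: eq_bigr => e eP; case: ifP => // eQ.
    by rewrite h.
  rewrite mulr0; symmetry; apply/eqP; rewrite prodf_seq_eq0; apply/hasP.
  have [e eQ eS] : exists2 e, e \in Q & (e \in S) != pat e.
    apply/exists_inP; apply: contra_notT h; rewrite negb_exists => /forallP h e eQ.
    by have := h e; rewrite eQ /= negbK.
  exists e; first by rewrite mem_index_enum.
  by rewrite (fintype.subsetP sQP) //= eQ (negbTE eS).
rewrite (big_setID Q) /= (finset.setIidPr sQP) [X in _ * X]big1 ?mulr1.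
  by apply: eq_bigr => e eQ; rewrite /F eQ; case: (pat e); rewrite /= ?addr0 ?add0r.
by move=> e /finset.setDP [_ eQ]; rewrite /F (negbTE eQ) wt_sum.
Qed.

(** Prescribing [S] on [Q1] and on [Q2] is prescribing it on the union, where the elements of
    [Q1 :&: Q2] are charged once and not twice. The division is cleared, so [p] may be 0 or 1. *)
Lemma Pr_agrees2 p P Q1 Q2 (pat1 pat2 : pred E) : Q1 \subset P -> Q2 \subset P ->
  (\sum_(S : {set E} | S \subset P)
     wgt p P S * (agrees Q1 pat1 S && agrees Q2 pat2 S)%:R)
    * \prod_(e in Q1 :&: Q2) wt p (pat1 e)
  = [forall e in Q1 :&: Q2, pat1 e == pat2 e]%:R
    * (\prod_(e in Q1) wt p (pat1 e) * \prod_(e in Q2) wt p (pat2 e)).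
Proof.
move=> sQ1 sQ2; case: forall_inP => [h|h]; last first.
  rewrite mul0r [X in X * _]big1 ?mul0r // => S _.
  case: (boolP (_ && _)) => [/andP[/forall_inP h1 /forall_inP h2]|_]; last first.
    by rewrite mulr0.
  case: h => e /finset.setIP[e1 e2]; by rewrite -(eqP (h1 _ e1)) -(eqP (h2 _ e2)).
pose pat e := if e \in Q1 then pat1 e else pat2 e.
have E1 S : (agrees Q1 pat1 S && agrees Q2 pat2 S) = agrees (Q1 :|: Q2) pat S.
  apply/andP/forall_inP => [[/forall_inP h1 /forall_inP h2] e|h'].
    by rewrite finset.in_setU /pat; case: ifP => [e1 _|_ /= e2]; [exact: h1|exact: h2].
  split; apply/forall_inP => e eQ.
    by have := h' e; rewrite finset.in_setU /pat eQ; apply.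
  have := h' e; rewrite finset.in_setU /pat eQ orbT => /(_ isT).
  case: ifP => // e1 /eqP ->; apply: h; exact/finset.setIP.
rewrite [X in X * _](eq_bigr (fun S => wgt p P S * (agrees (Q1 :|: Q2) pat S)%:R));
  last by move=> S _; rewrite E1.
rewrite Pr_agrees ?finset.subUset ?sQ1 // mul1r.
rewrite [X in _ = _ * X](big_setID (Q1 :&: Q2)) /= [RHS]mulrA [RHS]mulrAC.
rewrite [X in _ * X = _](eq_bigr (fun e => wt p (pat2 e))); last first.
  by move=> e eI; rewrite (eqP (h _ eI)).
rewrite [X in _ * X = _](eq_bigl (mem (Q2 :&: (Q1 :&: Q2)))); last first.
  by move=> e; rewrite !inE; case: (e \in Q1); case: (e \in Q2).
congr (_ * _).
rewrite (big_setID Q1) /= finset.setUK finset.setDUl finset.setDv finset.set0U.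
congr (_ * _); first by apply: eq_bigr => e eQ; rewrite /pat eQ.
rewrite [RHS](eq_bigl (mem (Q2 :\: Q1))).
  by apply: eq_bigr => e /finset.setDP[_ /negbTE eQ]; rewrite /pat eQ.
by move=> e; rewrite !inE; case: (e \in Q1); case: (e \in Q2).
Qed.

Lemma wgt_card p P S : S \subset P ->
  wgt p P S = p ^+ #|S| * (1 - p) ^+ (#|P| - #|S|).
Proof.
move=> sSP; rewrite /wgt (big_setID S) /= (finset.setIidPr sSP).
rewrite (eq_bigr (fun=> p)) ?prodr_const; last by move=> e ->.
rewrite (eq_bigr (fun=> 1 - p)) ?prodr_const; last first.
  by move=> e /finset.setDP[_ /negbTE->].
by rewrite cardsD (finset.setIidPr sSP).
Qed.

Definition evr_eq Q (g : E -> E) S := [forall e in Q, (e \in S) == (g e \in S)].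

(** As [Q] and its image are disjoint and [g] is injective on [Q], the memberships of [e] and [g e]
    are independent; they agree with probability p^2 + (1-p)^2, independently for different [e]. *)
Lemma Pr_evr_eq p P Q (g : E -> E) : 0 <= p <= 1 ->
  Q \subset P -> {in Q &, injective g} -> g @: Q \subset P ->
  [disjoint Q & g @: Q] ->
  \sum_(S : {set E} | S \subset P) wgt p P S * (evr_eq Q g S)%:R
  <= (p ^+ 2 + (1 - p) ^+ 2) ^+ #|Q|.
Proof.
move=> hp sQP injg sgP dis.
pose pat (U : {set E}) e := if e \in Q then e \in U else e \in g @: U.
have key S : (evr_eq Q g S)%:R <=
   \sum_(U : {set E} | U \subset Q) (agrees (Q :|: g @: Q) (pat U) S)%:R :> R.
  rewrite /evr_eq; case: forall_inP => [h|_]; last exact: sumr_ge0.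
  rewrite (bigD1 (Q :&: S)) ?subsetIl //= ler_wpDr ?sumr_ge0 //.
  suff -> : agrees (Q :|: g @: Q) (pat (Q :&: S)) S by [].
  apply/forall_inP => e; rewrite !inE /pat; case: ifPn => [eQ _|eQ /=].
    by rewrite inE eQ.
  move=> z; case/finset.imsetP: z => x xQ ex; rewrite ex -(eqP (h _ xQ)).
  apply/eqP; apply/idP/finset.imsetP => [xS|[y]]; first by exists x => //; rewrite inE xQ.
  by rewrite inE => /andP[yQ yS] /(injg _ _ xQ yQ) ->.
apply: (@le_trans _ _ (\sum_(S : {set E} | S \subset P) \sum_(U : {set E} | U \subset Q)
   wgt p P S * (agrees (Q :|: g @: Q) (pat U) S)%:R)).
  apply: ler_sum => S _; rewrite -mulr_sumr ler_wpM2l ?wgt_ge0 //.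
rewrite exchange_big /=.
under eq_bigr => U sU do rewrite Pr_agrees ?finset.subUset ?sQP //.
rewrite -prodr_const.
have -> : \prod_(e in Q) (p ^+ 2 + (1 - p) ^+ 2)
   = \prod_(e in Q) ((wt p true) ^+ 2 + (wt p false) ^+ 2) by [].
rewrite -(sum_subsets_prod Q (fun e b => (wt p b) ^+ 2)).
apply: ler_sum => U sUQ.
rewrite le_eqVlt; apply/orP; left; apply/eqP.
rewrite (eq_bigl [predU Q & g @: Q]); last first.
  by move=> e; rewrite finset.in_setU.
rewrite bigU //=.
rewrite [X in _ * X]big_imset //= -big_split /=.
apply: eq_bigr => e eQ; rewrite /pat eQ.
have -> : (g e \in Q) = false.
  by apply: (disjointFl dis); apply: imset_f.
suff -> : (g e \in g @: U) = (e \in U) by rewrite expr2.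
apply/finset.imsetP/idP => [[x xU]|eU]; last by exists e.
by move=> /(injg _ _ eQ (fintype.subsetP sUQ _ xU)) ->.
Qed.

End RandomSubset.

(** * Pull-backs of edge sets and overlaps of embeddings *)

Definition pairs (T : finType) (K : {set T}) : {set {set T}} :=
  [set e : {set T} | (e \subset K) && (#|e| == 2)]%SET.

(** The graph that [G] induces on the image of [f], read back on [T]. Isomorphism of induced
    subgraphs thus becomes equality of two pull-backs. *)
Definition pb (T V : finType) (f : T -> V) (G : {set {set V}}) : {set {set T}} :=
  [set e in pairs [set: T] | f @: e \in G]%SET.

Section Pairs.
Variables (T V : finType).
Implicit Types (K : {set T}) (f : T -> V) (H : {set {set T}}).

Lemma card_pairs K : #|pairs K| = 'C(#|K|, 2).
Proof. exact: cards_draws. Qed.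

Lemma pairsS K K' : (K \subset K' -> pairs K \subset pairs K')%SET.
Proof.
move=> sK; apply/fintype.subsetP => e; rewrite !inE => /andP[eK ->].
by rewrite (fintype.subset_trans eK sK).
Qed.

Lemma pairsT K : (pairs K \subset pairs [set: T])%SET.
Proof. exact/pairsS/finset.subsetT. Qed.

Lemma pairsI K K' : (pairs K :&: pairs K' = pairs (K :&: K'))%SET.
Proof.
apply/finset.setP => e; rewrite !inE finset.subsetI.
by case: (_ \subset _); case: (_ \subset _); case: (_ == _).
Qed.

Lemma imset_inj_in K f : {in K &, injective f} ->
  {in [pred e : {set T} | e \subset K] &, injective (fun e : {set T} => f @: e)%SET}.
Proof.
move=> fi e1 e2; rewrite !inE => s1 s2 eq; apply/finset.setP => x.
apply/idP/idP => xe.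
  have : f x \in (f @: e1)%SET by apply: imset_f.
  rewrite eq => /finset.imsetP[y ye]; move=> /fi ->//; first exact: (fintype.subsetP s1).
  exact: (fintype.subsetP s2).
have : f x \in (f @: e2)%SET by apply: imset_f.
rewrite -eq => /finset.imsetP[y ye]; move=> /fi ->//; first exact: (fintype.subsetP s2).
exact: (fintype.subsetP s1).
Qed.

Lemma imset_pairs_inj K f : {in K &, injective f} ->
  {in pairs K &, injective (fun e : {set T} => f @: e)%SET}.
Proof.
move=> fi e1 e2; rewrite !inE => /andP[s1 _] /andP[s2 _].
exact: (imset_inj_in fi).
Qed.

Lemma imset_pairs K f : {in K &, injective f} ->
  ((fun e : {set T} => f @: e) @: pairs K = pairs (f @: K))%SET.
Proof.
move=> fi; apply/finset.setP => e; apply/finset.imsetP/idP.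
  move=> [e0]; rewrite !inE => /andP[s0 /eqP c0] ->.
  rewrite finset.imsetS //= card_in_imset ?c0 // => x y xe ye.
  by apply: fi; apply: (fintype.subsetP s0).
rewrite !inE => /andP[se /eqP ce].
have E : e = (f @: [set x in K | f x \in e])%SET.
  apply/finset.setP => y; apply/idP/finset.imsetP => [ye|[x]].
    have /finset.imsetP[x xK yx] := fintype.subsetP se _ ye.
    by exists x => //; rewrite inE xK -yx.
  by rewrite inE => /andP[_ h] ->.
exists [set x in K | f x \in e]%SET => //.
have sK : [set x in K | f x \in e]%SET \subset K.
  by apply/fintype.subsetP => x; rewrite inE => /andP[].
rewrite inE sK /= -ce {2}E card_in_imset // => x y xe ye.
by apply: fi; apply: (fintype.subsetP sK).
Qed.

Lemma pb_sub f G : pb f G \subset pairs [set: T]%SET.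
Proof. by apply/fintype.subsetP => e; rewrite inE => /andP[]. Qed.

Definition pinv f (e : {set V}) : {set T} := [set x | f x \in e]%SET.

Lemma pinvK f (e : {set T}) : injective f -> pinv f (f @: e)%SET = e.
Proof.
move=> fi; apply/finset.setP => x; rewrite inE.
by apply/finset.imsetP/idP => [[y ye /fi ->]|xe] //; exists x.
Qed.

Lemma pb_eq_agrees f H (G : {set {set V}}) : injective f -> H \subset pairs [set: T]%SET ->
  (pb f G == H) = agrees (pairs (f @: [set: T]))%SET (fun e => pinv f e \in H) G.
Proof.
move=> fi sH; have fi' : {in [set: T]%SET &, injective f} by move=> x y _ _ /fi.
apply/eqP/forall_inP => [E e|h].
  rewrite -imset_pairs // => /finset.imsetP[e0 e0P ->].
  by rewrite pinvK // -E inE e0P.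
apply/finset.setP => e; rewrite inE.
case: (boolP (e \in _)) => [eP|eP] /=.
  have := h (f @: e)%SET; rewrite pinvK // => /(_ _)/eqP -> //.
  by rewrite -imset_pairs //; apply: imset_f.
by apply/esym/negbTE; apply: contra eP; apply: (fintype.subsetP sH).
Qed.

End Pairs.
#[global] Hint Resolve pairsT : core.

(** * Joint law of two embeddings in terms of their overlap *)

Section Overlap.
Variables (R : realType) (T V : finType).
Implicit Types (f : T -> V) (H : {set {set T}}) (th : {ffun T -> option T}) (p : R).

Lemma prod_imset_pairs (W : finType) (K : {set T}) (g : T -> W) (F : {set W} -> R) :
  {in K &, injective g} ->
  \prod_(e in pairs (g @: K)%SET) F e = \prod_(e in pairs K) F (g @: e)%SET.
Proof. by move=> gi; rewrite -imset_pairs // big_imset //=; exact: imset_pairs_inj. Qed.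

Lemma Pr_pb p f H : injective f -> H \subset pairs [set: T]%SET ->
  \sum_(G : {set {set V}} | G \subset pairs [set: V]%SET)
     wgt p (pairs [set: V]%SET) G * (pb f G == H)%:R = wgt p (pairs [set: T]%SET) H.
Proof.
move=> fi sH.
under eq_bigr do rewrite pb_eq_agrees //.
rewrite Pr_agrees ?pairsT // prod_imset_pairs; last by move=> x y _ _ /fi.
by apply: eq_bigr => e _; rewrite pinvK.
Qed.

Definition dom th : {set T} := [set x | isSome (th x)]%SET.
Definition tot th x : T := odflt x (th x).
Definition pinj th := [forall x, forall y, isSome (th x) && (th x == th y) ==> (x == y)].
(* th := overlap f f' satisfies f (th y) = f' y wherever the images meet *)
Definition overlap f f' : {ffun T -> option T} := [ffun y => [pick x | f x == f' y]].
Definition compat th H H' :=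
  agrees (pairs (dom th)) (fun e => (tot th @: e)%SET \in H) H'.

Lemma pinjP th x y : pinj th -> x \in dom th -> y \in dom th -> tot th x = tot th y -> x = y.
Proof.
move=> /forallP/(_ x)/forallP/(_ y); rewrite !inE /tot => /implyP h.
case ex : (th x) h => [a|] //; case ey : (th y) => [b|] //= h _ _ ab.
by apply/eqP/h; rewrite ab.
Qed.

Lemma tot_inj th : pinj th -> {in dom th &, injective (tot th)}.
Proof. by move=> ip x y xd yd; apply: pinjP. Qed.

Lemma overlapP f f' y : y \in dom (overlap f f') -> f (tot (overlap f f') y) = f' y.
Proof. by rewrite inE /tot ffunE; case: pickP => //= x /eqP. Qed.

Lemma overlap_pinj f f' : injective f' -> pinj (overlap f f').
Proof.
move=> fi; apply/forallP => x; apply/forallP => y; apply/implyP; rewrite !ffunE.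
case: pickP => //= a /eqP ea; case: pickP => // b /eqP eb /eqP[ab].
by apply/eqP/fi; rewrite -ea -eb ab.
Qed.

Lemma overlap_dom f f' : injective f ->
  (tot (overlap f f') @: dom (overlap f f') = [set x | f x \in f' @: [set: T]])%SET.
Proof.
move=> fi; apply/finset.setP => x; apply/finset.imsetP/idP.
  by move=> [y yd ->]; rewrite inE overlapP //; apply: imset_f; rewrite inE.
rewrite inE => /finset.imsetP[y _ E].
have yd : y \in dom (overlap f f').
  by rewrite inE ffunE; case: pickP => // /(_ x); rewrite E eqxx.
by exists y => //; apply: fi; rewrite overlapP.
Qed.

(** The pairs inside both images are the [f]-images of the pairs in the range of the overlap. They
    are charged once only, and on them [H] and [H'] must match. *)
Lemma Pr_pb2 p f f' H H' : 0 < p < 1 -> injective f -> injective f' ->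
  H \subset pairs [set: T]%SET -> H' \subset pairs [set: T]%SET ->
  (\sum_(G : {set {set V}} | G \subset pairs [set: V]%SET)
     wgt p (pairs [set: V]%SET) G * ((pb f G == H) && (pb f' G == H'))%:R)
   * \prod_(e in pairs (tot (overlap f f') @: dom (overlap f f'))%SET) wt p (e \in H)
  <= (compat (overlap f f') H H')%:R *
    (wgt p (pairs [set: T]%SET) H * wgt p (pairs [set: T]%SET) H').
Proof.
move=> hp fi fi' sH sH'.
have fT : {in [set: T]%SET &, injective f} by move=> x y _ _ /fi.
have fT' : {in [set: T]%SET &, injective f'} by move=> x y _ _ /fi'.
rewrite [X in X * _](eq_bigr (fun G => wgt p (pairs [set: V]%SET) G *
  (agrees (pairs (f @: [set: T]))%SET (fun e => pinv f e \in H) G &&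
   agrees (pairs (f' @: [set: T]))%SET (fun e => pinv f' e \in H') G)%:R));
  last by move=> G _; rewrite !pb_eq_agrees.
have := Pr_agrees2 p (fun e => pinv f e \in H) (fun e => pinv f' e \in H')
  (pairsT (f @: [set: T])%SET) (pairsT (f' @: [set: T])%SET).
rewrite pairsI.
have E : ((f @: [set: T]) :&: (f' @: [set: T]) =
   f @: (tot (overlap f f') @: dom (overlap f f')))%SET.
  rewrite overlap_dom //; apply/finset.setP => v; rewrite inE.
  apply/andP/finset.imsetP => [[/finset.imsetP[x _ ->] h]|[x]].
    by exists x => //; rewrite inE.
  by rewrite inE => h ->; split => //; apply: imset_f; rewrite inE.
have -> : \prod_(e in pairs (f @: [set: T] :&: f' @: [set: T])%SET) wt p (pinv f e \in H)
   = \prod_(e in pairs (tot (overlap f f') @: dom (overlap f f'))%SET) wt p (e \in H).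
  rewrite E prod_imset_pairs; last by move=> x y _ _ /fi.
  by apply: eq_bigr => e _; rewrite pinvK.
move=> ->.
rewrite !prod_imset_pairs //.
rewrite (eq_bigr (fun e => wt p (e \in H))); last by move=> e _; rewrite pinvK.
rewrite [X in _ * (_ * X)](eq_bigr (fun e => wt p (e \in H'))); last by move=> e _; rewrite pinvK.
rewrite ler_wpM2r ?mulr_ge0 ?wgt_ge0 //; try by case/andP: hp => /ltW -> /ltW ->.
rewrite ler_nat; case: forall_inP => //= h.
suff -> : compat (overlap f f') H H' by [].
apply/forall_inP => e eP.
have e2 : (f' @: e = f @: (tot (overlap f f') @: e))%SET.
  rewrite -imset_comp; apply: eq_in_imset => x xe /=; rewrite overlapP //.
  by move: eP; rewrite inE => /andP[/fintype.subsetP -> //].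
have := h (f' @: e)%SET; rewrite pinvK // {2}e2 pinvK // eq_sym; apply.
rewrite E e2 -imset_pairs; last by move=> x y _ _ /fi.
apply: imset_f; rewrite -imset_pairs; last by apply: tot_inj; exact: overlap_pinj.
exact: imset_f.
Qed.

Definition coherent th1 th2 H :=
  [forall e in pairs (dom th1 :&: dom th2)%SET,
     ((tot th1 @: e)%SET \in H) == ((tot th2 @: e)%SET \in H)].

(** Now [H'] itself is random: each of [th1], [th2] prescribes [H'] on its domain, and the two
    prescriptions meet on the common domain. *)
Lemma Pr_compat2 p th1 th2 H : pinj th1 -> pinj th2 ->
  (\sum_(H' : {set {set T}} | H' \subset pairs [set: T]%SET)
     wgt p (pairs [set: T]%SET) H' * (compat th1 H H' && compat th2 H H')%:R)
   * \prod_(e in pairs (tot th1 @: (dom th1 :&: dom th2))%SET) wt p (e \in H)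
  = (coherent th1 th2 H)%:R *
    (\prod_(e in pairs (tot th1 @: dom th1)%SET) wt p (e \in H) *
     \prod_(e in pairs (tot th2 @: dom th2)%SET) wt p (e \in H)).
Proof.
move=> i1 i2.
rewrite !prod_imset_pairs; try exact: tot_inj; last first.
  by move=> x y /finset.setIP[x1 _] /finset.setIP[y1 _]; exact: tot_inj.
have := Pr_agrees2 p (fun e : {set T} => (tot th1 @: e)%SET \in H) (fun e : {set T} => (tot th2 @: e)%SET \in H)
  (pairsT (dom th1)) (pairsT (dom th2)).
by rewrite pairsI.
Qed.

End Overlap.

(** * The second moment method *)

(** Chebyshev's inequality: where [X] vanishes its squared deviation is mu^2, and the variance is at
    most eps mu^2. *)
Lemma second_moment_zero (R : realType) (I : finType) (P : pred I) (w X : I -> R) (eps : R) :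
  (forall i, P i -> 0 <= w i) -> \sum_(i | P i) w i = 1 ->
  0 < \sum_(i | P i) w i * X i ->
  \sum_(i | P i) w i * X i ^+ 2 <= (1 + eps) * (\sum_(i | P i) w i * X i) ^+ 2 ->
  \sum_(i | P i && (X i == 0)) w i <= eps.
Proof.
move=> w0 w1 mu0 h2; set mu := \sum_(i | P i) w i * X i in mu0 h2 *.
have mu2 : 0 < mu ^+ 2 by rewrite exprn_gt0.
rewrite -(ler_pM2r mu2).
apply: (@le_trans _ _ (\sum_(i | P i) w i * (X i - mu) ^+ 2)).
  rewrite mulr_suml [leRHS](bigID (fun i => X i == 0)) /= ler_wpDr //.
    by apply: sumr_ge0 => i /andP[/w0 ? _]; rewrite mulr_ge0 ?sqr_ge0.
  by apply: ler_sum => i /andP[_ /eqP->]; rewrite sub0r sqrrN.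
have -> : \sum_(i | P i) w i * (X i - mu) ^+ 2 =
    \sum_(i | P i) w i * X i ^+ 2 - mu ^+ 2.
  transitivity (\sum_(i | P i) (w i * X i ^+ 2 - 2 * mu * (w i * X i) + mu ^+ 2 * w i)).
    by apply: eq_bigr => i _; ring.
  by rewrite big_split /= sumrB -!mulr_sumr w1 -/mu; ring.
by rewrite lerBlDr; apply: (le_trans h2); rewrite le_eqVlt; apply/orP; left; apply/eqP; ring.
Qed.

Section SecondMoment.
Variables (R : realType) (T V : finType) (p1 p2 p : R) (m : nat).
Variable (GG : {set {set {set T}}}).
Hypotheses (hp1 : 0 < p1 < 1) (hp2 : 0 < p2 < 1) (hp : 0 < p < 1).
Let PT := pairs [set: T]%SET.
Let PV := pairs [set: V]%SET.
Hypothesis GGP : forall H, H \in GG -> H \subset PT /\ #|H| = m.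
Implicit Types (f : {ffun T -> V}) (H : {set {set T}}) (th : {ffun T -> option T}).

Definition injs : {set {ffun T -> V}} := [set f : {ffun T -> V} | injectiveb f]%SET.

Lemma injsP f : reflect (injective f) (f \in injs).
Proof. by rewrite inE; exact: injectiveP. Qed.

Lemma card_injs : #|injs| = (#|V| ^_ #|T|)%N.
Proof. exact: card_inj_ffuns. Qed.

(** On [dom th] the value [f' y] must be [f (tot th y)]; every other point has at most [#|V|]
    choices. *)
Lemma card_overlap f th : 
  (#|[set f' : {ffun T -> V} | overlap f f' == th]%SET| <= #|V| ^ (#|T| - #|dom th|))%N.
Proof.
pose F (y : T) : {pred V} := if y \in dom th then pred1 (f (tot th y)) else predT.
apply: (@leq_trans #|family F|).
  apply: subset_leq_card; apply/fintype.subsetP => f'; rewrite inE => /eqP E.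
  apply/familyP => y; rewrite /F; case: ifP => // yd.
  by rewrite inE -E overlapP ?E.
rewrite card_family foldrE big_map enumT -/(index_enum T) /=.
rewrite (bigID (mem (dom th))) /= big1 ?mul1n; last first.
  by move=> y yd; rewrite /F yd card1.
rewrite (eq_bigr (fun=> #|V|)); last by move=> y /negbTE yd; rewrite /F yd.
rewrite prod_nat_const leq_eqVlt; apply/orP; left; apply/eqP; congr expn.
by rewrite -(cardC (mem (dom th))) addKn; apply: eq_card => y; rewrite !inE.
Qed.

Lemma sum_overlap f (g : {ffun T -> option T} -> R) :
  (forall th, 0 <= g th) ->
  \sum_(f' in injs) g (overlap f f') <=
  \sum_(th | pinj th) #|V|%:R ^+ (#|T| - #|dom th|) * g th.
Proof.
move=> g0; rewrite (partition_big (fun f' : {ffun T -> V} => overlap f f') (@pinj T)) /=; last first.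
  by move=> f' /injsP; exact: overlap_pinj.
apply: ler_sum => th _.
rewrite (eq_bigr (fun=> g th)); last by move=> f' /andP[_ /eqP ->].
rewrite sumr_const -[_ *+ _]mulr_natl ler_wpM2r // -natrX ler_nat.
apply: leq_trans (card_overlap f th).
by apply: subset_leq_card; apply/fintype.subsetP => f'; rewrite inE => /andP[].
Qed.

Definition W (r : R) (K : {set T}) H : R := \prod_(e in pairs K) wt r (e \in H).

Lemma W_gt0 r K H : 0 < r < 1 -> 0 < W r K H.
Proof. by move=> hr; apply: prodr_gt0 => e _; exact: wt_gt0. Qed.

Definition im th : {set T} := (tot th @: dom th)%SET.
(** An overlap of at most one point contains no pair, so it creates no dependence between the
    embeddings. *)
Definition bad th1 th2 : bool := (1 < #|dom th1|)%N || (1 < #|dom th2|)%N.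

(** Embeddings are labelled, so a common copy is counted with all its relabellings that stay in
    [GG]. For the second moment only positivity matters; the first moment divides by n!. *)
Definition Xcount (G : {set {set V}} * {set {set V}}) : R :=
  \sum_(f1 in injs) \sum_(f2 in injs) \sum_(H in GG)
     (pb f1 G.1 == H)%:R * (pb f2 G.2 == H)%:R.

Let pi_ (r : R) := r ^+ m * (1 - r) ^+ (#|PT| - m).

Lemma wgt_GG r H : H \in GG -> wgt r PT H = pi_ r.
Proof. by move=> /GGP[sH cH]; rewrite wgt_card // cH. Qed.

Let pi_gt0 r : 0 < r < 1 -> 0 < pi_ r.
Proof. by move=> /andP[r0 r1]; rewrite mulr_gt0 ?exprn_gt0 ?subr_gt0. Qed.

Definition PP (G : {set {set V}} * {set {set V}}) : bool := (G.1 \subset PV) && (G.2 \subset PV).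
Definition ww (G : {set {set V}} * {set {set V}}) : R := wgt p1 PV G.1 * wgt p2 PV G.2.

Lemma sum_ww (a b : {set {set V}} -> R) :
  \sum_(G | PP G) ww G * (a G.1 * b G.2) =
  (\sum_(G : {set {set V}} | G \subset PV) wgt p1 PV G * a G) *
  (\sum_(G : {set {set V}} | G \subset PV) wgt p2 PV G * b G).
Proof.
rewrite mulr_suml; under [RHS]eq_bigr do rewrite mulr_sumr.
rewrite pair_big /=; apply: eq_bigr => G _; rewrite /ww; ring.
Qed.

Lemma ww_ge0 G : 0 <= ww G.
Proof.
by rewrite mulr_ge0 // wgt_ge0 //; [case/andP: hp1|case/andP: hp2] => /ltW-> /ltW->.
Qed.

Lemma ww_total : \sum_(G | PP G) ww G = 1.
Proof.
have := sum_ww (fun=> 1) (fun=> 1).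
under eq_bigr do rewrite !mulr1.
move=> ->; under eq_bigr do rewrite mulr1.
by under [X in _ * X]eq_bigr do rewrite mulr1; rewrite !wgt_total mulr1.
Qed.

Lemma EXcount : \sum_(G | PP G) ww G * Xcount G =
  #|injs|%:R ^+ 2 * #|GG|%:R * (pi_ p1 * pi_ p2).
Proof.
under eq_bigr do rewrite /Xcount mulr_sumr.
rewrite exchange_big /=.
transitivity (\sum_(f1 in injs) \sum_(f2 in injs) \sum_(H in GG) (pi_ p1 * pi_ p2)); last first.
  by rewrite !sumr_const -!mulrnA -[LHS]mulr_natl !natrM; ring.
apply: eq_bigr => f1 /injsP i1.
under eq_bigr do rewrite mulr_sumr.
rewrite exchange_big /=; apply: eq_bigr => f2 /injsP i2.
under eq_bigr do rewrite mulr_sumr.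
rewrite exchange_big /=; apply: eq_bigr => H HG; have [sH _] := GGP HG.
rewrite (sum_ww (fun G => (pb f1 G == H)%:R) (fun G => (pb f2 G == H)%:R)).
by rewrite !Pr_pb // !(@wgt_GG _ H).
Qed.

(** Sum over [H'] of a bound for the ratio between the joint probability of the four embedding
    events and the product of their separate probabilities. *)
Definition ZZ H th1 th2 : R :=
  (\sum_(H' in GG) (compat th1 H H' && compat th2 H H')%:R) / (W p1 (im th1) H * W p2 (im th2) H).

Lemma ZZ_ge0 H th1 th2 : 0 <= ZZ H th1 th2.
Proof.
rewrite divr_ge0 ?sumr_ge0 // mulr_ge0 // ltW //; exact: W_gt0.
Qed.

Lemma ZZ_good H th1 th2 : ~~ bad th1 th2 -> ZZ H th1 th2 <= #|GG|%:R.
Proof.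
rewrite negb_or -!leqNgt => /andP[d1 d2].
have W1 r th : (#|dom th| <= 1)%N -> W r (im th) H = 1.
  move=> d; rewrite /W big1 // => e; rewrite !inE => /andP[se /eqP ce].
  have := leq_trans (subset_leq_card se) (leq_imset_card _ _).
  by rewrite ce => /leq_trans/(_ d).
rewrite /ZZ !W1 // mulr1 divr1 -sumr_const.
by apply: ler_sum => H' _; case: (_ && _).
Qed.

(** The compatible [H'] are counted by a change of measure: at the auxiliary density [p] every
    member of [GG] has the same weight [pi_ p], and enlarging the sum to all graphs makes
    [Pr_compat2] applicable. *)
Lemma ZZ_bad H th1 th2 : H \in GG -> pinj th1 -> pinj th2 ->
  ZZ H th1 th2 * pi_ p <= (coherent th1 th2 H)%:R *
    (W p (im th1) H / W p1 (im th1) H) * (W p (im th2) H / W p2 (im th2) H)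
     / W p (tot th1 @: (dom th1 :&: dom th2))%SET H.
Proof.
move=> HG i1 i2.
have := Pr_compat2 p H i1 i2.
rewrite -/PT -/(W p _ H) -/(W p _ H) -/(W p _ H) -/(im th1) -/(im th2) => E.
have Wn0 r K : 0 < r < 1 -> W r K H != 0 by move=> hr; rewrite gt_eqF ?W_gt0.
rewrite ler_pdivlMr ?W_gt0 //.
set A := (coherent th1 th2 H)%:R in E *.
have -> : A * (W p (im th1) H / W p1 (im th1) H) * (W p (im th2) H / W p2 (im th2) H) =
  A * (W p (im th1) H * W p (im th2) H) / (W p1 (im th1) H * W p2 (im th2) H).
  by field; rewrite !Wn0.
rewrite -E /ZZ.
rewrite [leLHS](_ : _ = (\sum_(H' in GG) (compat th1 H H' && compat th2 H H')%:R) * pi_ p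
   * W p (tot th1 @: (dom th1 :&: dom th2))%SET H / (W p1 (im th1) H * W p2 (im th2) H)); last first.
  by field; rewrite !Wn0.
rewrite ler_wpM2r ?invr_ge0 ?mulr_ge0 ?(ltW (W_gt0 _ _ _)) //.
rewrite ler_wpM2r ?(ltW (W_gt0 _ _ _)) //.
rewrite mulr_suml [leRHS](bigID (mem GG)) /= ler_wpDr //.
  by apply: sumr_ge0 => H' _; rewrite mulr_ge0 // wgt_ge0 //; case/andP: hp => /ltW -> /ltW ->.
rewrite [leRHS](eq_bigl (mem GG)); last first.
  by move=> H' /=; case HG' : (H' \in GG); rewrite ?andbF // (proj1 (GGP HG')).
by apply: ler_sum => H' HG'; rewrite wgt_GG // mulrC.
Qed.

Lemma EXcount2 (eps : R) :
  (forall H, H \in GG ->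
     \sum_(th1 | pinj th1) \sum_(th2 | pinj th2)
        #|V|%:R ^+ (#|T| - #|dom th1|) * #|V|%:R ^+ (#|T| - #|dom th2|) *
        ((bad th1 th2)%:R * ZZ H th1 th2) <= eps * (#|injs|%:R ^+ 2 * #|GG|%:R)) ->
  \sum_(G | PP G) ww G * Xcount G ^+ 2 <=
  (1 + eps) * (\sum_(G | PP G) ww G * Xcount G) ^+ 2.
Proof.
move=> hZ; rewrite EXcount.
pose J (r : R) f f' H H' := \sum_(G : {set {set V}} | G \subset PV)
     wgt r PV G * ((pb f G == H) && (pb f' G == H'))%:R.
have -> : \sum_(G | PP G) ww G * Xcount G ^+ 2 =
  \sum_(f1 in injs) \sum_(f2 in injs) \sum_(H in GG)
  \sum_(f1' in injs) \sum_(f2' in injs) \sum_(H' in GG) J p1 f1 f1' H H' * J p2 f2 f2' H H'.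
  transitivity (\sum_(G | PP G) \sum_(f1 in injs) \sum_(f2 in injs) \sum_(H in GG)
    \sum_(f1' in injs) \sum_(f2' in injs) \sum_(H' in GG)
    ww G * (((pb f1 G.1 == H) && (pb f1' G.1 == H'))%:R *
            ((pb f2 G.2 == H) && (pb f2' G.2 == H'))%:R)).
    apply: eq_bigr => G _.
    rewrite expr2 {1}/Xcount mulr_suml mulr_sumr; apply: eq_bigr => f1 _.
    rewrite mulr_suml mulr_sumr; apply: eq_bigr => f2 _.
    rewrite mulr_suml mulr_sumr; apply: eq_bigr => H _.
    rewrite /Xcount !mulr_sumr; apply: eq_bigr => f1' _.
    rewrite !mulr_sumr; apply: eq_bigr => f2' _.
    rewrite !mulr_sumr; apply: eq_bigr => H' _.
    by rewrite -!mulnb !natrM; ring.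
  rewrite exchange_big; apply: eq_bigr => f1 _.
  rewrite exchange_big; apply: eq_bigr => f2 _.
  rewrite exchange_big; apply: eq_bigr => H _.
  rewrite exchange_big; apply: eq_bigr => f1' _.
  rewrite exchange_big; apply: eq_bigr => f2' _.
  rewrite exchange_big; apply: eq_bigr => H' _.
  exact: (sum_ww (fun G => ((pb f1 G == H) && (pb f1' G == H'))%:R)
                 (fun G => ((pb f2 G == H) && (pb f2' G == H'))%:R)).
pose C := pi_ p1 * pi_ p2.
have C0 : 0 < C by rewrite mulr_gt0 ?pi_gt0.
have step f1 f2 H : f1 \in injs -> f2 \in injs -> H \in GG ->
  \sum_(f1' in injs) \sum_(f2' in injs) \sum_(H' in GG) J p1 f1 f1' H H' * J p2 f2 f2' H H'
  <= C ^+ 2 * ((1 + eps) * (#|injs|%:R ^+ 2 * #|GG|%:R)).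
  move=> /injsP i1 /injsP i2 HG; have [sH _] := GGP HG.
  have JJ f1' f2' : f1' \in injs -> f2' \in injs ->
    \sum_(H' in GG) J p1 f1 f1' H H' * J p2 f2 f2' H H' <=
    C ^+ 2 * ZZ H (overlap f1 f1') (overlap f2 f2').
    move=> /injsP i1' /injsP i2'.
    rewrite /ZZ mulr_suml mulr_sumr; apply: ler_sum => H' HG'; have [sH' _] := GGP HG'.
    have W1 := W_gt0 (im (overlap f1 f1')) H hp1.
    have W2 := W_gt0 (im (overlap f2 f2')) H hp2.
    have A1 : J p1 f1 f1' H H' <= (compat (overlap f1 f1') H H')%:R * (pi_ p1 * pi_ p1) / W p1 (im (overlap f1 f1')) H.
      by rewrite ler_pdivlMr // -{1}(wgt_GG p1 HG) -(wgt_GG p1 HG'); apply: Pr_pb2.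
    have A2 : J p2 f2 f2' H H' <= (compat (overlap f2 f2') H H')%:R * (pi_ p2 * pi_ p2) / W p2 (im (overlap f2 f2')) H.
      by rewrite ler_pdivlMr // -{1}(wgt_GG p2 HG) -(wgt_GG p2 HG'); apply: Pr_pb2.
    have J0 r f f' : 0 < r < 1 -> 0 <= J r f f' H H'.
      move=> /andP[r0 r1]; apply: sumr_ge0 => G _; rewrite mulr_ge0 // wgt_ge0 //.
      by rewrite (ltW r0) (ltW r1).
    apply: (le_trans (ler_pM (J0 _ _ _ hp1) (J0 _ _ _ hp2) A1 A2)).
    rewrite -mulnb natrM /C le_eqVlt; apply/orP; left; apply/eqP; field.
    by rewrite !gt_eqF.
  apply: (@le_trans _ _ (\sum_(f1' in injs) \sum_(f2' in injs)
     C ^+ 2 * (#|GG|%:R + (bad (overlap f1 f1') (overlap f2 f2'))%:R *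
          ZZ H (overlap f1 f1') (overlap f2 f2')))).
    apply: ler_sum => f1' i1'; apply: ler_sum => f2' i2'.
    apply: (le_trans (JJ _ _ i1' i2')); rewrite ler_pM2l ?exprn_gt0 //.
    (* Trivial overlaps produce the main term, the 1 in [1 + eps]; only the bad ones are charged to
       [eps]. *)
    case: (boolP (bad _ _)) => b; first by rewrite mul1r ler_wpDl.
    by rewrite mul0r addr0 ZZ_good.
  under eq_bigr do rewrite -mulr_sumr big_split /=.
  rewrite -mulr_sumr ler_pM2l ?exprn_gt0 // big_split /= !sumr_const.
  rewrite mulrDl mul1r lerD //.
    rewrite -mulrnA -[leLHS]mulr_natl natrM le_eqVlt; apply/orP; left; apply/eqP; ring.
  apply: le_trans (hZ H HG).
  apply: (@le_trans _ _ (\sum_(f1' in injs) \sum_(th2 | pinj th2)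
     #|V|%:R ^+ (#|T| - #|dom th2|) * ((bad (overlap f1 f1') th2)%:R * ZZ H (overlap f1 f1') th2))).
    apply: ler_sum => f1' _.
    apply: (sum_overlap f2 (g := fun th2 => (bad (overlap f1 f1') th2)%:R * ZZ H (overlap f1 f1') th2)).
    by move=> th; rewrite mulr_ge0 ?ZZ_ge0.
  apply: (le_trans (sum_overlap f1 (g := fun th1 => \sum_(th2 | pinj th2)
     #|V|%:R ^+ (#|T| - #|dom th2|) * ((bad th1 th2)%:R * ZZ H th1 th2)) _)).
    move=> th; apply: sumr_ge0 => th2 _; apply: mulr_ge0; first exact: exprn_ge0.
    by apply: mulr_ge0 => //; exact: ZZ_ge0.
  apply: ler_sum => th1 _; rewrite mulr_sumr; apply: ler_sum => th2 _.
  by rewrite mulrA.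
apply: (@le_trans _ _ (\sum_(f1 in injs) \sum_(f2 in injs) \sum_(H in GG)
   C ^+ 2 * ((1 + eps) * (#|injs|%:R ^+ 2 * #|GG|%:R)))).
  by apply: ler_sum => f1 i1; apply: ler_sum => f2 i2; apply: ler_sum => H HG; exact: step.
rewrite !sumr_const -!mulrnA -[leLHS]mulr_natl !natrM /C le_eqVlt; apply/orP; left; apply/eqP.
by ring.
Qed.

End SecondMoment.

(** * Counting overlap patterns *)

(** A map within distance [w] of [g0] is encoded by [w] positions covering all differences, padded
    with a fixed point [x0], and by its values there. *)
Lemma card_hamming_ball (A B : finType) (g0 : {ffun A -> B}) (w : nat) : (0 < #|A|)%N ->
  (#|[set g : {ffun A -> B} | (#|[set x | g x != g0 x]| <= w)%N]%SET| <= (#|A| * #|B|) ^ w)%N.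
Proof.
move=> /card_gt0P[x0 _].
pose F (ab : w.-tuple A * w.-tuple B) : {ffun A -> B} :=
  [ffun x => nth (g0 x) ab.2 (index x ab.1)].
suff sub : [set g : {ffun A -> B} | (#|[set x | g x != g0 x]| <= w)%N]%SET
   \subset (F @: [set: w.-tuple A * w.-tuple B])%SET.
  apply: (leq_trans (subset_leq_card sub)).
  apply: (leq_trans (leq_imset_card _ _)).
  by rewrite cardsT card_prod !card_tuple expnMn.
apply/fintype.subsetP => g; rewrite inE => gw.
set D := [set x | g x != g0 x]%SET in gw.
have sz : size (enum D ++ nseq (w - #|D|) x0) == w.
  by rewrite size_cat size_nseq -cardE subnKC.
pose a := Tuple sz.
apply/finset.imsetP; exists (a, [tuple of map g a]); first by rewrite inE.
apply/ffunP => x; rewrite ffunE /=.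
case: (boolP (x \in tval a)) => xa.
  by rewrite (nth_map x0) ?index_mem // nth_index.
rewrite nth_default; last by rewrite size_map leqNgt index_mem.
apply/eqP; apply: contraNT xa => gx.
by rewrite mem_cat mem_enum inE gx.
Qed.

Section Counting.
Variable (T : finType).
Local Notation n := #|T|.
Implicit Types (th : {ffun T -> option T}) (H : {set {set T}}).

Lemma tot_eq th x : x \in dom th -> th x = Some (tot th x).
Proof. by rewrite inE /tot; case: (th x). Qed.

Lemma notin_dom th x : x \notin dom th -> th x = None.
Proof. by rewrite inE; case: (th x). Qed.

Lemma card_im th : pinj th -> #|im th| = #|dom th|.
Proof. by move=> hi; rewrite card_in_imset //; exact: tot_inj. Qed.

Lemma card_pinj_dom (D : {set T}) :
  (#|[set th : {ffun T -> option T} | pinj th && (dom th == D)]%SET| <= n ^_ #|D|)%N.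
Proof.
pose F th : {ffun {x | x \in D} -> T} := [ffun x => tot th (val x)].
have -> : #|D| = #|{: {x | x \in D}}| by rewrite card_sig.
rewrite -card_inj_ffuns.
have Fi : {in [set th : {ffun T -> option T} | pinj th && (dom th == D)]%SET &, injective F}.
  move=> th1 th2; rewrite !inE => /andP[_ /eqP d1] /andP[_ /eqP d2] /ffunP E.
  apply/ffunP => x; case: (boolP (x \in D)) => xD.
    have := E (exist _ x xD); rewrite !ffunE /= => Ex.
    by rewrite !tot_eq ?d1 ?d2 // Ex.
  by rewrite !notin_dom ?d1 ?d2.
rewrite -(card_in_imset Fi); apply: subset_leq_card.
apply/fintype.subsetP => g /finset.imsetP[th]; rewrite !inE => /andP[ip /eqP d] ->.
apply/injectiveP => x y; rewrite !ffunE => /(pinjP ip) E.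
by apply: val_inj; apply: E; rewrite d; exact: valP.
Qed.

Lemma card_pinj (k : nat) :
  (#|[set th : {ffun T -> option T} | pinj th && (#|dom th| == k)]%SET| <= 'C(n, k) * n ^_ k)%N.
Proof.
rewrite -sum1dep_card (partition_big (@dom T) (fun D : {set T} => #|D| == k)) /=; last first.
  by move=> th /andP[].
rewrite -card_draws -sum1dep_card big_distrl /=; apply: leq_sum => D /eqP cD.
rewrite mul1n -cD; apply: leq_trans (card_pinj_dom D).
rewrite sum1dep_card; apply: subset_leq_card; apply/fintype.subsetP => th.
by rewrite !inE => /andP[/andP[-> _] ->].
Qed.

Lemma bin_leq_exp (a k : nat) : ('C(a, k) <= a ^ k)%N.
Proof.
apply: (@leq_trans (a ^_ k)); first by rewrite -bin_ffact leq_pmulr // fact_gt0.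
by rewrite -{2}(card_ord a) -{2}(card_ord k) -card_ffun -{1}(card_ord a) -{1}(card_ord k)
  -card_inj_ffuns max_card.
Qed.

Lemma ffact_leq_exp (a k : nat) : (a ^_ k <= a ^ k)%N.
Proof.
by rewrite -{2}(card_ord a) -{2}(card_ord k) -card_ffun -{1}(card_ord a) -{1}(card_ord k)
  -card_inj_ffuns max_card.
Qed.

Lemma ffact_leq_fact (a k : nat) : (a ^_ k <= a`!)%N.
Proof.
case: (leqP k a) => h; last by rewrite ffact_small.
by rewrite -(ffact_fact h) leq_pmulr // fact_gt0.
Qed.

Lemma card_pinj_small (k : nat) :
  (#|[set th : {ffun T -> option T} | pinj th && (#|dom th| == k)]%SET| <= n ^ (2 * k))%N.
Proof.
apply: (leq_trans (card_pinj k)).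
by rewrite mul2n -addnn expnD leq_mul ?bin_leq_exp ?ffact_leq_exp.
Qed.

Lemma card_pinj_large (k : nat) : (k <= n)%N ->
  (#|[set th : {ffun T -> option T} | pinj th && (#|dom th| == k)]%SET| <= n`! * n ^ (n - k))%N.
Proof.
move=> kn; apply: (leq_trans (card_pinj k)).
by rewrite mulnC leq_mul ?ffact_leq_fact // -bin_sub // bin_leq_exp.
Qed.

Definition self_map th H :=
  [forall e in pairs (dom th), ((tot th @: e)%SET \in H) == (e \in H)].

Definition asym w H := [forall th, pinj th && (n - #|dom th| <= w)%N && self_map th H ==>
  [forall x in dom th, tot th x == x]].

(** On the image under [th1] of the common domain, th2 composed with the inverse of th1 is a partial
    injection preserving the edges of [H] and missing at most [w] points. Asymmetry makes it the
    identity. *)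
Lemma coherent_agree w H th1 th2 : asym w H -> pinj th1 -> pinj th2 ->
  coherent th1 th2 H -> (n - #|dom th1 :&: dom th2|%SET <= w)%N ->
  {in (dom th1 :&: dom th2)%SET, th1 =1 th2}.
Proof.
move=> /forallP as_ i1 i2 /forall_inP co hw.
set D := (dom th1 :&: dom th2)%SET in hw *.
have D1 x : x \in D -> x \in dom th1 by move=> /finset.setIP[].
have D2 x : x \in D -> x \in dom th2 by move=> /finset.setIP[].
pose psi : {ffun T -> option T} :=
  [ffun x => if [pick y in D | tot th1 y == x] is Some y then th2 y else None].
have psiE y : y \in D -> psi (tot th1 y) = Some (tot th2 y).
  move=> yD; rewrite ffunE; case: pickP => [z /andP[zD /eqP zy]|/(_ y)].
    by rewrite -(pinjP i1 (D1 _ zD) (D1 _ yD) zy) tot_eq // D2.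
  by rewrite yD eqxx.
have dpsi : dom psi = (tot th1 @: D)%SET.
  apply/finset.setP => x; rewrite inE; apply/idP/finset.imsetP.
    by rewrite ffunE; case: pickP => // y /andP[yD /eqP <-] _; exists y.
  by move=> [y yD ->]; rewrite psiE.
have tpsi y : y \in D -> tot psi (tot th1 y) = tot th2 y.
  by move=> yD; rewrite {1}/tot psiE.
have ti1 : {in D &, injective (tot th1)}.
  by move=> x y /D1 xD /D1 yD; exact: (pinjP i1).
have := as_ psi; rewrite (_ : pinj psi && _ && _ = true) /=; last first.
  apply/andP; split; last first.
    apply/forall_inP => e; rewrite dpsi -imset_pairs // => /finset.imsetP[e0 e0P ->].
    have sD : e0 \subset D by move: e0P; rewrite inE => /andP[].
    rewrite (eqP (co _ e0P)) -imset_comp; apply/eqP; congr (_ \in H).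
    by apply: eq_in_imset => x xe /=; rewrite tpsi // (fintype.subsetP sD).
  rewrite dpsi card_in_imset // hw andbT.
  apply/forallP => x; apply/forallP => y; apply/implyP => /andP[sx /eqP sxy].
  have : x \in dom psi by rewrite inE.
  have : y \in dom psi by rewrite inE -sxy.
  rewrite dpsi => /finset.imsetP[b bD yb] /finset.imsetP[a aD xa].
  move: sxy; rewrite xa yb !psiE // => -[] /(pinjP i2 (D2 _ aD) (D2 _ bD)) ->.
  by [].
move=> /forall_inP h y yD.
have := h (tot th1 y); rewrite tpsi // dpsi => /(_ (imset_f _ yD)) /eqP E.
by rewrite !tot_eq ?D1 ?D2 ?E.
Qed.

Definition cpairs H (k1 k2 : nat) : {set {ffun T -> option T} * {ffun T -> option T}} :=
  [set t | [&& pinj t.1 && (#|dom t.1| == k1), pinj t.2 && (#|dom t.2| == k2) & coherent t.1 t.2 H]]%SET.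

Lemma card_cpairs_prod H k1 k2 :
  (#|cpairs H k1 k2| <= #|[set th : {ffun T -> option T} | pinj th && (#|dom th| == k1)]%SET| *
                       #|[set th : {ffun T -> option T} | pinj th && (#|dom th| == k2)]%SET|)%N.
Proof.
rewrite -cardsX; apply: subset_leq_card; apply/fintype.subsetP => t.
by rewrite !inE => /and3P[-> ->].
Qed.

(** [th1] is chosen freely. By [coherent_agree], [th2] then differs from it only outside the common
    domain, hence lies in a Hamming ball of radius (n - k1) + (n - k2) among maps into the n + 1
    values of [option T]. *)
Lemma card_cpairs_asym w H k1 k2 : (0 < n)%N -> asym w H ->
  (n - k1 + (n - k2) <= w)%N -> (k1 <= n)%N -> (k2 <= n)%N ->
  (#|cpairs H k1 k2| <= n`! * n ^ (n - k1) * (n * n.+1) ^ (n - k1 + (n - k2)))%N.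
Proof.
move=> n0 as_ hw k1n k2n.
rewrite -sum1dep_card -(pair_big_dep (fun th1 => pinj th1 && (#|dom th1| == k1))
  (fun th1 th2 => (pinj th2 && (#|dom th2| == k2)) && coherent th1 th2 H) (fun _ _ => 1%N)) /=.
apply: (@leq_trans (\sum_(th1 | pinj th1 && (#|dom th1| == k1)) (n * n.+1) ^ (n - k1 + (n - k2))))%N.
  apply: leq_sum => th1 /andP[i1 /eqP d1].
  have := card_hamming_ball th1 (n - k1 + (n - k2)) n0; rewrite card_option.
  apply: leq_trans; rewrite sum1dep_card; apply: subset_leq_card.
  apply/fintype.subsetP => th2; rewrite !inE => /andP[/andP[i2 /eqP d2] co].
  have hD : (n - #|dom th1 :&: dom th2|%SET <= n - k1 + (n - k2))%N.
    have := cardsUI (dom th1) (dom th2); have := max_card (mem (dom th1 :|: dom th2)%SET).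
    rewrite d1 d2; set u := #|(_ :|: _)%SET|; set i := #|(_ :&: _)%SET|.
    by move: k1n k2n; clear; rewrite -/n; lia.
  have ag := coherent_agree as_ i1 i2 co (leq_trans hD hw).
  apply: leq_trans hD.
  rewrite -(cardsC (dom th1 :&: dom th2)%SET) addKn; apply: subset_leq_card.
  apply/fintype.subsetP => x; rewrite !inE => hx; apply: contra hx => /andP[h h0].
  by rewrite ag // !inE h h0.
by rewrite sum_nat_const leq_mul2r -sum1_card sum1dep_card card_pinj_large ?orbT.
Qed.

(** At most one n! appears, even if both overlaps exceed half of [T]. An overlap of at most half
    costs only a power of n proportional to its size. *)
Lemma card_cpairs w H k1 k2 : (1 < n)%N -> asym w H -> (n <= w * w)%N ->
  (k1 <= n)%N -> (k2 <= n)%N ->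
  (#|cpairs H k1 k2| <= (if (n < 2 * k1) || (n < 2 * k2) then n`! else 1) *
      n ^ ((4 + w) * (minn k1 (n - k1) + minn k2 (n - k2))))%N.
Proof.
move=> n1 as_ hw k1n k2n; have n0 : (0 < n)%N by exact: ltnW.
have pr := card_cpairs_prod H k1 k2.
have big1 := card_pinj_large k1n; have big2 := card_pinj_large k2n.
have sm1 := card_pinj_small k1; have sm2 := card_pinj_small k2.
have facle : (n`! <= n ^ n)%N by rewrite -ffactnn ffact_leq_exp.
have n3 : (n * n.+1 <= n ^ 3)%N.
  rewrite !expnS expn0 muln1; apply: leq_mul => //.
  by move: n1; clear; case: #|T| => [|[|k]] // _; rewrite mulSn !addSn !ltnS mulnS; lia.
have mL k : (n < 2 * k)%N -> minn k (n - k) = (n - k)%N.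
  by move=> c; apply/minn_idPr; move: c; clear; lia.
have mS k : (2 * k <= n)%N -> minn k (n - k) = k.
  by move=> c; apply/minn_idPl; move: c; clear; lia.
have le4 a : (4 * a <= (4 + w) * a)%N by rewrite leq_mul2r leq_addr orbT.
case: (ltnP n (2 * k1)) => c1; case: (ltnP n (2 * k2)) => c2 /=;
  rewrite ?(mL _ c1) ?(mS _ c1) ?(mL _ c2) ?(mS _ c2).
- case: (leqP (n - k1 + (n - k2)) w) => hl.
    apply: (leq_trans (card_cpairs_asym n0 as_ hl k1n k2n)).
    rewrite -mulnA leq_mul2l; apply/orP; right.
    apply: (@leq_trans (n ^ (n - k1) * (n ^ 3) ^ (n - k1 + (n - k2)))).
      rewrite leq_mul2l; apply/orP; right.
      have [->|h] := eqVneq (n - k1 + (n - k2))%N 0%N; first by [].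
      by rewrite leq_exp2r ?lt0n.
    rewrite -expnM -expnD leq_exp2l //; apply: leq_trans (le4 _); clear; lia.
  (* More than [w] points are missing in total, so [n <= w * w] bounds n by w times that number. The
     second n! is at most n^n and disappears in the power of n. *)
  apply: (leq_trans pr); apply: (leq_trans (leq_mul big1 big2)).
  rewrite -mulnA leq_mul2l; apply/orP; right.
  apply: (@leq_trans (n ^ (n - k1) * (n ^ n * n ^ (n - k2)))).
    by rewrite leq_mul2l leq_mul2r facle !orbT.
  rewrite -!expnD leq_exp2l // mulnDl.
  have : (n <= w * (n - k1 + (n - k2)))%N.
    by apply: leq_trans hw _; rewrite leq_mul2l (ltnW hl) orbT.
  by clear; lia.
- apply: (leq_trans pr); apply: (leq_trans (leq_mul big1 sm2)).
  rewrite -mulnA leq_mul2l -expnD leq_exp2l //; apply/orP; right.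
  by apply: leq_trans (le4 _); clear; lia.
- apply: (leq_trans pr); apply: (leq_trans (leq_mul sm1 big2)).
  rewrite mulnCA leq_mul2l -expnD leq_exp2l //; apply/orP; right.
  by apply: leq_trans (le4 _); clear; lia.
- apply: (leq_trans pr); apply: (leq_trans (leq_mul sm1 sm2)).
  rewrite mul1n -expnD leq_exp2l //.
  by apply: leq_trans (le4 _); clear; lia.
Qed.

End Counting.

(** * Exponents of the overlap terms *)

Lemma bin2R (R : realType) (k : nat) : ('C(k, 2))%:R = k%:R * (k%:R - 1) / 2 :> R.
Proof.
have : (2 * 'C(k, 2) = k * k.-1)%N by rewrite mul_bin_left subn1 bin1 mulnC.
case: k => [|k]; first by rewrite bin0n mul0r mul0r.
move=> /(congr1 (fun x : nat => x%:R : R)); rewrite /= !natrM -[k.+1%:R]natr1; lra.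
Qed.

Section Exponent.
Variable R : realType.

Definition relent (r p : R) : R := p * ln (p / r) + (1 - p) * ln ((1 - p) / (1 - r)).
Definition entropy (p : R) : R := - (p * ln p + (1 - p) * ln (1 - p)).

(* the three hypotheses on 'C(n, 2) say that the expected numbers of copies are
   at least [exp s]; [F] stands for [ln n!] *)
Lemma overlap_exponent (n k1 k2 i : nat) (L F s a1 a2 h : R) :
  (1 < n)%N -> (i <= k1)%N -> (i <= k2)%N -> (k1 <= n)%N -> (k2 <= n)%N ->
  0 <= F + s ->
  ('C(n, 2))%:R * a1 <= n%:R * L - F - s ->
  ('C(n, 2))%:R * a2 <= n%:R * L - F - s ->
  ('C(n, 2))%:R * (a1 + a2 + h) <= 2 * n%:R * L - F - s ->
  - (k1%:R + k2%:R) * L + (a1 * ('C(k1, 2))%:R + a2 * ('C(k2, 2))%:R + h * ('C(i, 2))%:R) <=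
  - (k1%:R + k2%:R - i%:R) * ((F + s) / n%:R)
  - (L - (F + s) / n%:R) * ((k1%:R * (n%:R - k1%:R) + k2%:R * (n%:R - k2%:R)) / (n%:R - 1)).
Proof.
move=> n1 ik1 ik2 k1n k2n Fs0 h1 h2 h0.
have n0 : 1 < n%:R :> R by rewrite ltr1n.
have np : 0 < n%:R :> R by lra.
have nm : 0 < n%:R - 1 :> R by lra.
(* [sg k] is the ratio of 'C(k,2) to 'C(n,2). The three hypotheses are combined with the nonnegative
   weights [sg i] (joint exponent), [sg k1 - sg i] and [sg k2 - sg i] (single exponents). *)
pose sg (k : nat) : R := k%:R * (k%:R - 1) / (n%:R * (n%:R - 1)).
have sgE (k : nat) : ('C(k, 2))%:R = sg k * ('C(n, 2))%:R.
  by rewrite !bin2R /sg; field; rewrite !gt_eqF.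
have sg_mono (a b : nat) : (a <= b)%N -> sg a <= sg b.
  move=> ab; rewrite /sg ler_pM2r ?invr_gt0 ?mulr_gt0 //.
  case: a ab => [|a] ab; first by rewrite mul0r; case: b ab => [|b] _; rewrite ?mul0r // mulr_ge0 // subr_ge0 ler1n.
  have : a.+1%:R <= b%:R :> R by rewrite ler_nat.
  have : 1 <= a.+1%:R :> R by rewrite ler1n.
  by move=> *; apply: ler_pM => //; lra.
have sgi0 : 0 <= sg i.
  have -> : 0 = sg 0%N by rewrite /sg !mul0r.
  exact: sg_mono.
rewrite (sgE k1) (sgE k2) (sgE i).
have e1 := ler_wpM2l sgi0 h0.
have d1 : 0 <= sg k1 - sg i by rewrite subr_ge0 sg_mono.
have d2 : 0 <= sg k2 - sg i by rewrite subr_ge0 sg_mono.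
have e2 := ler_wpM2l d1 h1.
have e3 := ler_wpM2l d2 h2.
set D := (F + s) / n%:R.
have FsD : F + s = n%:R * D by rewrite /D mulrC divfK // gt_eqF.
have D0 : 0 <= D by rewrite divr_ge0 // ltW.
have sk (k : nat) : n%:R * sg k = k%:R - k%:R * (n%:R - k%:R) / (n%:R - 1).
  by rewrite /sg; field; rewrite !gt_eqF.
have ski : n%:R * sg i <= i%:R.
  rewrite sk lerBlDr lerDl; apply: divr_ge0; last exact: ltW.
  by apply: mulr_ge0 => //; rewrite subr_ge0 ler_nat (leq_trans ik1 k1n).
have e4 : n%:R * sg i * D <= i%:R * D by rewrite ler_wpM2r.
set Mb := ('C(n, 2))%:R in e1 e2 e3 *.
have -> : (k1%:R * (n%:R - k1%:R) + k2%:R * (n%:R - k2%:R)) / (n%:R - 1) =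
   k1%:R + k2%:R - n%:R * sg k1 - n%:R * sg k2 :> R.
  by rewrite !sk; ring.
have e1' : sg i * (Mb * (a1 + a2 + h)) <= sg i * (2 * n%:R * L - n%:R * D).
  by rewrite -FsD opprD addrA.
have e2' : (sg k1 - sg i) * (Mb * a1) <= (sg k1 - sg i) * (n%:R * L - n%:R * D).
  by rewrite -FsD opprD addrA.
have e3' : (sg k2 - sg i) * (Mb * a2) <= (sg k2 - sg i) * (n%:R * L - n%:R * D).
  by rewrite -FsD opprD addrA.
move: e1' e2' e3' e4; clear; lra.
Qed.

Lemma min_gap (n k : nat) : (1 < n)%N -> (k <= n)%N ->
  (minn k (n - k))%:R / 2 <= k%:R * (n%:R - k%:R) / (n%:R - 1) :> R.
Proof.
move=> n1 kn; have nm : 0 < n%:R - 1 :> R by rewrite subr_gt0 ltr1n.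
rewrite ler_pdivlMr //.
have kR : k%:R <= n%:R :> R by rewrite ler_nat.
have kR0 : 0 <= k%:R :> R by [].
case: (leqP k (n - k)) => h.
  have h2 : 0 <= n%:R - 2 * k%:R :> R.
    by rewrite subr_ge0 -natrM ler_nat; move: h kn; clear; lia.
  by have := mulr_ge0 kR0 h2; move: kR0; clear; lra.
have h2 : 0 <= 2 * k%:R - n%:R :> R.
  by rewrite subr_ge0 -natrM ler_nat; move: h kn; clear; lia.
rewrite natrB //; have h3 : 0 <= n%:R - k%:R :> R by lra.
by have := mulr_ge0 h3 h2; move: h3; clear; lra.
Qed.

(** Convexity of k(k-1) gains about L per point by which each overlap differs from being empty or
    total. This beats both the powers of n in the count and the jumbledness error [err], which has
    the same shape k(n-k). *)
Lemma overlap_weight (n k1 k2 i w cnt : nat) (L s a1 a2 h err : R) :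
  (1 < n)%N -> (i <= k1)%N -> (i <= k2)%N -> (k1 <= n)%N -> (k2 <= n)%N ->
  (n - i <= (n - k1) + (n - k2))%N -> (1 < k1)%N || (1 < k2)%N ->
  (cnt <= (if (n < 2 * k1) || (n < 2 * k2) then n`! else 1) *
      n ^ ((4 + w) * (minn k1 (n - k1) + minn k2 (n - k2))))%N ->
  0 <= s -> s <= L / 8 -> 0 <= err -> 
  (ln (n`!%:R) + s) / n%:R <= L / 16 ->
  (4 + w)%:R * ln n%:R <= L / 16 ->
  8 * err * (n%:R - 1) <= L ->
  ('C(n, 2))%:R * a1 <= n%:R * L - ln (n`!%:R) - s ->
  ('C(n, 2))%:R * a2 <= n%:R * L - ln (n`!%:R) - s ->
  ('C(n, 2))%:R * (a1 + a2 + h) <= 2 * n%:R * L - ln (n`!%:R) - s ->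
  cnt%:R * expR (- (k1%:R + k2%:R) * L + (a1 * ('C(k1, 2))%:R + a2 * ('C(k2, 2))%:R + h * ('C(i, 2))%:R) +
    err * (k1%:R * (n%:R - k1%:R) + k2%:R * (n%:R - k2%:R) + i%:R * (n%:R - i%:R)))
  <= expR (- s).
Proof.
move=> n1 ik1 ik2 k1n k2n hi hbad hcnt s0 sL err0 hD hw herr h1 h2 h0.
set F := ln (n`!%:R) in hD h1 h2 h0 *.
have n0 : 1 < n%:R :> R by rewrite ltr1n.
have np : 0 < n%:R :> R by lra.
have nm : 0 < n%:R - 1 :> R by lra.
have F0 : 0 <= F by rewrite ln_ge0 // ler1n fact_gt0.
have L0 : 0 <= L by lra.
have Fs0 : 0 <= F + s by lra.
have := overlap_exponent n1 ik1 ik2 k1n k2n Fs0 h1 h2 h0.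
set E := _ + (_ + _ + _); set D := (F + s) / n%:R in hD *.
have D0 : 0 <= D by rewrite divr_ge0 // ltW.
have FsD : F + s = n%:R * D by rewrite /D mulrC divfK // gt_eqF.
set m1 := minn k1 (n - k1) in hcnt *; set m2 := minn k2 (n - k2) in hcnt *.
have g1 := min_gap n1 k1n; have g2 := min_gap n1 k2n.
rewrite -/m1 in g1; rewrite -/m2 in g2.
set Q := k1%:R * (n%:R - k1%:R) + k2%:R * (n%:R - k2%:R).
have Qi : i%:R * (n%:R - i%:R) <= Q.
  have x1 : n%:R - i%:R <= (n%:R - k1%:R) + (n%:R - k2%:R) :> R.
    rewrite -!natrB // -?natrD ?ler_nat //; exact: leq_trans ik1 k1n.
  have x2 : i%:R <= k1%:R :> R by rewrite ler_nat.
  have x3 : i%:R <= k2%:R :> R by rewrite ler_nat.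
  have x4 : 0 <= n%:R - k1%:R :> R by rewrite subr_ge0 ler_nat.
  have x5 : 0 <= n%:R - k2%:R :> R by rewrite subr_ge0 ler_nat.
  have y1 := ler_wpM2l (ler0n R i) x1.
  have y2 := ler_wpM2r x4 x2.
  have y3 := ler_wpM2r x5 x3.
  by move: y1 y2 y3; rewrite /Q mulrDr; lra.
have gQ : (m1%:R + m2%:R) / 2 <= Q / (n%:R - 1).
  by rewrite /Q mulrDl; lra.
have Q0 : 0 <= Q.
  by rewrite addr_ge0 // mulr_ge0 // subr_ge0 ler_nat.
have errQ : err * (Q + i%:R * (n%:R - i%:R)) <= L / 4 * (Q / (n%:R - 1)).
  rewrite mulrA ler_pdivlMr //.
  have y1 : err * (Q + i%:R * (n%:R - i%:R)) <= err * (2 * Q).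
    by apply: ler_wpM2l => //; lra.
  have y2 : 8 * err * (n%:R - 1) * Q <= L * Q by rewrite ler_wpM2r.
  have y3 := ler_wpM2r (ltW nm) y1.
  apply: (le_trans y3); move: y2; clear; lra.
move=> hE.
have m0 : 0 <= m1%:R + m2%:R :> R by rewrite addr_ge0.
have hE2 : E + err * (Q + i%:R * (n%:R - i%:R)) <=
   - (k1%:R + k2%:R - i%:R) * D - L / 8 * (m1%:R + m2%:R).
  have : L / 4 * ((m1%:R + m2%:R) / 2) <= (L - D - L / 4) * (Q / (n%:R - 1)).
    have q0 : 0 <= Q / (n%:R - 1) by rewrite divr_ge0 // ltW.
    by apply: ler_pM => //; lra.
  move: hE errQ; rewrite -/Q; clear; lra.
have i1R : i%:R <= k1%:R :> R by rewrite ler_nat.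
have i2R : i%:R <= k2%:R :> R by rewrite ler_nat.
have lnn0 : 0 <= ln n%:R :> R by rewrite ln_ge0 // ltW.
have cntle : cnt%:R <= expR ((if (n < 2 * k1)%N || (n < 2 * k2)%N then F else 0) +
     L / 16 * (m1%:R + m2%:R)) :> R.
  have : cnt%:R <= ((if (n < 2 * k1) || (n < 2 * k2) then n`! else 1) *
      n ^ ((4 + w) * (m1 + m2)))%N%:R :> R by rewrite ler_nat.
  move/le_trans; apply; rewrite natrM expRD; apply: ler_pM => //.
    by case: ifP => _; rewrite ?expR0 // /F lnK // posrE ltr0n fact_gt0.
  rewrite natrX -[n%:R](@lnK R) ?posrE // -expRM_natl ler_expR natrM.
  rewrite -natrD mulrAC; apply: ler_wpM2r => //; by rewrite natrD.
apply: (le_trans (ler_pM (ler0n _ _) (expR_ge0 _) cntle (lexx _))).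
rewrite -expRD ler_expR.
set E2 := E + _ in hE2 *.
(* When an overlap exceeds half of [T], its size is n minus its gap, so the term with [D]
   contributes -(F + s) up to gap times [D]. This cancels the n! in the count. *)
case: (ltnP n (2 * k1)) hcnt cntle => c1 /=.
  move=> _ _.
  have m1E : k1%:R = n%:R - m1%:R :> R.
    have <- : (k1 + m1 = n)%N by move: c1 k1n; rewrite /m1; clear; lia.
    by rewrite natrD addrK.
  have : (k1%:R + k2%:R - i%:R) * D >= k1%:R * D by apply: ler_wpM2r => //; lra.
  have : m1%:R * D <= (m1%:R + m2%:R) * (L / 16).
    by apply: ler_pM => //; rewrite lerDl.
  by move: hE2 FsD; rewrite m1E; clear; lra.
case: (ltnP n (2 * k2)) => c2 /=.
  move=> _ _.
  have m2E : k2%:R = n%:R - m2%:R :> R.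
    have <- : (k2 + m2 = n)%N by move: c2 k2n; rewrite /m2; clear; lia.
    by rewrite natrD addrK.
  have : (k1%:R + k2%:R - i%:R) * D >= k2%:R * D by apply: ler_wpM2r => //; lra.
  have : m2%:R * D <= (m1%:R + m2%:R) * (L / 16).
    by apply: ler_pM => //; rewrite lerDr.
  by move: hE2 FsD; rewrite m2E; clear; lra.
move=> _ _.
(* Without an n! to cancel, [hbad] supplies two units of gap; the surplus of L/16 per unit gives
   L/8, at least [s]. *)
have : 2 <= m1%:R + m2%:R :> R.
  by move: hbad c1 c2; rewrite -natrD ler_nat /m1 /m2; clear; lia.
have : 0 <= (k1%:R + k2%:R - i%:R) * D.
  by apply: mulr_ge0 => //; have := ler0n R k2; lra.
move=> y2 y1; have y3 := ler_wpM2l L0 y1.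
by move: y2 y3 hE2 sL; clear; lra.
Qed.

End Exponent.

(** * Bound on the second moment *)

Section Jumbled.
Variables (R : realType) (T : finType).
Implicit Types (H : {set {set T}}) (K : {set T}).

(** The error vanishes for empty and for full [K]. Near the full set it is controlled by the number
    of missing vertices, exactly as the convexity gain for overlaps is, so that a small constant
    [eta] can be absorbed. *)
Definition jumbled (p eta : R) H := forall K,
  `|#|H :&: pairs K|%SET%:R - p * ('C(#|K|, 2))%:R| <= eta * (#|K|%:R * (#|T|%:R - #|K|%:R)).

Lemma prod_jumbled (p eta lam A B : R) H K : jumbled p eta H -> 0 < A -> 0 < B ->
  `|ln A - ln B| <= lam ->
  \prod_(e in pairs K) (if e \in H then A else B) <=
  expR ((p * ln A + (1 - p) * ln B) * ('C(#|K|, 2))%:R + lam * eta * (#|K|%:R * (#|T|%:R - #|K|%:R))).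
Proof.
move=> jH A0 B0 hlam.
rewrite (big_setID H) /= (eq_bigr (fun=> A)); last by move=> e /finset.setIP[_ ->].
rewrite [X in _ * X](eq_bigr (fun=> B)); last by move=> e /finset.setDP[_ /negbTE->].
have EA : A = expR (ln A) by rewrite lnK ?posrE.
have EB : B = expR (ln B) by rewrite lnK ?posrE.
rewrite !prodr_const [X in X ^+ _ * _]EA [X in _ * X ^+ _ <= _]EB.
rewrite -!expRM_natl -expRD ler_expR.
rewrite finset.setIC; set e := #|(H :&: _)%SET|; set e' := #|_ :\: _|%SET.
have := jH K; rewrite -/e.
have <- : (e + e')%N = 'C(#|K|, 2).
  by rewrite -card_pairs -(cardsID H (pairs K)) /e finset.setIC.
rewrite natrD => h.
set d := e%:R - _ in h.
apply: (@le_trans _ _ ((p * ln A + (1 - p) * ln B) * (e%:R + e'%:R) + `|ln A - ln B| * `|d|)).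
  have -> : e%:R * ln A + e'%:R * ln B = (p * ln A + (1 - p) * ln B) * (e%:R + e'%:R) + (ln A - ln B) * d.
    by rewrite /d; ring.
  by rewrite lerD2l -normrM ler_norm.
rewrite lerD2l -mulrA.
by apply: ler_pM.
Qed.

End Jumbled.

(** * Covariance sum for jumbled asymmetric graphs *)

Section Assembly.
Variables (R : realType) (T V : finType) (p1 p2 p : R) (m w : nat).
Variable (GG : {set {set {set T}}}).
Hypotheses (hp1 : 0 < p1 < 1) (hp2 : 0 < p2 < 1) (hp : 0 < p < 1).
Let PT := pairs [set: T]%SET.
Let n := #|T|.
Let N := #|V|.
Let L : R := ln N%:R.
Let M := 'C(n, 2).
Variables (eta lam s g : R).
Hypothesis GGP : forall H, H \in GG -> H \subset PT /\ #|H| = m.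
Hypothesis GGj : forall H, H \in GG -> jumbled p eta H.
Hypothesis GGa : forall H, H \in GG -> asym w H.
Hypotheses (n1 : (1 < n)%N) (N1 : (0 < N)%N) (nw : (n <= w * w)%N).
Hypotheses (eta0 : 0 <= eta) (s0 : 0 <= s) (sL : s <= L / 8).
Hypothesis hD : (ln (n`!%:R) + s) / n%:R <= L / 16.
Hypothesis hw : (4 + w)%:R * ln n%:R <= L / 16.
Hypothesis herr : 8 * (lam * eta) * (n%:R - 1) <= L.
Hypothesis hl1 : `|ln (p / p1) - ln ((1 - p) / (1 - p1))| <= lam.
Hypothesis hl2 : `|ln (p / p2) - ln ((1 - p) / (1 - p2))| <= lam.
Hypothesis hl3 : `|ln p - ln (1 - p)| <= lam.
Hypothesis h1 : M%:R * relent p1 p <= n%:R * L - ln (n`!%:R) - s.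
Hypothesis h2 : M%:R * relent p2 p <= n%:R * L - ln (n`!%:R) - s.
Hypothesis h0 : M%:R * (relent p1 p + relent p2 p + entropy p) <= 2 * n%:R * L - ln (n`!%:R) - s.
Hypothesis hND : N%:R ^+ n <= 2 * (N ^_ n)%:R :> R.
Hypotheses (g0 : 0 < g) (hg : g <= #|GG|%:R * (p ^+ m * (1 - p) ^+ (#|PT| - m))).
Implicit Types (H : {set {set T}}) (th : {ffun T -> option T}).

Lemma W_quot r K H : 0 < r < 1 -> jumbled p eta H ->
  `|ln (p / r) - ln ((1 - p) / (1 - r))| <= lam ->
  W p K H / W r K H <=
  expR (relent r p * ('C(#|K|, 2))%:R + lam * eta * (#|K|%:R * (#|T|%:R - #|K|%:R))).
Proof.
move=> /andP[r0 r1] jH hl; have /andP[q0 q1] := hp.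
rewrite /W -prodfV -big_split /=.
rewrite (eq_bigr (fun e => if e \in H then p / r else (1 - p) / (1 - r))); last first.
  by move=> e _; rewrite /wt; case: ifP.
by apply: prod_jumbled => //; rewrite divr_gt0 // subr_gt0.
Qed.

Lemma W_inv K H : jumbled p eta H ->
  (W p K H)^-1 <= expR (entropy p * ('C(#|K|, 2))%:R + lam * eta * (#|K|%:R * (#|T|%:R - #|K|%:R))).
Proof.
move=> jH; have /andP[q0 q1] := hp.
rewrite /W -prodfV.
rewrite (eq_bigr (fun e => if e \in H then p^-1 else (1 - p)^-1)); last first.
  by move=> e _; rewrite /wt; case: ifP.
have -> : entropy p = p * ln p^-1 + (1 - p) * ln (1 - p)^-1.
  by rewrite /entropy !lnV ?posrE ?subr_gt0 //; ring.
apply: prod_jumbled; rewrite ?invr_gt0 ?subr_gt0 //.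
by rewrite !lnV ?posrE ?subr_gt0 // -opprD normrN.
Qed.

Let lam0 : 0 <= lam. Proof. exact: le_trans hl3. Qed.

Definition expo (k1 k2 i : nat) : R :=
  - (k1%:R + k2%:R) * L + (relent p1 p * ('C(k1, 2))%:R + relent p2 p * ('C(k2, 2))%:R + entropy p * ('C(i, 2))%:R) +
    (lam * eta) * (k1%:R * (n%:R - k1%:R) + k2%:R * (n%:R - k2%:R) + i%:R * (n%:R - i%:R)).

Let pi_ := p ^+ m * (1 - p) ^+ (#|PT| - m).

Let N0 : 0 < N%:R :> R. Proof. by rewrite ltr0n. Qed.

Lemma term_le H th1 th2 : H \in GG -> pinj th1 -> pinj th2 ->
  N%:R ^+ (n - #|dom th1|) * N%:R ^+ (n - #|dom th2|) * (ZZ p1 p2 GG H th1 th2 * pi_) <=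
  N%:R ^+ (2 * n) * ((coherent th1 th2 H)%:R *
    expR (expo #|dom th1| #|dom th2| #|dom th1 :&: dom th2|%SET)).
Proof.
move=> HG i1 i2.
have jH := GGj HG.
have k1n : (#|dom th1| <= n)%N by exact: max_card.
have k2n : (#|dom th2| <= n)%N by exact: max_card.
have NE k : (k <= n)%N -> N%:R ^+ (n - k) = N%:R ^+ n * expR (- (k%:R * L)).
  move=> kn; rewrite expRN expRM_natl /L lnK ?posrE //.
  by rewrite exprB // unitfE gt_eqF.
rewrite !NE //.
have := ZZ_bad hp1 hp2 hp GGP HG i1 i2.
set Z := ZZ _ _ _ _ _ _ * _ => hZ.
have cI : #|(tot th1 @: (dom th1 :&: dom th2))%SET| = #|(dom th1 :&: dom th2)%SET|.
  rewrite card_in_imset // => x y /finset.setIP[x1 _] /finset.setIP[y1 _].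
  exact: (pinjP i1).
have B1 := W_quot (im th1) hp1 jH hl1.
have B2 := W_quot (im th2) hp2 jH hl2.
have B3 := W_inv (tot th1 @: (dom th1 :&: dom th2))%SET jH.
rewrite (card_im i1) in B1; rewrite (card_im i2) in B2; rewrite cI in B3.
have W0 r K : 0 < r < 1 -> 0 <= W r K H by move=> hr; rewrite ltW // W_gt0.
have q1 : 0 <= W p (im th1) H / W p1 (im th1) H by rewrite divr_ge0 ?W0.
have q2 : 0 <= W p (im th2) H / W p2 (im th2) H by rewrite divr_ge0 ?W0.
have q3 : 0 <= (W p (tot th1 @: (dom th1 :&: dom th2))%SET H)^-1 by rewrite invr_ge0 W0.
have B := ler_pM (mulr_ge0 q1 q2) q3 (ler_pM q1 q2 B1 B2) B3.
rewrite -!expRD in B.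
rewrite -!mulrA in hZ; rewrite mulrA in hZ.
have hZ2 : Z <= (coherent th1 th2 H)%:R * (W p (im th1) H / W p1 (im th1) H *
  (W p (im th2) H / W p2 (im th2) H) / W p (tot th1 @: (dom th1 :&: dom th2))%SET H).
  by apply: (le_trans hZ); rewrite le_eqVlt; apply/orP; left; apply/eqP; ring.
have hZ3 := le_trans hZ2 (ler_wpM2l (ler0n _ _) B).
set k1 := #|dom th1| in hZ3 *; set k2 := #|dom th2| in hZ3 *; set i := #|_ :&: _|%SET in hZ3 *.
have A0 : 0 <= N%:R ^+ n * expR (- (k1%:R * L)) * (N%:R ^+ n * expR (- (k2%:R * L))).
  by rewrite !mulr_ge0 ?exprn_ge0 ?expR_ge0 // ltW.
apply: (le_trans (ler_wpM2l A0 hZ3)).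
rewrite /expo.
rewrite [X in _ <= _ * (_ * expR X)](_ : _ = - (k1%:R * L) + - (k2%:R * L) +
  (relent p1 p * ('C(k1, 2))%:R + lam * eta * (k1%:R * (#|T|%:R - k1%:R)) +
   (relent p2 p * ('C(k2, 2))%:R + lam * eta * (k2%:R * (#|T|%:R - k2%:R))) +
   (entropy p * ('C(i, 2))%:R + lam * eta * (i%:R * (#|T|%:R - i%:R))))); last first.
  by rewrite /n; ring.
rewrite mul2n -addnn exprD !expRD le_eqVlt; apply/orP; left; apply/eqP; ring.
Qed.

Lemma bad_sum_le H : H \in GG ->
  \sum_(th1 | pinj th1) \sum_(th2 | pinj th2)
        N%:R ^+ (n - #|dom th1|) * N%:R ^+ (n - #|dom th2|) *
        ((bad th1 th2)%:R * ZZ p1 p2 GG H th1 th2) * pi_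
  <= N%:R ^+ (2 * n) * (n.+1%:R ^+ 2 * expR (- s)).
Proof.
move=> HG.
pose ko (t : {ffun T -> option T} * {ffun T -> option T}) : 'I_n.+1 * 'I_n.+1 :=
  (inord #|dom t.1|, inord #|dom t.2|).
rewrite pair_big /= (partition_big ko predT) //=.
have -> : N%:R ^+ (2 * n) * (n.+1%:R ^+ 2 * expR (- s)) =
   \sum_(k : 'I_n.+1 * 'I_n.+1) N%:R ^+ (2 * n) * expR (- s).
  by rewrite sumr_const card_prod card_ord -[RHS]mulr_natl natrM; ring.
apply: ler_sum => -[k1 k2] _.
have k1n : (k1 <= n)%N by rewrite -ltnS.
have k2n : (k2 <= n)%N by rewrite -ltnS.
have koE t : ko t == (k1, k2) -> #|dom t.1| = k1 /\ #|dom t.2| = k2.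
  rewrite /ko xpair_eqE => /andP[/eqP <- /eqP <-].
  by rewrite !inordK // ltnS max_card.
have N2 : 0 <= N%:R ^+ (2 * n) :> R by rewrite exprn_ge0.
case: (boolP ((1 < k1)%N || (1 < k2)%N)) => hb; last first.
  rewrite big1 ?mulr_ge0 ?expR_ge0 // => t /andP[_ /koE [d1 d2]].
  by rewrite /bad d1 d2 (negbTE hb) mul0r mulr0 mul0r.
(* [overlap_weight] bounds a single term times the whole cardinality of [cpairs], so each term is at
   most [expR (- s)] divided by that cardinality, up to the power of N. *)
apply: (@le_trans _ _ (\sum_(t in cpairs H k1 k2) N%:R ^+ (2 * n) * (expR (- s) / #|cpairs H k1 k2|%:R))).
  rewrite [leRHS]big_mkcond [leLHS]big_mkcond /=.
  apply: ler_sum => t _.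
  case: ifPn => [/andP[/andP[i1 i2] /koE [d1 d2]]|_]; last first.
    by case: ifP => // _; rewrite mulr_ge0 ?divr_ge0 ?expR_ge0.
  have := term_le HG i1 i2; rewrite d1 d2 /bad d1 d2 hb mul1r.
  rewrite -[X in _ -> X <= _]mulrA => hT; apply: (le_trans hT).
  rewrite inE d1 d2 !eqxx i1 i2 /=.
  case: ifPn => co; last by rewrite mul0r mulr0.
  rewrite mul1r ler_wpM2l // ler_pdivlMr; last first.
    rewrite ltr0n; apply/card_gt0P; exists t; rewrite inE d1 d2 !eqxx i1 i2 /=.
    exact: co.
  rewrite mulrC.
  have ii1 : (#|dom t.1 :&: dom t.2|%SET <= k1)%N by rewrite -d1 subset_leq_card // subsetIl.
  have ii2 : (#|dom t.1 :&: dom t.2|%SET <= k2)%N by rewrite -d2 subset_leq_card // subsetIr.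
  apply: (overlap_weight n1 ii1 ii2 k1n k2n _ hb (card_cpairs n1 (GGa HG) nw k1n k2n)) => //.
  - have hU : (#|dom t.1 :|: dom t.2|%SET <= n)%N by exact: max_card.
    have := cardsUI (dom t.1) (dom t.2); rewrite d1 d2.
    move: hU k1n k2n; set u := #|(_ :|: _)%SET|; set j := #|(_ :&: _)%SET|.
    by rewrite -/n; clear; lia.
  - by rewrite mulr_ge0.
rewrite sumr_const.
have [->|h] := eqVneq #|cpairs H k1 k2| 0%N; first by rewrite mulr0n mulr_ge0 ?expR_ge0.
rewrite -[leLHS]mulr_natl mulrCA ler_wpM2l //.
by rewrite mulrC divfK // pnatr_eq0.
Qed.

(** The (n+1)^2 counts pairs of overlap sizes, the 4 comes from using [hND] once for each random
    graph, and [g] bounds from below the probability that a graph of density [p] lies in [GG]. *)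
Lemma Xcount_zero_le :
  \sum_(G : {set {set V}} * {set {set V}} | PP G && (Xcount R GG G == 0)) ww p1 p2 G <= 4 * (n.+1%:R ^+ 2 * expR (- s)) / g.
Proof.
have DE : #|injs T V| = (N ^_ n)%N by exact: card_injs.
have Nn0 : 0 < N%:R ^+ n :> R by rewrite exprn_gt0.
have D0 : 0 < (N ^_ n)%:R :> R by rewrite -(pmulr_rgt0 _ (ltr0Sn R 1)); exact: lt_le_trans Nn0 hND.
have pi0 : 0 < pi_.
  by case/andP: hp => a b; rewrite mulr_gt0 ?exprn_gt0 ?subr_gt0.
have GG0 : 0 < #|GG|%:R :> R.
  have := lt_le_trans g0 hg; rewrite -/pi_ => h.
  by rewrite -(pmulr_lgt0 _ pi0).
apply: second_moment_zero.
- by move=> G _; exact: ww_ge0.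
- exact: ww_total.
- rewrite (EXcount V p1 p2 GGP).
  rewrite DE !mulr_gt0 ?exprn_gt0 //; case/andP: hp1 => a b; case/andP: hp2 => c d //;
  by rewrite subr_gt0.
apply: (EXcount2 hp1 hp2 GGP) => H HG.
have hB := bad_sum_le HG.
rewrite -(ler_pM2r pi0).
apply: (@le_trans _ _ (N%:R ^+ (2 * n) * (n.+1%:R ^+ 2 * expR (- s)))).
  apply: le_trans hB; rewrite mulr_suml; apply: ler_sum => th1 _.
  by rewrite mulr_suml; apply: ler_sum => th2 _.
have e0 : 0 <= n.+1%:R ^+ 2 * expR (- s) by rewrite mulr_ge0 ?exprn_ge0 ?expR_ge0.
apply: (@le_trans _ _ (4 * (N ^_ n)%:R ^+ 2 * (n.+1%:R ^+ 2 * expR (- s)))).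
  apply: ler_wpM2r => //.
  rewrite mul2n -addnn exprD.
  have := ler_pM (ltW Nn0) (ltW Nn0) hND hND; move/le_trans; apply.
  by rewrite le_eqVlt; apply/orP; left; apply/eqP; ring.
rewrite DE.
rewrite [leRHS](_ : _ = 4 * (N ^_ n)%:R ^+ 2 * (n.+1%:R ^+ 2 * expR (- s)) * (#|GG|%:R * pi_ / g)); last first.
  by field; rewrite gt_eqF.
apply: ler_peMr; first by apply: mulr_ge0 => //; rewrite mulr_ge0 // exprn_ge0.
by rewrite ler_pdivlMr // mul1r.
Qed.

End Assembly.

(** * Random graphs are jumbled and asymmetric *)

Section Analytic.
Variable R : realType.
Implicit Types x y : R.

Lemma ln_le_subr1 x : 0 < x -> ln x <= x - 1.
Proof.
move=> x0; have := expR_ge1Dx (ln x); rewrite lnK ?posrE //; lra.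
Qed.

Lemma ln_ge_1subV x : 0 < x -> 1 - x^-1 <= ln x.
Proof.
move=> x0; have := ln_le_subr1 (x := x^-1); rewrite invr_gt0 lnV ?posrE // => /(_ x0); lra.
Qed.

Lemma expR_quadratic x : x <= 2^-1 -> expR x <= 1 + x + 2 * x ^+ 2.
Proof.
move=> hx; have h := expR_ge1Dx (- x).
have d : 0 < 1 - x by lra.
have : expR x <= (1 - x)^-1.
  rewrite -[expR x]invrK lef_pV2 ?posrE ?invr_gt0 ?expR_gt0 // -expRN; lra.
move/le_trans; apply; rewrite -div1r ler_pdivrMr //.
have h2 : 0 <= 1 - 2 * x by lra.
have := mulr_ge0 (sqr_ge0 x) h2; rewrite !expr2; lra.
Qed.

Lemma ln_fact_ge (n : nat) : (0 < n)%N -> n%:R * ln n%:R - n%:R <= ln (n`!%:R) :> R.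
Proof.
elim: n => [//|[|n] IH _]; first by rewrite ln1; lra.
have n0 : 0 < n.+1%:R :> R by [].
have m0 : 0 < n.+2%:R :> R by [].
rewrite factS natrM lnM ?posrE // ?ltr0n ?fact_gt0 //.
have yx : n.+2%:R = n.+1%:R + 1 :> R by rewrite -[n.+2%:R]natr1.
have := IH isT; have := ln_le_subr1 (divr_gt0 m0 n0); rewrite ln_div ?posrE //.
set x := n.+1%:R in n0 yx *; set y := n.+2%:R in m0 yx *.
have -> : y / x - 1 = x^-1 by rewrite yx; field; rewrite gt_eqF.
move: (ln x) (ln y) (ln _) => a b c h.
have := ler_wpM2l (ltW n0) h; rewrite divff ?gt_eqF // yx; lra.
Qed.

Lemma ln_fact_le (n : nat) : (0 < n)%N ->
  ln (n`!%:R) <= n%:R * ln n%:R - n%:R + 1 + ln n%:R :> R.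
Proof.
elim: n => [//|[|n] IH _]; first by rewrite ln1; lra.
have n0 : 0 < n.+1%:R :> R by [].
have m0 : 0 < n.+2%:R :> R by [].
rewrite factS natrM lnM ?posrE // ?ltr0n ?fact_gt0 //.
have yx : n.+2%:R = n.+1%:R + 1 :> R by rewrite -[n.+2%:R]natr1.
have := IH isT; have := ln_ge_1subV (divr_gt0 m0 n0); rewrite ln_div ?posrE // invf_div.
set x := n.+1%:R in n0 yx *; set y := n.+2%:R in m0 yx *.
have -> : 1 - x / y = y^-1 by rewrite (_ : x = y - 1); [field; rewrite gt_eqF|rewrite yx addrK].
move: (ln x) (ln y) (ln _) => a b c h.
have := ler_wpM2l (ltW m0) h; rewrite divff ?gt_eqF // yx; lra.
Qed.

(** At its mean the binomial law loses only a polynomial factor: of the three factorials the two in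
    the denominator each cost 1 + log M in Stirling's bound. Exponentially unlikely events therefore
    stay negligible when exactly [m] edges are prescribed. *)
Lemma binomial_mode (M m : nat) : (0 < m)%N -> (m < M)%N ->
  expR (-2) / M%:R ^+ 2 <= ('C(M, m))%:R * ((m%:R / M%:R) ^+ m * (1 - m%:R / M%:R) ^+ (M - m)) :> R.
Proof.
move=> m0 mM; have M0 : (0 < M)%N by exact: leq_trans mM.
have d0 : (0 < M - m)%N by rewrite subn_gt0.
have mR : 0 < m%:R :> R by rewrite ltr0n.
have MR : 0 < M%:R :> R by rewrite ltr0n.
have dR : 0 < (M - m)%:R :> R by rewrite ltr0n.
have -> : 1 - m%:R / M%:R = (M - m)%:R / M%:R :> R.
  by rewrite natrB ?(ltnW mM) // mulrBl divff // gt_eqF.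
have F (k : nat) : 0 < k`!%:R :> R by rewrite ltr0n fact_gt0.
have B0 : 0 < ('C(M, m))%:R :> R by rewrite ltr0n bin_gt0 ltnW.
have bf : ln ('C(M, m))%:R = ln (M`!%:R) - ln (m`!%:R) - ln ((M - m)`!%:R) :> R.
  have := congr1 (fun x : nat => x%:R : R) (bin_fact (ltnW mM)).
  rewrite /= !natrM => <-.
  by rewrite !lnM ?posrE ?mulr_gt0 //; ring.
rewrite -[leRHS](@lnK R); last by rewrite posrE !mulr_gt0 ?exprn_gt0 ?divr_gt0.
have -> : expR (-2) / M%:R ^+ 2 = expR (- 2 - 2 * ln M%:R) :> R.
  by rewrite expRD (expRN (2 * _)) expRM_natl lnK ?posrE.
rewrite ler_expR !lnM ?posrE ?mulr_gt0 ?exprn_gt0 ?divr_gt0 //.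
rewrite !lnXn ?divr_gt0 // !ln_div ?posrE // bf.
rewrite -![(_ - _) *+ _]mulr_natl.
have := ln_fact_ge M0; have := ln_fact_le m0; have := ln_fact_le d0.
have l1 : ln m%:R <= ln M%:R :> R by rewrite ler_ln ?posrE // ler_nat ltnW.
have l2 : ln (M - m)%:R <= ln M%:R :> R by rewrite ler_ln ?posrE // ler_nat leq_subr.
have e : (M - m)%:R = M%:R - m%:R :> R by rewrite natrB // ltnW.
move: (ln (M - m)%:R) l2 (ln ((M-m)`!%:R)) => a l2 b.
rewrite e; lra.
Qed.

End Analytic.

(** * Exponential tail bounds for random subsets *)

Section Chernoff.
Variables (R : realType) (E : finType).
Implicit Types (P Q S : {set E}) (p : R).

(** The transform factorises over elements. In each factor the linear term vanishes because
    membership minus [p] has mean zero, and [expR_quadratic] leaves 2 lam^2 p(1-p). *)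
Lemma Pr_mgf p P Q lam : 0 < p < 1 -> Q \subset P -> `|lam| <= 2^-1 ->
  \sum_(S : {set E} | S \subset P) wgt p P S * expR (lam * (#|S :&: Q|%SET%:R - p * #|Q|%:R))
  <= expR (2 * lam ^+ 2 * #|Q|%:R).
Proof.
move=> hp sQ hl.
have /andP[p0 p1] := hp.
pose F (e : E) (b : bool) : R := wt p b * (if e \in Q then expR (lam * (b%:R - p)) else 1).
have -> : \sum_(S : {set E} | S \subset P) wgt p P S * expR (lam * (#|S :&: Q|%SET%:R - p * #|Q|%:R))
   = \prod_(e in P) (F e true + F e false).
  rewrite -sum_subsets_prod; apply: eq_bigr => S sS.
  rewrite /F big_split /= -/(wgt p P S); congr (_ * _).
  rewrite (big_setID Q) /= (finset.setIidPr sQ) [X in _ = _ * X]big1 ?mulr1; last first.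
    by move=> e /finset.setDP[_ /negbTE->].
  rewrite (eq_bigr (fun e => expR (lam * ((e \in S)%:R - p)))); last by move=> e ->.
  rewrite -expR_sum; congr expR.
  rewrite -mulr_sumr sumrB sumr_const mulr_natr; congr (_ * (_ - _)).
  by rewrite -sum1_card natr_sum big_mkcond [RHS]big_mkcond /=; apply: eq_bigr => e _;
    rewrite inE andbC; case: (e \in Q); case: (e \in S).
rewrite (big_setID Q) /= (finset.setIidPr sQ) [X in _ * X]big1 ?mulr1; last first.
  by move=> e /finset.setDP[_ /negbTE eQ]; rewrite /F eQ !mulr1 wt_sum.
rewrite mulr_natr -mulr_natl expRM_natl -prodr_const.
apply: ler_prod => e eQ; rewrite /F eQ.
rewrite addr_ge0 ?mulr_ge0 ?expR_ge0 ?wt_ge0 ?(ltW p0) ?(ltW p1) //=.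
rewrite /wt sub0r.
move: hl; rewrite ler_norml => /andP[l1 l2].
have a1 : lam * (1 - p) <= 2^-1.
  have [h|h] := leP 0 lam; last first.
    have := mulr_ge0 (y := 1 - p) (x := - lam); lra.
  have := mulr_ge0 h (ltW p0); lra.
have a2 : lam * - p <= 2^-1.
  have [h|h] := leP 0 lam.
    have := mulr_ge0 h (ltW p0); lra.
  have h' : 0 <= - lam by lra.
  have h2 : 0 <= 1 - p by lra.
  have := mulr_ge0 h' h2; lra.
have e1 := ler_wpM2l (ltW p0) (expR_quadratic a1).
have q0 : 0 <= 1 - p by lra.
have e2 := ler_wpM2l q0 (expR_quadratic a2).
apply: (le_trans (lerD e1 e2)).
apply: le_trans (expR_ge1Dx _).
have h1 : 0 <= lam ^+ 2 by exact: sqr_ge0.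
have -> : p * (1 + lam * (1 - p) + 2 * (lam * (1 - p)) ^+ 2) +
  (1 - p) * (1 + lam * - p + 2 * (lam * - p) ^+ 2) = 1 + 2 * lam ^+ 2 * (p * (1 - p)) by ring.
rewrite lerD2l; apply: ler_piMr; first by rewrite mulr_ge0.
by apply: mulr_ile1; lra.
Qed.

Lemma Pr_tail p P Q lam t : 0 < p < 1 -> Q \subset P -> 0 <= lam <= 2^-1 ->
  \sum_(S : {set E} | (S \subset P) && (t < `|#|S :&: Q|%SET%:R - p * #|Q|%:R|)) wgt p P S
  <= 2 * expR (2 * lam ^+ 2 * #|Q|%:R - lam * t).
Proof.
move=> hp sQ /andP[l0 l1].
have hpw : 0 <= p <= 1 by case/andP: hp => /ltW -> /ltW ->.
have n1 : `|lam| <= 2^-1 by rewrite ger0_norm.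
have n2 : `|- lam| <= 2^-1 by rewrite normrN.
have := lerD (Pr_mgf hp sQ n1) (Pr_mgf hp sQ n2).
rewrite sqrrN -big_split /= => h.
have -> : 2 * expR (2 * lam ^+ 2 * #|Q|%:R - lam * t) =
  (expR (2 * lam ^+ 2 * #|Q|%:R) + expR (2 * lam ^+ 2 * #|Q|%:R)) * expR (- (lam * t)).
  by rewrite expRD; ring.
apply: le_trans (ler_wpM2r (expR_ge0 _) h).
rewrite mulr_suml [leRHS](bigID (fun S : {set E} => t < `|#|S :&: Q|%SET%:R - p * #|Q|%:R|)) /=.
rewrite ler_wpDr //.
  apply: sumr_ge0 => S _; rewrite mulr_ge0 ?expR_ge0 // addr_ge0 // mulr_ge0 ?expR_ge0 ?wgt_ge0 //.
apply: ler_sum => S /andP[_ hS].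
rewrite -mulrDr -mulrA ler_peMr ?wgt_ge0 //.
rewrite mulrDl -!expRD.
set z := #|_|%:R - _ in hS *.
have [z0|z0] := leP 0 z.
  rewrite ler_wpDr ?expR_ge0 // -expR0 ler_expR.
  by rewrite ger0_norm // in hS; rewrite -mulrBr mulr_ge0 // subr_ge0 ltW.
rewrite ler_wpDl ?expR_ge0 // -expR0 ler_expR.
by rewrite ltr0_norm // in hS; rewrite mulNr -opprD oppr_ge0 -mulrDr mulr_ge0_le0 //; lra.
Qed.

End Chernoff.

Lemma sum_union_bound (R : realType) (I J : finType) (P : pred I) (A : pred I) (Q : pred J)
    (B : J -> pred I) (w : I -> R) :
  (forall i, P i -> 0 <= w i) ->
  (forall i, P i -> A i -> exists2 j, Q j & B j i) ->
  \sum_(i | P i && A i) w i <= \sum_(j | Q j) \sum_(i | P i && B j i) w i.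
Proof.
move=> w0 h; rewrite (exchange_big_dep P) /=; last by move=> j i _ /andP[].
rewrite big_mkcondr /=; apply: ler_sum => i Pi; case: ifPn => [Ai|_]; last first.
  by apply: sumr_ge0 => j _; exact: w0.
have [j Qj Bj] := h i Pi Ai.
by rewrite (bigD1 j) ?Qj ?Pi ?Bj //= ler_wpDr // sumr_ge0 // => k _; exact: w0.
Qed.

(** * Jumbledness of a random graph with prescribed edge number *)

Section Jumbledness.
Variables (R : realType) (T : finType) (p eta : R) (m : nat).
Let n := #|T|.
Let PT := pairs [set: T]%SET.
Hypotheses (hp : 0 < p < 1) (heta : 0 < eta <= 1) (n1 : (1 < n)%N).
Hypothesis pm : p * ('C(n, 2))%:R = m%:R.
Implicit Types (H : {set {set T}}) (K : {set T}).

Definition deviation H K : R := `|#|H :&: pairs K|%SET%:R - p * ('C(#|K|, 2))%:R|.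
Definition jumbledb H := [forall K : {set T},
  deviation H K <= eta * (#|K|%:R * (#|T|%:R - #|K|%:R))].

Lemma jumbledbP H : jumbledb H -> jumbled p eta H.
Proof. by move=> /forallP h K; exact: h. Qed.

(** With exactly m = p 'C(n,2) edges in all, the pairs inside [K] and the remaining pairs deviate
    equally. Testing the suitable family keeps its size below 2 |K| (n - |K|). *)
Let QK K := if (2 * #|K| <= n)%N then pairs K else (PT :\: pairs K)%SET.

Let cardPT : #|PT| = 'C(n, 2). Proof. by rewrite card_pairs cardsT. Qed.

Let QK_sub K : QK K \subset PT.
Proof. by rewrite /QK; case: ifP => _; [exact: pairsT|exact: finset.subsetDl]. Qed.

Let cardQD K : #|(PT :\: pairs K)%SET|%:R = ('C(n, 2))%:R - ('C(#|K|, 2))%:R :> R.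
Proof.
rewrite -cardPT -(cardsID (pairs K) PT) natrD (finset.setIidPr (pairsT K)) card_pairs.
by rewrite addrC addKr.
Qed.

Let devQ H K : H \subset PT -> #|H| = m ->
  deviation H K = `|#|H :&: QK K|%SET%:R - p * #|QK K|%:R|.
Proof.
move=> sH cH; rewrite /QK /deviation; case: ifP => _; first by rewrite card_pairs.
rewrite cardQD -normrN; congr `|_|.
have : #|H|%:R = #|H :&: pairs K|%SET%:R + #|H :&: (PT :\: pairs K)|%SET%:R :> R.
  rewrite -natrD -(cardsID (pairs K) H); congr (_ + _)%N%:R.
  congr #|pred_of_set _|; apply/finset.setP => e; rewrite !finset.in_setD !finset.in_setI finset.in_setD.
  case eH : (e \in H); rewrite ?andbF //= ?andbT.
  by rewrite (fintype.subsetP sH _ eH) andbT.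
rewrite cH mulrBr pm; lra.
Qed.

Let cardQ K : #|QK K|%:R <= 2 * (#|K|%:R * (n%:R - #|K|%:R)) :> R.
Proof.
have kn : (#|K| <= n)%N by exact: max_card.
have kR : #|K|%:R <= n%:R :> R by rewrite ler_nat.
rewrite /QK; case: ifPn => h.
  rewrite card_pairs bin2R.
  have h2 : 2 * #|K|%:R <= n%:R :> R by rewrite -natrM ler_nat.
  have k0 : 0 <= #|K|%:R :> R by [].
  have := ler_wpM2l k0 h2; move: (sqr_ge0 (#|K|%:R : R)); rewrite expr2; lra.
rewrite cardQD !bin2R.
have h2 : 0 <= 2 * #|K|%:R - n%:R :> R.
  by rewrite subr_ge0 -natrM ler_nat; move: h; rewrite -ltnNge => /ltnW.
have d0 : 0 <= n%:R - #|K|%:R :> R by lra.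
have k0 : 0 <= #|K|%:R :> R by [].
have h3 : 0 <= 3 * #|K|%:R - n%:R :> R by lra.
by have := mulr_ge0 d0 h3; lra.
Qed.

Lemma min_gap_n (k : nat) : (k <= n)%N ->
  n%:R * (minn k (n - k))%:R / 2 <= k%:R * (n%:R - k%:R) :> R.
Proof.
move=> kn.
have kR : k%:R <= n%:R :> R by rewrite ler_nat.
have kR0 : 0 <= k%:R :> R by [].
case: (leqP k (n - k)) => h.
  have h2 : 0 <= n%:R - 2 * k%:R :> R.
    by rewrite subr_ge0 -natrM ler_nat; move: h kn; clear; lia.
  by have := mulr_ge0 kR0 h2; lra.
have h2 : 0 <= 2 * k%:R - n%:R :> R.
  by rewrite subr_ge0 -natrM ler_nat; move: h kn; clear; lia.
rewrite natrB //; have h3 : 0 <= n%:R - k%:R :> R by lra.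
by have := mulr_ge0 h3 h2; lra.
Qed.

Lemma Pr_not_jumbled : ln n%:R <= eta ^+ 2 * n%:R / 32 ->
  \sum_(H : {set {set T}} | (H \subset PT) && ((#|H| == m) && ~~ jumbledb H)) wgt p PT H
  <= 2 * n.+1%:R * expR (- (eta ^+ 2 * n%:R / 32 - ln n%:R)).
Proof.
move=> hn.
have /andP[e0 e1] := heta.
have w0 H : 0 <= wgt p PT H by apply: wgt_ge0; case/andP: hp => /ltW -> /ltW ->.
pose B K := fun H : {set {set T}} =>
  eta * (#|K|%:R * (n%:R - #|K|%:R)) < `|#|H :&: QK K|%SET%:R - p * #|QK K|%:R|.
apply: (le_trans (@sum_union_bound _ _ _ _ _ (fun K : {set T} => (0 < #|K| < n)%N) B _ _ _)) => //.
  move=> H sH /andP[/eqP cH]; rewrite negb_forall => /existsP[K]; rewrite -ltNge => hK.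
  exists K; last by rewrite /B -(devQ K sH cH).
  have kn : (#|K| <= n)%N by exact: max_card.
  (* The empty set contains no pairs and the full set has exactly [m] edges, so neither can violate
     the bound. *)
  case: (posnP #|K|) => k0.
    have P0 : pairs K = finset.set0.
      by apply/eqP; rewrite -cards_eq0 card_pairs k0.
    move: hK; rewrite /deviation P0 finset.setI0 cards0 k0 bin0n /= !mulr0n.
    by rewrite !(mulr0, mul0r, subr0, normr0) ltxx.
  rewrite ltn_neqAle kn andbT; apply: contraTneq hK => kE.
  rewrite /deviation -/n kE subrr !mulr0 pm.
  have -> : K = [set: T]%SET.
    by apply/eqP; rewrite finset.eqEcard finset.subsetT cardsT -/n kE leqnn.
  by rewrite (finset.setIidPl sH) cH subrr normr0 ltxx.
pose c := eta ^+ 2 * n%:R / 32.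
have hK K : (0 < #|K| < n)%N ->
  \sum_(H : {set {set T}} | (H \subset PT) && B K H) wgt p PT H <=
  2 * expR (- (c * (minn #|K| (n - #|K|))%:R)).
  move=> /andP[k0 kn].
  (* With x = |K|(n - |K|) and |QK| <= 2x the Chernoff exponent is at most eta^2 x/16 - eta^2 x/8.
     As x is at least half of n min(|K|, n - |K|), this is at most -c min(|K|, n - |K|), which beats
     the number of sets of that size. *)
  have lam : 0 <= eta / 8 <= 2^-1 by apply/andP; split; lra.
  apply: (le_trans (Pr_tail _ hp (QK_sub K) lam)).
  rewrite ler_pM2l // ler_expR.
  have := cardQ K; have := min_gap_n (ltnW kn).
  set x := #|K|%:R * _; set mu := (minn _ _)%:R => h1 h2.
  have s0 : 0 <= eta ^+ 2 := sqr_ge0 eta.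
  have := ler_wpM2l s0 h1; have := ler_wpM2l s0 h2.
  rewrite /c; have -> : (eta / 8) ^+ 2 = eta ^+ 2 / 64 by rewrite expr2 (expr2 eta); lra.
  have -> : eta / 8 * (eta * x) = eta ^+ 2 * x / 8 by rewrite expr2; lra.
  lra.
apply: (le_trans (ler_sum _ hK)).
rewrite (partition_big (fun K : {set T} => inord #|K| : 'I_n.+1) (fun k => (0 < k < n)%N)) /=; last first.
  by move=> K /andP[a b]; rewrite inordK ?a // ltnS ltnW.
apply: (@le_trans _ _ (\sum_(k : 'I_n.+1 | (0 < k < n)%N) 2 * expR (- (c - ln n%:R)))); last first.
  rewrite sumr_const -[leLHS]mulr_natl.
  rewrite -/c mulrA [2 * n.+1%:R]mulrC -mulrA -[leRHS]mulrA; apply: ler_wpM2r.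
    by rewrite mulr_ge0 // expR_ge0.
  by rewrite ler_nat; apply: leq_trans (max_card _) _; rewrite card_ord.
apply: ler_sum => k /andP[k0 kn].
set mu := minn k (n - k).
have mu1 : (0 < mu)%N by rewrite /mu leq_min k0 subn_gt0.
rewrite (eq_bigr (fun=> 2 * expR (- (c * mu%:R)))); last first.
  by move=> K /andP[_ /eqP kE]; rewrite /mu -kE inordK // ltnS max_card.
rewrite sumr_const -[leLHS]mulr_natl mulrCA ler_pM2l //.
have n0 : 0 < n%:R :> R by rewrite ltr0n ltnW.
have l0 : 0 <= ln n%:R :> R by rewrite ln_ge0 // ler1n ltnW.
apply: (@le_trans _ _ ((n ^ mu)%:R * expR (- (c * mu%:R)))).
  apply: ler_wpM2r; rewrite ?expR_ge0 // ler_nat.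
  apply: (@leq_trans 'C(n, k)).
    rewrite -card_draws -/n; apply: subset_leq_card; apply/fintype.subsetP => K.
    rewrite !inE => /andP[_ /eqP <-]; rewrite inordK ?eqxx // ltnS max_card //.
  rewrite /mu; case: (leqP k (n - k)) => _; first exact: bin_leq_exp.
  by rewrite -bin_sub ?bin_leq_exp // ltnW.
rewrite natrX -{1}[n%:R](@lnK R) ?posrE // -expRM_natl -expRD ler_expR.
have : 1 <= mu%:R :> R by rewrite ler1n.
rewrite -/c in hn *; move=> m1.
have d0 : 0 <= c - ln n%:R by lra.
have := ler_wpM2l d0 m1; lra.
Qed.

End Jumbledness.

(** * Asymmetry of a random graph *)

Section Asymmetry.
Variables (R : realType) (T : finType) (p : R) (w : nat).
Let n := #|T|.
Let PT := pairs [set: T]%SET.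
Hypotheses (hp : 0 < p < 1) (n1 : (1 < n)%N) (hw : (6 * (2 * w + 1) <= n)%N).
Implicit Types (H : {set {set T}}) (th : {ffun T -> option T}).

Definition moved th : {set T} := [set x in dom th | tot th x != x]%SET.

(* take [A] maximal: then every moved point lies in [A], [th A] or [th^-1 A] *)
Lemma moved_third th : pinj th -> exists2 A : {set T}, A \subset moved th &
  [disjoint A & tot th @: A]%SET /\ (#|moved th| <= 3 * #|A|)%N.
Proof.
move=> ip.
pose P (A : {set T}) := (A \subset moved th) && [disjoint A & (tot th @: A)%SET].
have P0 : P finset.set0.
  rewrite /P finset.sub0set /=; apply/pred0P => x /=; by rewrite !inE.
have [A /finset.maxsetP[/andP[sA dA] maxA] _] := finset.maxset_exists P0.
exists A => //; split => //.
have sd x : x \in moved th -> x \in dom th by rewrite inE => /andP[].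
have cover : moved th \subset (A :|: (tot th @: A) :|: [set x in moved th | tot th x \in A])%SET.
  apply/fintype.subsetP => x xm; rewrite !finset.in_setU inE xm /=.
  apply/negPn/negP; rewrite !negb_or => /andP[/andP[xA xtA] txA].
  have PxA : P (x |: A)%SET.
    rewrite /P finset.subUset finset.sub1set xm sA /=.
    rewrite finset.imsetU1; apply/pred0P => y /=; apply/negP => /andP[].
    rewrite !finset.in_setU1 => /orP[/eqP ->|yA] /orP[/eqP E|yt].
    - by move: xm; rewrite inE -E eqxx andbF.
    - by rewrite yt in xtA.
    - by rewrite -E yA in txA.
    - by rewrite (disjointFr dA yA) in yt.
  have := maxA _ PxA (finset.subsetUr _ _) => E.
  by move: xA; rewrite -E finset.setU11.
apply: (leq_trans (subset_leq_card cover)).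
have c1 : (#|tot th @: A|%SET <= #|A|)%N by exact: leq_imset_card.
have c2 : (#|[set x in moved th | tot th x \in A]|%SET <= #|A|)%N.
  rewrite -(@card_in_imset _ _ (tot th) [set x in moved th | tot th x \in A]%SET).
    apply: subset_leq_card; apply/fintype.subsetP => y /finset.imsetP[x].
    by rewrite inE => /andP[_ h] ->.
  move=> x y; rewrite inE => /andP[/sd xd _]; rewrite inE => /andP[/sd yd _].
  exact: (pinjP ip).
have := finset.cardsU (A :|: (tot th @: A))%SET [set x in moved th | tot th x \in A]%SET.
have := finset.cardsU A (tot th @: A)%SET.
move: c1 c2; set a := #|A|; set b := #|_ @: _|%SET; set c := #|[set x in _ | _]|%SET.
set d := #|_|; set e := #|_|; set f := #|_|; set g := #|_|.
clear; lia.
Qed.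

Lemma Pr_self_map th : pinj th -> (n - #|dom th| <= w)%N -> 
  \sum_(H : {set {set T}} | (H \subset PT) && self_map th H) wgt p PT H
  <= expR (ln (p ^+ 2 + (1 - p) ^+ 2) * (#|moved th|%:R * n%:R / 36)).
Proof.
move=> ip hd.
have hp' : 0 <= p <= 1 by case/andP: hp => /ltW -> /ltW ->.
have [A sA [dA cA]] := moved_third ip.
set F := (dom th :\: moved th)%SET.
(* [F] is the set of fixed points of [th]. A pair in [Q] meets [A] while its image avoids [A], so
   [Q] and its image are disjoint and [Pr_evr_eq] applies. *)
pose Q := (pairs (A :|: F) :\: pairs F)%SET.
have sd : moved th \subset dom th by apply/fintype.subsetP => x; rewrite inE => /andP[].
have sAd : A \subset dom th := fintype.subset_trans sA sd.
have sFd : F \subset dom th := finset.subsetDl _ _.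
have sAF : (A :|: F)%SET \subset dom th by rewrite finset.subUset sAd sFd.
have fixF x : x \in F -> tot th x = x.
  by rewrite !inE => /andP[]; case: (isSome _) => //= /negPn/eqP.
have disAF : [disjoint A & F].
  apply/pred0P => x /=; apply/negP => /andP[/(fintype.subsetP sA) xm].
  by rewrite finset.in_setD xm.
have tA x : x \in (A :|: F)%SET -> tot th x \notin A.
  rewrite finset.in_setU => /orP[xA|xF].
    by apply/negP => h; have := disjointFr dA h; rewrite imset_f.
  by rewrite fixF //; rewrite (disjointFl disAF xF).
have inj1 : {in (A :|: F)%SET &, injective (tot th)}.
  move=> x y xa ya; apply: (pinjP ip); exact: (fintype.subsetP sAF).
have sQ : Q \subset pairs (A :|: F)%SET by exact: finset.subsetDl.
have meetA e : e \in Q -> exists2 x, x \in e & x \in A.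
  rewrite inE [e \in pairs (A :|: F)%SET]inE => /andP[eF /andP[eAF c2]].
  have : ~~ (e \subset F) by apply: contra eF => eF; rewrite inE eF.
  move=> /fintype.subsetPn[x xe xF]; exists x => //.
  by have := fintype.subsetP eAF _ xe; rewrite finset.in_setU (negbTE xF) orbF.
have imQ e : e \in Q -> (tot th @: e)%SET \in pairs [set: T]%SET /\ [disjoint (tot th @: e)%SET & A].
  move=> eQ; have := fintype.subsetP sQ _ eQ; rewrite inE => /andP[eAF ce]; split.
    rewrite inE finset.subsetT /= card_in_imset // => x y xe ye.
    by apply: inj1; exact: (fintype.subsetP eAF).
  apply/pred0P => y /=; apply/negP => /andP[/finset.imsetP[x xe ->]].
  by apply/negP; apply: tA; exact: (fintype.subsetP eAF).
have step : \sum_(H : {set {set T}} | (H \subset PT) && self_map th H) wgt p PT H <=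
   \sum_(H : {set {set T}} | H \subset PT) wgt p PT H * (evr_eq Q (fun e : {set T} => tot th @: e)%SET H)%:R.
  rewrite big_mkcondr; apply: ler_sum => H sH; case: ifPn => [/forall_inP sm|_]; last first.
    by rewrite mulr_ge0 // wgt_ge0.
  suff -> : evr_eq Q (fun e : {set T} => tot th @: e)%SET H by rewrite mulr1.
  apply/forall_inP => e eQ; rewrite eq_sym; apply: sm.
  exact: (fintype.subsetP (pairsS sAF)) (fintype.subsetP sQ _ eQ).
apply: (le_trans step).
apply: (le_trans (Pr_evr_eq hp' _ _ _ _)).
- exact: fintype.subset_trans sQ (pairsT _).
- move=> e1 e2 /(fintype.subsetP sQ) h1 /(fintype.subsetP sQ) h2.
  exact: (imset_pairs_inj inj1 h1 h2).
- by apply/fintype.subsetP => y /finset.imsetP[e /imQ[h _] ->].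
- apply/pred0P => e /=; apply/negP => /andP[/meetA[x xe xA] /finset.imsetP[e0 /imQ[_ d] ee]].
  by have := disjointFl d xA; rewrite -ee xe.
set k := p ^+ 2 + _.
have k0 : 0 < k.
  by case/andP: hp => a b; rewrite addr_gt0 // exprn_gt0 // subr_gt0.
have k1 : ln k <= 0.
  rewrite ln_le0 // /k; case/andP: hp => a b.
  have b' : 0 <= 1 - p by lra.
  have := mulr_ge0 (ltW a) b'; rewrite !expr2; lra.
rewrite -[X in X ^+ _](@lnK R) ?posrE // -expRM_natl ler_expR mulrC.
apply: ler_wnM2l => //.
have cQ : #|Q|%:R = ('C(#|A| + #|F|, 2))%:R - ('C(#|F|, 2))%:R :> R.
  have <- : #|(A :|: F)%SET| = (#|A| + #|F|)%N.
    by rewrite finset.cardsU finset.disjoint_setI0 // cards0 subn0.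
  rewrite -!card_pairs -(cardsID (pairs F) (pairs (A :|: F))%SET).
  rewrite (finset.setIidPr (pairsS (finset.subsetUr _ _))) natrD addrC addKr //.
rewrite cQ !bin2R natrD.
have cF : #|F|%:R = #|dom th|%:R - #|moved th|%:R :> R.
  by rewrite -(cardsID (moved th) (dom th)) (finset.setIidPr sd) natrD [X in X - _]addrC addrK.
have dn : n%:R - w%:R <= #|dom th|%:R :> R.
  by rewrite lerBlDr -natrD ler_nat; move: hd; clear; lia.
have rn : #|moved th|%:R <= n%:R :> R by rewrite ler_nat max_card.
have hA : #|moved th|%:R <= 3 * #|A|%:R :> R by rewrite -natrM ler_nat.
have hwR : 6 * (2 * w%:R + 1) <= n%:R :> R.
  by rewrite -[1]/(1%:R) -!natrM -natrD -natrM ler_nat.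
move: cF dn rn hA hwR (ler0n R #|A|) (ler0n R #|moved th|).
move: (#|A|%:R : R) (#|F|%:R : R) (#|dom th|%:R : R) (#|moved th|%:R : R) (n%:R : R) (w%:R : R).
clear => a f d r N W -> h1 h2 h3 h4 a0 r0.
(* Here |Q| = a(a + 2f - 1)/2 with a >= r/3. Since r <= N, the bracket is at least N/3 - (2W + 1),
   and [hw] makes this at least N/6; altogether |Q| >= rN/36. *)
have q : N / 6 <= (a + 2 * (d - r) - 1) by lra.
have N0 : 0 <= N / 6 by lra.
have := ler_pM (x1 := r / 3) (y1 := a) _ N0 _ q; lra.
Qed.

(** A map with [r] moved and at most [w] missing points is within distance r + w of the identity,
    giving at most n^(3(r + w)) maps. Each preserves the edges with probability at most exp(-c r
    n/36). *)
Lemma Pr_not_asym : 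
  let c := - ln (p ^+ 2 + (1 - p) ^+ 2) in
  3 * (1 + w%:R) * ln n%:R <= c * n%:R / 36 ->
  \sum_(H : {set {set T}} | (H \subset PT) && ~~ asym w H) wgt p PT H
  <= n.+1%:R * expR (- (c * n%:R / 36 - 3 * (1 + w%:R) * ln n%:R)).
Proof.
move=> c hc.
have w0 H : 0 <= wgt p PT H by apply: wgt_ge0; case/andP: hp => /ltW -> /ltW ->.
pose Q th := [&& pinj th, (n - #|dom th| <= w)%N & (0 < #|moved th|)%N].
apply: (le_trans (@sum_union_bound _ _ _ _ _ Q (fun th H => self_map th H) _ _ _)) => //.
  move=> H sH; rewrite negb_forall => /existsP[th].
  rewrite negb_imply => /andP[/andP[/andP[ip hd] sm]].
  rewrite negb_forall => /existsP[x]; rewrite negb_imply => /andP[xd xm].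
  exists th => //; rewrite /Q ip hd; apply/card_gt0P; exists x; by rewrite inE xd.
apply: (@le_trans _ _ (\sum_(th | Q th) expR (- (c * (#|moved th|%:R * n%:R / 36))))).
  apply: ler_sum => th /and3P[ip hd _].
  by apply: (le_trans (Pr_self_map ip hd)); rewrite /c mulNr opprK.
rewrite (partition_big (fun th => inord #|moved th| : 'I_n.+1) (fun r => (0 < r)%N)) /=; last first.
  by move=> th /and3P[_ _ h]; rewrite inordK // ltnS max_card.
set z := c * n%:R / 36 - _.
apply: (@le_trans _ _ (\sum_(r : 'I_n.+1 | (0 < r)%N) expR (- z))); last first.
  rewrite sumr_const -[leLHS]mulr_natl; apply: ler_wpM2r; first exact: expR_ge0.
  by rewrite ler_nat; apply: leq_trans (max_card _) _; rewrite card_ord.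
apply: ler_sum => r r0.
rewrite (eq_bigr (fun=> expR (- (c * (r%:R * n%:R / 36))))); last first.
  by move=> th /andP[_ /eqP <-]; rewrite inordK // ltnS max_card.
rewrite sumr_const -[leLHS]mulr_natl.
have n0 : 0 < n%:R :> R by rewrite ltr0n ltnW.
have l0 : 0 <= ln n%:R :> R by rewrite ln_ge0 // ler1n ltnW.
pose id0 : {ffun T -> option T} := [ffun x => Some x].
apply: (@le_trans _ _ ((n ^ (3 * (r + w)))%:R * expR (- (c * (r%:R * n%:R / 36))))).
  apply: ler_wpM2r; first exact: expR_ge0.
  rewrite ler_nat.
  have := card_hamming_ball id0 (r + w) (ltnW n1).
  rewrite card_option -/n => hb.
  apply: (@leq_trans ((n * n.+1) ^ (r + w))%N).
    apply: leq_trans hb; apply: subset_leq_card; apply/fintype.subsetP => th.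
    rewrite inE => /andP[/and3P[ip hd _] /eqP cr].
    have rE : #|moved th| = r by rewrite -cr inordK // ltnS max_card.
    apply: (@leq_trans #|(moved th :|: ~: dom th)%SET|).
      apply: subset_leq_card; apply/fintype.subsetP => x; rewrite !inE ffunE /tot.
      case: (th x) => [y|] //=; rewrite orbF; apply: contra => /eqP ->; exact: eqxx.
    apply: (leq_trans (leq_card_setU _ _)); rewrite rE leq_add2l.
    by apply: leq_trans hd; rewrite /n -(cardsC (dom th)) addKn.
  rewrite expnM leq_exp2r; last by rewrite addn_gt0 r0.
  rewrite !expnS expn0 muln1; apply: leq_mul => //.
  by move: n1; clear; case: n => [|[|k]] // _; rewrite mulSn !addSn !ltnS mulnS; lia.
rewrite natrX -{1}[n%:R](@lnK R) ?posrE // -expRM_natl -expRD ler_expR.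
have r1 : 1 <= r%:R :> R by rewrite ler1n.
rewrite natrM natrD.
have z0 : 0 <= z by rewrite subr_ge0.
have h1 := ler_wpM2l z0 r1.
have h2 : w%:R * ln n%:R <= r%:R * (w%:R * ln n%:R) :> R.
  by apply: ler_peMl => //; rewrite mulr_ge0.
move: h1 h2; rewrite /z; lra.
Qed.

End Asymmetry.

(** * Common induced subgraphs *)

Section Bridge.
Variable V : finType.
Implicit Types (F G : sgraph V).

Lemma edges_sub G : edges G \subset pairs [set: V]%SET.
Proof.
apply/fintype.subsetP => e eG; rewrite inE finset.subsetT /=.
exact: (forall_inP (svalP G)).
Qed.

Lemma edges_inj : injective (@edges V).
Proof. by move=> F G; exact: val_inj. Qed.

Lemma edges_onto (S : {set {set V}}) : S \subset pairs [set: V]%SET -> exists G, edges G = S.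
Proof.
move=> sS; have h : [forall e in S, #|e| == 2%N].
  by apply/forall_inP => e /(fintype.subsetP sS); rewrite inE => /andP[].
by exists (exist _ S h).
Qed.

Lemma adjE G x y : adj G x y = ([set x; y]%SET \in edges G).
Proof. by []. Qed.

Lemma adj_irr G x : adj G x x = false.
Proof.
rewrite adjE finset.setUid; apply/negbTE/negP => /(fintype.subsetP (edges_sub G)).
by rewrite inE cards1 andbF.
Qed.

Lemma adj_induced G (S : {set V}) (x y : {x : V | x \in S}) :
  adj (Defs.induced G S) x y = adj G (val x) (val y).
Proof. by rewrite /adj {1}/edges /= inE finset.imsetU1 finset.imset_set1. Qed.

Lemma pb_pair (T : finType) (f : T -> V) G a b : injective f ->
  ([set a; b]%SET \in pb f (edges G)) = adj G (f a) (f b).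
Proof.
move=> fi; rewrite inE inE finset.subsetT /= finset.imsetU1 finset.imset_set1 -adjE.
rewrite cards2; case: (eqVneq a b) => [->|_] //=.
by rewrite adj_irr.
Qed.

Lemma eq_pb (T : finType) (f1 f2 : T -> V) F G : injective f1 -> injective f2 ->
  (forall a b, adj F (f1 a) (f1 b) = adj G (f2 a) (f2 b)) ->
  pb f1 (edges F) = pb f2 (edges G).
Proof.
move=> i1 i2 h; apply/finset.setP => e.
case: (boolP (e \in pairs [set: T]%SET)) => [he|he]; last first.
  by rewrite !inE; rewrite inE in he; rewrite (negbTE he).
move: he; rewrite inE finset.subsetT => /cards2P[a [b [_ ->]]].
by rewrite !pb_pair.
Qed.

Lemma common_inducedP F G n : reflect (exists f1 f2 : {ffun 'I_n -> V},
   [/\ injective f1, injective f2 & pb f1 (edges F) = pb f2 (edges G)])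
  `[< common_induced F G n >].
Proof.
apply: (iffP (asboolP _)) => [[S1 [S2 [c1 c2 [phi phib hphi]]]]|[f1 [f2 [i1 i2 E]]]].
  have e1 : #|{: {x : V | x \in S1}}| = n by rewrite card_sig.
  pose g (i : 'I_n) : {x : V | x \in S1} := enum_val (cast_ord (esym e1) i).
  have gi : injective g by move=> i j /enum_val_inj/cast_ord_inj.
  exists [ffun i => val (g i)], [ffun i => val (phi (g i))].
  have i1 : injective [ffun i => val (g i)].
    by move=> i j; rewrite !ffunE => /val_inj/gi.
  have i2 : injective [ffun i => val (phi (g i))].
    by move=> i j; rewrite !ffunE => /val_inj/(bij_inj phib)/gi.
  split => //; apply: eq_pb => // a b; rewrite !ffunE.
  by rewrite -(adj_induced G) hphi adj_induced.
exists (f1 @: [set: 'I_n])%SET, (f2 @: [set: 'I_n])%SET.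
have ih1 i : f1 i \in (f1 @: [set: 'I_n])%SET by rewrite imset_f ?inE.
have ih2 i : f2 i \in (f2 @: [set: 'I_n])%SET by rewrite imset_f ?inE.
split; rewrite ?card_imset ?cardsT ?card_ord //.
have inv1 (x : {x : V | x \in (f1 @: [set: 'I_n])%SET}) : exists i, f1 i == val x.
  by case: x => x /= /finset.imsetP[i _ ->]; exists i.
have inv2 (x : {x : V | x \in (f2 @: [set: 'I_n])%SET}) : exists i, f2 i == val x.
  by case: x => x /= /finset.imsetP[i _ ->]; exists i.
pose r1 x := xchoose (inv1 x); pose r2 x := xchoose (inv2 x).
have r1E x : f1 (r1 x) = val x by apply/eqP; exact: (xchooseP (inv1 x)).
have r2E x : f2 (r2 x) = val x by apply/eqP; exact: (xchooseP (inv2 x)).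
exists (fun x => exist _ (f2 (r1 x)) (ih2 (r1 x))).
  exists (fun y => exist _ (f1 (r2 y)) (ih1 (r2 y))) => x; apply: val_inj => /=.
    by rewrite -[RHS]r1E; congr (f1 _); apply: i2; rewrite r2E.
  by rewrite -[RHS]r2E; congr (f2 _); apply: i1; rewrite r1E.
move=> x y; rewrite !adj_induced /= -!r1E -!pb_pair //.
by rewrite E.
Qed.

(** The property is hereditary: a common copy on more vertices, restricted to its first [n] labels,
    is a common copy on [n] vertices. *)
Lemma mcis_geP F G n : (0 < n)%N -> reflect (exists f1 f2 : {ffun 'I_n -> V},
   [/\ injective f1, injective f2 & pb f1 (edges F) = pb f2 (edges G)])
  (n <= mcis F G)%N.
Proof.
move=> n0; apply: (iffP idP) => [h|].
  have [k nk] : exists2 k : 'I_#|V|.+1, (n <= k)%N & `[< common_induced F G k >].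
    apply/exists_inP; apply: contraTT h; rewrite negb_exists_in => /forall_inP h.
    rewrite -ltnNge -(prednK n0) ltnS; apply/bigmax_leqP => k ck.
    rewrite -ltnS (prednK n0) ltnNge; apply/negP => nk.
    by have := h _ nk; rewrite ck.
  move=> /common_inducedP[f1 [f2 [i1 i2 E]]].
  pose wd := widen_ord nk.
  have wi : injective wd by move=> i j /(congr1 val) /= ij; exact: val_inj.
  have j1 : injective [ffun i => f1 (wd i)] by move=> i j; rewrite !ffunE => /i1/wi.
  have j2 : injective [ffun i => f2 (wd i)] by move=> i j; rewrite !ffunE => /i2/wi.
  exists [ffun i => f1 (wd i)], [ffun i => f2 (wd i)]; split => //.
  by apply: eq_pb => // a b; rewrite !ffunE -!pb_pair // E.
move=> h; have [f1 [_ [i1 _ _]]] := h.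
have nV : (n < #|V|.+1)%N.
  by rewrite ltnS -[n]card_ord -(card_codom i1) max_card.
have c : `[< common_induced F G (Ordinal nV) >] by apply/common_inducedP.
exact: (@leq_bigmax_cond _ (fun k : 'I_#|V|.+1 => `[< common_induced F G k >]) (fun k => val k) _ c).
Qed.

End Bridge.

(** * Probabilities of graph events as sums over edge sets *)

Section Prob.
Variables (R : realType) (N : nat) (p1 p2 : R).
Hypotheses (hp1 : 0 < p1 < 1) (hp2 : 0 < p2 < 1).
Let V := 'I_N.

(** [edges] is a bijection from graphs to sets of pairs, so the law becomes [ww], for which the
    moments are computed. *)
Lemma gnp2_probE (A : pred (sgraph V * sgraph V)) (B : pred ({set {set V}} * {set {set V}})) :
  (forall FG, A FG = B (edges FG.1, edges FG.2)) ->
  gnp2_prob p1 p2 A = \sum_(G | PP G && B G) ww p1 p2 G.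
Proof.
move=> h.
pose e (FG : sgraph V * sgraph V) := (edges FG.1, edges FG.2).
have ei : injective e by move=> [a b] [c d] [] /edges_inj -> /edges_inj ->.
transitivity (\sum_(FG | A FG) ww p1 p2 (e FG)).
  apply: eq_bigr => FG _; rewrite /ww /gnp_pmf /wgt /wt.
  by congr (_ * _); apply: eq_bigl => x; rewrite !inE finset.subsetT.
rewrite (eq_bigl (mem [set FG | A FG]%SET)); last by move=> FG; rewrite /= inE.
rewrite -(big_imset (ww p1 p2)) /=; last by move=> ? ? _ _ /ei.
apply: eq_bigl => -[G1 G2]; apply/finset.imsetP/andP.
  by move=> [FG]; rewrite inE h => hA [-> ->]; rewrite /PP /= !edges_sub.
rewrite /PP /= => -[/andP[/edges_onto[F FE] /edges_onto[G GE]] hB].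
by exists (F, G); rewrite ?inE ?h /e /= FE GE.
Qed.

Lemma gnp2_prob_total : @gnp2_prob R N p1 p2 xpredT = 1.
Proof.
rewrite (@gnp2_probE _ xpredT) //.
by under eq_bigl do rewrite andbT; exact: ww_total.
Qed.

Lemma gnp2_prob_ge0 (A : pred (sgraph V * sgraph V)) : 0 <= gnp2_prob p1 p2 A.
Proof.
apply: sumr_ge0 => FG _; apply: mulr_ge0; apply: prodr_ge0 => e _; case: ifP => _;
  by move: hp1 hp2 => /andP[a b] /andP[c d]; rewrite ?subr_ge0 ltW.
Qed.

Lemma gnp2_prob_compl (A : pred (sgraph V * sgraph V)) : gnp2_prob p1 p2 A = 1 - gnp2_prob p1 p2 (predC A).
Proof.
by rewrite -[X in X - _]gnp2_prob_total /gnp2_prob [X in _ = X - _](bigID A) /= addrK.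
Qed.

Lemma gnp2_prob_le1 (A : pred (sgraph V * sgraph V)) : gnp2_prob p1 p2 A <= 1.
Proof. by rewrite gnp2_prob_compl lerBlDr lerDl gnp2_prob_ge0. Qed.

Lemma gnp2_prob_union (A B C : pred (sgraph V * sgraph V)) : (forall FG, A FG -> B FG || C FG) ->
  gnp2_prob p1 p2 A <= gnp2_prob p1 p2 B + gnp2_prob p1 p2 C.
Proof.
move=> h; rewrite /gnp2_prob [X in X <= _]big_mkcond [X in _ <= X + _]big_mkcond
   [X in _ <= _ + X]big_mkcond -big_split /=.
apply: ler_sum => FG _.
have w0 : 0 <= gnp_pmf p1 FG.1 * gnp_pmf p2 FG.2.
  by apply: mulr_ge0; apply: prodr_ge0 => e _; case: ifP => _;
    move: hp1 hp2 => /andP[a b] /andP[c d]; rewrite ?subr_ge0 ltW.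
case: ifPn => [/h|_]; last by case: ifP; case: ifP; rewrite ?addr0 ?add0r ?addr_ge0.
by case: (B FG); case: (C FG) => //= _; rewrite ?addr0 ?add0r // lerDl.
Qed.

End Prob.

(** * First moment *)

Section FirstMoment.
Variables (R : realType) (n N : nat) (p1 p2 : R).
Hypotheses (hp1 : 0 < p1 < 1) (hp2 : 0 < p2 < 1) (n1 : (1 < n)%N) (N1 : (0 < N)%N).
Let T := 'I_n.
Let V := 'I_N.
Let PT := pairs [set: T]%SET.
Let M := 'C(n, 2).

Lemma M_gt0 : (0 < M)%N.
Proof. by rewrite bin_gt0. Qed.

Lemma cardPT : #|PT| = M.
Proof. by rewrite card_pairs cardsT card_ord. Qed.

Definition sized (m : nat) : {set {set {set T}}} := [set H : {set {set T}} | (H \subset PT) && (#|H| == m)]%SET.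

Lemma sizedP m H : H \in sized m -> H \subset PT /\ #|H| = m.
Proof. by rewrite inE => /andP[? /eqP]. Qed.

Lemma card_pb_perm (s : {perm T}) (f : {ffun T -> V}) (G : {set {set V}}) :
  #|pb [ffun x => f (s x)] G| = #|pb f G|.
Proof.
pose sI (e : {set T}) := (s @: e)%SET.
have sIi : injective sI by apply: finset.imset_inj; exact: perm_inj.
rewrite -(card_imset _ sIi); apply: eq_card => e.
have fE (e' : {set T}) : ([ffun x => f (s x)] @: e' = f @: sI e')%SET.
  by rewrite -imset_comp; apply: finset.eq_imset => x; rewrite ffunE.
apply/finset.imsetP/idP => [[e' he' ->]|he].
  move: he'; rewrite !inE !finset.subsetT fE /= card_imset //; exact: perm_inj.
have eE : sI (s^-1%g @: e)%SET = e.
  by rewrite /sI -imset_comp (finset.eq_imset (g := id)) ?finset.imset_id // => x /=; rewrite permKV.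
exists (s^-1%g @: e)%SET; last by rewrite eE.
by move: he; rewrite !inE !finset.subsetT fE eE /= card_imset //; exact: perm_inj.
Qed.

Lemma Pr_sized m : \sum_(H in sized m) (m%:R / M%:R) ^+ m * (1 - m%:R / M%:R) ^+ (M - m) <= 1 :> R.
Proof.
have [mM|mM] := leqP m M; last first.
  rewrite big1 ?ler01 // => H /sizedP[sH cH].
  by have := subset_leq_card sH; rewrite cH cardPT leqNgt mM.
have hp : 0 <= (m%:R / M%:R : R) <= 1.
  rewrite divr_ge0 //= ler_pdivrMr ?mul1r ?ler_nat // ltr0n; exact: M_gt0.
rewrite -[leRHS](wgt_total (m%:R / M%:R) PT) [leRHS](bigID (mem (sized m))) /=.
rewrite ler_wpDr; first by [].
  by apply: sumr_ge0 => H _; exact: wgt_ge0.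
rewrite le_eqVlt; apply/orP; left; apply/eqP.
apply: eq_big => [H|H /sizedP[sH cH]]; first by rewrite inE andbA andbb.
by rewrite wgt_card // cH cardPT.
Qed.

(** Change of measure from density [r] to the empirical density m/M; this is where relative entropy
    enters. *)
Lemma power_relent (r : R) (m : nat) : 0 < r < 1 -> (m <= M)%N ->
  r ^+ m * (1 - r) ^+ (M - m) =
  (m%:R / M%:R) ^+ m * (1 - m%:R / M%:R) ^+ (M - m) * expR (- (M%:R * relent r (m%:R / M%:R))).
Proof.
move=> /andP[r0 r1] mM.
have M0 : 0 < M%:R :> R by rewrite ltr0n M_gt0.
have q0 : 0 < 1 - r by rewrite subr_gt0.
have qE : M%:R * (1 - m%:R / M%:R) = (M - m)%:R :> R.
  by rewrite natrB // mulrBr mulr1 mulrC divfK // gt_eqF.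
have pE : M%:R * (m%:R / M%:R) = m%:R :> R by rewrite mulrC divfK // gt_eqF.
have key (x y : R) k : 0 < y -> (0 < k)%N -> 0 < x ->
  y ^+ k = x ^+ k * expR (- (k%:R * ln (x / y))).
  move=> y0 _ x0; rewrite expRN expRM_natl lnK ?posrE ?divr_gt0 //.
  by rewrite expr_div_n invf_div mulrC divfK // expf_neq0 // gt_eqF.
have -> : - (M%:R * relent r (m%:R / M%:R)) =
   - (m%:R * ln (m%:R / M%:R / r)) + - ((M - m)%:R * ln ((1 - m%:R / M%:R) / (1 - r))).
  rewrite /relent -qE; set q := m%:R / M%:R in pE *; rewrite -pE; ring.
rewrite expRD mulrACA; congr (_ * _).
  (* At the extreme edge numbers one power has base and exponent 0 and equals 1, and the matching
     entropy term is 0. *)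
  case: (posnP m) => [->|m0]; first by rewrite !expr0 mul0r oppr0 expR0 mulr1.
  by apply: key => //; rewrite divr_gt0 // ltr0n.
case: (posnP (M - m)) => [->|m0]; first by rewrite !expr0 mul0r oppr0 expR0 mulr1.
by apply: key => //; rewrite -(pmulr_rgt0 _ M0) qE ltr0n.
Qed.

Lemma power_entropy (m : nat) : (m <= M)%N ->
  (m%:R / M%:R) ^+ m * (1 - m%:R / M%:R) ^+ (M - m) = expR (- (M%:R * entropy (m%:R / M%:R))) :> R.
Proof.
move=> mM.
have M0 : 0 < M%:R :> R by rewrite ltr0n M_gt0.
have qE : M%:R * (1 - m%:R / M%:R) = (M - m)%:R :> R.
  by rewrite natrB // mulrBr mulr1 mulrC divfK // gt_eqF.
have pE : M%:R * (m%:R / M%:R) = m%:R :> R by rewrite mulrC divfK // gt_eqF.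
have -> : - (M%:R * entropy (m%:R / M%:R)) =
   (m%:R * ln (m%:R / M%:R)) + ((M - m)%:R * ln (1 - m%:R / M%:R)) :> R.
  rewrite /entropy -qE; set q := m%:R / M%:R in pE *; rewrite -pE; ring.
rewrite expRD !expRM_natl; congr (_ * _).
  case: (posnP m) => [->|m0]; first by rewrite !expr0.
  by rewrite lnK // posrE divr_gt0 // ltr0n.
case: (posnP (M - m)) => [->|m0]; first by rewrite !expr0.
by rewrite lnK // posrE -(pmulr_rgt0 _ M0) qE ltr0n.
Qed.

Definition copies (m : nat) (G : {set {set V}} * {set {set V}}) :=
  [exists f1 : {ffun T -> V}, [exists f2 : {ffun T -> V},
     [&& injectiveb f1, injectiveb f2, pb f1 G.1 == pb f2 G.2 & #|pb f1 G.1| == m]]].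

Lemma compose_injs (f : {ffun T -> V}) (s : {perm T}) : f \in injs T V -> [ffun x => f (s x)] \in injs T V.
Proof. by move=> /injsP i; apply/injsP => x y; rewrite !ffunE => /i/perm_inj. Qed.

Lemma compose_inj (f : {ffun T -> V}) : f \in injs T V ->
  injective (fun s : {perm T} => [ffun x => f (s x)]).
Proof. by move=> /injsP i s t /ffunP E; apply/permP => x; have := E x; rewrite !ffunE => /i. Qed.

(* relabelling a common copy by the n! permutations gives distinct pairs of
   embeddings *)
Lemma copies_count m G : copies m G -> n`!%:R <= Xcount R (sized m) G.
Proof.
move=> /existsP[f1 /existsP[f2 /and4P[j1 j2 /eqP E /eqP cm]]].
have i1 : f1 \in injs T V by rewrite inE. have i2 : f2 \in injs T V by rewrite inE.
rewrite /Xcount.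
pose h (s : {perm T}) := ([ffun x => f1 (s x)], [ffun x => f2 (s x)]) : {ffun T -> V} * {ffun T -> V}.
have hi : injective h by move=> s t [] /(compose_inj i1).
rewrite pair_big /=.
pose F (q : {ffun T -> V} * {ffun T -> V}) : R :=
  \sum_(H in sized m) (pb q.1 G.1 == H)%:R * (pb q.2 G.2 == H)%:R.
have F0 q : 0 <= F q by apply: sumr_ge0 => H _; rewrite mulr_ge0.
rewrite [leRHS](eq_bigr F) //.
apply: (@le_trans _ _ (\sum_(q in (h @: [set: {perm T}])%SET) F q)); last first.
  rewrite [leRHS](bigID (mem (h @: [set: {perm T}])%SET)) /= ler_wpDr ?sumr_ge0 //.
  rewrite le_eqVlt; apply/orP; left; apply/eqP; apply: eq_bigl => q.
  case hq : (q \in _) => /=; last by rewrite andbF.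
  have /finset.imsetP[s _ ->] := hq; by rewrite /h /= !compose_injs.
rewrite big_imset /=; last by move=> s t _ _ /hi.
have -> : n`!%:R = \sum_(s in [set: {perm T}]%SET) (1 : R).
  rewrite sumr_const cardsT; congr (_%:R).
  exact: (esym (card_Sn n)).
apply: ler_sum => s _; rewrite /F /h /=.
have sz : pb [ffun x => f1 (s x)] G.1 \in sized m by rewrite inE pb_sub card_pb_perm cm eqxx.
rewrite (bigD1 _ sz) /= eqxx mul1r.
suff -> : pb [ffun x => f2 (s x)] G.2 = pb [ffun x => f1 (s x)] G.1.
  by rewrite eqxx ler_wpDr // sumr_ge0 // => H _; rewrite mulr_ge0.
have cE (f : {ffun T -> V}) (K : {set {set V}}) : pb [ffun x => f (s x)] K = pb s (pb f K).
  apply/finset.setP => e; rewrite !inE !finset.subsetT /= card_imset; last exact: perm_inj.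
  case: (_ == _) => //=.
  suff -> : ([ffun x => f (s x)] @: e = f @: (s @: e))%SET by [].
  by rewrite -imset_comp; apply: finset.eq_imset => x; rewrite ffunE.
by rewrite !cE E.
Qed.

End FirstMoment.

(** * First-moment bounds for each edge number *)

Section FirstMomentBounds.
Variables (R : realType) (n N : nat) (p1 p2 : R).
Hypotheses (hp1 : 0 < p1 < 1) (hp2 : 0 < p2 < 1) (n1 : (1 < n)%N) (N1 : (0 < N)%N).
Let T := 'I_n.
Let V := 'I_N.
Let PV := pairs [set: V]%SET.
Let M := 'C(n, 2).
Let L : R := ln N%:R.

Let injs_le : #|injs T V|%:R <= expR (n%:R * L) :> R.
Proof.
rewrite expRM_natl /L lnK ?posrE ?ltr0n // card_injs !card_ord -natrX ler_nat.
exact: ffact_leq_exp.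
Qed.

Let factE : n`!%:R = expR (ln n`!%:R) :> R.
Proof. by rewrite lnK // posrE ltr0n fact_gt0. Qed.

Let pi_ (r : R) (m : nat) : R := r ^+ m * (1 - r) ^+ (M - m).

(** By total probability at density m/M. Together with [power_entropy] it bounds the number of
    [m]-edge graphs by the exponential of M times the entropy. *)
Lemma sized_le (m : nat) : (m <= M)%N -> #|sized n m|%:R * pi_ (m%:R / M%:R) m <= 1.
Proof. by move=> mM; have := @Pr_sized R n n1 m; rewrite sumr_const -[X in X <= _ -> _]mulr_natl. Qed.

Lemma sized_relent (r : R) (m : nat) : 0 < r < 1 -> (m <= M)%N ->
  #|sized n m|%:R * pi_ r m <= expR (- (M%:R * relent r (m%:R / M%:R))).
Proof.
move=> hr mM; rewrite /pi_ (power_relent n1 hr mM) mulrA ler_piMl ?expR_ge0 //.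
exact: sized_le.
Qed.

Lemma copies_single m (G0 : {set {set V}}) (f1 : {ffun T -> V}) :
  injective f1 -> #|pb f1 G0| = m ->
  n`!%:R <= \sum_(f in injs T V) \sum_(H in sized n m) (pb f G0 == H)%:R :> R.
Proof.
move=> i1 cm; have i1' : f1 \in injs T V by apply/injsP.
pose h (s : {perm T}) : {ffun T -> V} := [ffun x => f1 (s x)].
have hi : injective h by exact: compose_inj.
apply: (@le_trans _ _ (\sum_(f in (h @: [set: {perm T}])%SET) \sum_(H in sized n m) (pb f G0 == H)%:R)); last first.
  rewrite [leRHS](bigID (mem (h @: [set: {perm T}])%SET)) /= ler_wpDr //.
    by apply: sumr_ge0 => f _; apply: sumr_ge0.
  rewrite le_eqVlt; apply/orP; left; apply/eqP; apply: eq_bigl => f.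
  case hf : (f \in (h @: _)%SET) => /=; last by rewrite andbF.
  by have /finset.imsetP[s _ ->] := hf; rewrite andbT compose_injs.
rewrite big_imset /=; last by move=> s t _ _ /hi.
have -> : n`!%:R = \sum_(s in [set: {perm T}]%SET) (1 : R).
  rewrite sumr_const cardsT; congr (_%:R).
  exact: (esym (card_Sn n)).
apply: ler_sum => s _.
have sz : pb (h s) G0 \in sized n m by rewrite inE pb_sub card_pb_perm cm eqxx.
by rewrite (bigD1 _ sz) /= eqxx ler_wpDr // sumr_ge0.
Qed.

Lemma single_moment (r : R) (m : nat) : 0 < r < 1 ->
  \sum_(G0 : {set {set V}} | G0 \subset PV)
     wgt r PV G0 * (\sum_(f in injs T V) \sum_(H in sized n m) (pb f G0 == H)%:R)
  = #|injs T V|%:R * (#|sized n m|%:R * pi_ r m).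
Proof.
move=> hr; under eq_bigr do rewrite mulr_sumr.
rewrite exchange_big /= mulr_natl -sumr_const; apply: eq_bigr => f /injsP fi.
under eq_bigr do rewrite mulr_sumr.
rewrite exchange_big /= mulr_natl -sumr_const; apply: eq_bigr => H /sizedP[sH cH].
by rewrite Pr_pb // wgt_card // cH cardPT.
Qed.

Lemma Pr_copies0 m : (m <= M)%N ->
  \sum_(G | PP G && @copies n N m G) ww p1 p2 G <=
  expR (2 * n%:R * L - ln n`!%:R -
    M%:R * (relent p1 (m%:R / M%:R) + relent p2 (m%:R / M%:R) + entropy (m%:R / M%:R))).
Proof.
move=> mM.
have f0 : 0 < n`!%:R :> R by rewrite ltr0n fact_gt0.
rewrite -(ler_pM2l f0).
apply: (@le_trans _ _ (\sum_(G | PP G) ww p1 p2 G * Xcount R (sized n m) G)).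
  rewrite mulr_sumr big_mkcondr /=; apply: ler_sum => G _; case: ifPn => [c|_].
    by rewrite mulrC ler_wpM2l ?ww_ge0 //; exact: copies_count.
  apply: mulr_ge0; first exact: ww_ge0.
  by apply: sumr_ge0 => f _; apply: sumr_ge0 => f' _; apply: sumr_ge0 => H _; rewrite mulr_ge0.
rewrite (EXcount V p1 p2 (@sizedP n m)) cardPT -/(pi_ p1 m) -/(pi_ p2 m).
have P0 r : 0 < r < 1 -> 0 <= pi_ r m.
  by move=> /andP[a b]; rewrite mulr_ge0 // exprn_ge0 // ?subr_ge0 ltW.
set q : R := m%:R / M%:R.
have S0 : 0 <= #|sized n m|%:R * (pi_ p1 m * pi_ p2 m) by apply: mulr_ge0 => //; apply: mulr_ge0; exact: P0.
(* Changing the measure twice leaves two powers at density [q]: one absorbs the number of graphs,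
   the other is the entropy term. *)
have A : #|sized n m|%:R * (pi_ p1 m * pi_ p2 m) <=
   expR (- (M%:R * relent p1 q)) * expR (- (M%:R * relent p2 q)) * expR (- (M%:R * entropy q)).
  rewrite -(power_entropy R n1 mM) /pi_ (power_relent n1 hp1 mM) (power_relent n1 hp2 mM).
  rewrite -/q; set z := q ^+ m * _.
  have sz : #|sized n m|%:R * z <= 1 by exact: sized_le.
  have z0 : 0 <= z by rewrite /z /q (power_entropy R n1 mM) expR_ge0.
  rewrite [leLHS](_ : _ = (#|sized n m|%:R * z) * (expR (- (M%:R * relent p1 q)) * expR (- (M%:R * relent p2 q)) * z)); last by ring.
  by apply: ler_piMl => //; apply: mulr_ge0 => //; apply: mulr_ge0; exact: expR_ge0.
have I2 : #|injs T V|%:R ^+ 2 <= expR (n%:R * L) ^+ 2 by rewrite ler_pXn2r // nnegrE ?expR_ge0.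
rewrite -mulrA; apply: (le_trans (ler_pM _ S0 I2 A)); first exact: exprn_ge0.
rewrite [X in _ <= X * _]factE -expRM_natl -!expRD ler_expR; lra.
Qed.

(** The second graph is summed out. A common copy gives at least n! labelled [m]-edge copies in the
    first graph alone. *)
Lemma Pr_copies1 m : (m <= M)%N ->
  \sum_(G | PP G && @copies n N m G) ww p1 p2 G <=
  expR (n%:R * L - ln n`!%:R - M%:R * relent p1 (m%:R / M%:R)).
Proof.
move=> mM.
have f0 : 0 < n`!%:R :> R by rewrite ltr0n fact_gt0.
rewrite -(ler_pM2l f0).
pose Y (G0 : {set {set V}}) : R := \sum_(f in injs T V) \sum_(H in sized n m) (pb f G0 == H)%:R.
apply: (@le_trans _ _ (\sum_(G | PP G) ww p1 p2 G * (Y G.1 * 1))).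
  rewrite mulr_sumr big_mkcondr /=; apply: ler_sum => G _; rewrite mulr1.
  case: ifPn => [|_]; last first.
    apply: mulr_ge0; first exact: ww_ge0.
    by apply: sumr_ge0 => f _; apply: sumr_ge0.
  move=> /existsP[f1 /existsP[f2 /and4P[/injectiveP i1 _ _ /eqP cm]]].
  by rewrite mulrC ler_wpM2l ?ww_ge0 //; exact: (copies_single i1 cm).
rewrite (sum_ww p1 p2 Y (fun=> 1)).
rewrite [X in _ * X](eq_bigr (wgt p2 PV)); last by move=> G _; rewrite mulr1.
rewrite wgt_total mulr1 single_moment //.
apply: (@le_trans _ _ (expR (n%:R * L) * expR (- (M%:R * relent p1 (m%:R / M%:R))))).
  apply: ler_pM => //; last exact: sized_relent.
  by case/andP: hp1 => a b; apply: mulr_ge0 => //; apply: mulr_ge0; apply: exprn_ge0; rewrite ?subr_ge0 ltW.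
by rewrite [X in _ <= X * _]factE -!expRD ler_expR; lra.
Qed.

Lemma Pr_copies2 m : (m <= M)%N ->
  \sum_(G | PP G && @copies n N m G) ww p1 p2 G <=
  expR (n%:R * L - ln n`!%:R - M%:R * relent p2 (m%:R / M%:R)).
Proof.
move=> mM.
have f0 : 0 < n`!%:R :> R by rewrite ltr0n fact_gt0.
rewrite -(ler_pM2l f0).
pose Y (G0 : {set {set V}}) : R := \sum_(f in injs T V) \sum_(H in sized n m) (pb f G0 == H)%:R.
apply: (@le_trans _ _ (\sum_(G | PP G) ww p1 p2 G * (1 * Y G.2))).
  rewrite mulr_sumr big_mkcondr /=; apply: ler_sum => G _; rewrite mul1r.
  case: ifPn => [|_]; last first.
    apply: mulr_ge0; first exact: ww_ge0.
    by apply: sumr_ge0 => f _; apply: sumr_ge0.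
  move=> /existsP[f1 /existsP[f2 /and4P[_ /injectiveP i2 /eqP E /eqP cm]]].
  rewrite E in cm.
  by rewrite mulrC ler_wpM2l ?ww_ge0 //; exact: (copies_single i2 cm).
rewrite (sum_ww p1 p2 (fun=> 1) Y).
rewrite [X in X * _](eq_bigr (wgt p1 PV)); last by move=> G _; rewrite mulr1.
rewrite wgt_total mul1r single_moment //.
apply: (@le_trans _ _ (expR (n%:R * L) * expR (- (M%:R * relent p2 (m%:R / M%:R))))).
  apply: ler_pM => //; last exact: sized_relent.
  by case/andP: hp2 => a b; apply: mulr_ge0 => //; apply: mulr_ge0; apply: exprn_ge0; rewrite ?subr_ge0 ltW.
by rewrite [X in _ <= X * _]factE -!expRD ler_expR; lra.
Qed.

Lemma mcis_ge_copies (F G : sgraph V) :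
  (n <= mcis F G)%N = [exists m : 'I_M.+1, @copies n N m (edges F, edges G)].
Proof.
apply/idP/existsP.
  move=> /(mcis_geP _ _ (ltnW n1))[f1 [f2 [i1 i2 E]]].
  have cm : (#|pb f1 (edges F)| < M.+1)%N.
    by rewrite ltnS /M -(@cardPT n) subset_leq_card // pb_sub.
  exists (Ordinal cm); apply/existsP; exists f1; apply/existsP; exists f2.
  by apply/and4P; split; [exact/injectiveP|exact/injectiveP|exact/eqP|].
move=> [m /existsP[f1 /existsP[f2 /and4P[/injectiveP i1 /injectiveP i2 /eqP E _]]]].
by apply/(mcis_geP _ _ (ltnW n1)); exists f1, f2.
Qed.

Theorem first_moment (s : R) :
  (forall m : nat, (m <= M)%N -> let q : R := m%:R / M%:R in
     [\/ 2 * n%:R * L - ln n`!%:R - M%:R * (relent p1 q + relent p2 q + entropy q) <= - s,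
         n%:R * L - ln n`!%:R - M%:R * relent p1 q <= - s |
         n%:R * L - ln n`!%:R - M%:R * relent p2 q <= - s]) ->
  @gnp2_prob R N p1 p2 (fun FG => (n <= mcis FG.1 FG.2)%N) <= M.+1%:R * expR (- s).
Proof.
move=> hs.
rewrite (@gnp2_probE R N p1 p2 _ (fun G => [exists m : 'I_M.+1, @copies n N m G])); last first.
  by move=> FG; rewrite mcis_ge_copies.
apply: (le_trans (@sum_union_bound _ _ _ _ _ (fun=> true) (fun m : 'I_M.+1 => @copies n N m) _ _ _)).
- by move=> G _; exact: ww_ge0.
- by move=> G _ /existsP[m hm]; exists m.
apply: (@le_trans _ _ (\sum_(m : 'I_M.+1) expR (- s))).
  apply: ler_sum => m _; have mM : (m <= M)%N by rewrite -ltnS.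
  case: (hs m mM) => h.
  - by apply: (le_trans (Pr_copies0 mM)); rewrite ler_expR.
  - by apply: (le_trans (Pr_copies1 mM)); rewrite ler_expR.
  - by apply: (le_trans (Pr_copies2 mM)); rewrite ler_expR.
by rewrite sumr_const card_ord -[leLHS]mulr_natl.
Qed.

End FirstMomentBounds.

(** * Lower bound by the second moment *)

Section SecondMomentTheorem.
Variables (R : realType) (n N m w : nat) (p1 p2 p eta lam s : R).
Hypotheses (hp1 : 0 < p1 < 1) (hp2 : 0 < p2 < 1) (hp : 0 < p < 1).
Let M := 'C(n, 2).
Let L : R := ln N%:R.
Let c := - ln (p ^+ 2 + (1 - p) ^+ 2).
Let z1 := eta ^+ 2 * n%:R / 32 - ln n%:R.
Let z2 := c * n%:R / 36 - 3 * (1 + w%:R) * ln n%:R.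

Lemma second_moment : (1 < n)%N -> (0 < N)%N -> (n <= w * w)%N -> (6 * (2 * w + 1) <= n)%N ->
  p * M%:R = m%:R ->
  0 < eta <= 1 -> 0 <= s -> s <= L / 8 ->
  (ln n`!%:R + s) / n%:R <= L / 16 ->
  (4 + w)%:R * ln n%:R <= L / 16 ->
  8 * (lam * eta) * (n%:R - 1) <= L ->
  `|ln (p / p1) - ln ((1 - p) / (1 - p1))| <= lam ->
  `|ln (p / p2) - ln ((1 - p) / (1 - p2))| <= lam ->
  `|ln p - ln (1 - p)| <= lam ->
  M%:R * relent p1 p <= n%:R * L - ln n`!%:R - s ->
  M%:R * relent p2 p <= n%:R * L - ln n`!%:R - s ->
  M%:R * (relent p1 p + relent p2 p + entropy p) <= 2 * n%:R * L - ln n`!%:R - s ->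
  N%:R ^+ n <= 2 * (N ^_ n)%:R :> R ->
  0 <= z1 -> 0 <= z2 ->
  2 * n.+1%:R * expR (- z1) + n.+1%:R * expR (- z2) <= expR (-2) / M%:R ^+ 2 / 2 ->
  @gnp2_prob R N p1 p2 (fun FG => ~~ (n <= mcis FG.1 FG.2)%N) <=
    8 * M%:R ^+ 2 * expR 2 * (n.+1%:R ^+ 2 * expR (- s)).
Proof.
move=> n1 N1 nw hw6 pM heta s0 sL hD hw herr hl1 hl2 hl3 h1 h2 h0 hND z10 z20 hz.
pose T := 'I_n; pose V := 'I_N.
have cT : #|T| = n := card_ord n.
have cV : #|V| = N := card_ord N.
pose PT := pairs [set: T]%SET.
have cPT : #|PT| = M by exact: cardPT.
have M0 : 0 < M%:R :> R by rewrite ltr0n M_gt0.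
have /andP[p0 p1'] := hp.
have m0 : (0 < m)%N by rewrite -(ltr0n R) -pM mulr_gt0.
have mM : (m < M)%N by rewrite -(ltr_nat R) -pM gtr_pMl.
have pE : p = m%:R / M%:R by rewrite -pM mulfK // gt_eqF.
pose GG : {set {set {set T}}} :=
  [set H : {set {set T}} | [&& (H \subset PT) && (#|H| == m), jumbledb p eta H & asym w H]]%SET.
have GGP H : H \in GG -> H \subset PT /\ #|H| = m.
  by rewrite inE => /and3P[/andP[? /eqP]].
(* Half of the bound from [binomial_mode]; [hz] says that failures of jumbledness and asymmetry use
   up at most the other half. *)
pose g : R := expR (-2) / M%:R ^+ 2 / 2.
have g0 : 0 < g by rewrite !divr_gt0 ?expR_gt0 ?exprn_gt0.
have n1T : (1 < #|T|)%N by rewrite cT.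
have hg : g <= #|GG|%:R * (p ^+ m * (1 - p) ^+ (#|PT| - m)).
  have J1 : \sum_(H : {set {set T}} | (H \subset PT) && ((#|H| == m) && ~~ jumbledb p eta H)) wgt p PT H
     <= 2 * n.+1%:R * expR (- z1).
    have := @Pr_not_jumbled R T p eta m hp heta n1T; rewrite cT; apply => //.
    by rewrite -subr_ge0.
  have J2 : \sum_(H : {set {set T}} | (H \subset PT) && ~~ asym w H) wgt p PT H <= n.+1%:R * expR (- z2).
    have := @Pr_not_asym R T p w hp n1T; rewrite cT; apply => //.
    by rewrite -subr_ge0.
  have B : expR (-2) / M%:R ^+ 2 <= \sum_(H : {set {set T}} | (H \subset PT) && (#|H| == m)) wgt p PT H.
    apply: (le_trans (@binomial_mode R M m m0 mM)).
    rewrite -pE (eq_bigr (fun=> p ^+ m * (1 - p) ^+ (M - m))); last first.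
      by move=> H /andP[sH /eqP cH]; rewrite wgt_card // cH cPT.
    rewrite sumr_const -[leRHS]mulr_natl.
    rewrite le_eqVlt; apply/orP; left; apply/eqP; congr (_%:R * _).
    by rewrite -cPT -cards_draws; apply: eq_card => H; rewrite inE.
  have w0 H : 0 <= wgt p PT H by apply: wgt_ge0; rewrite (ltW p0) (ltW p1').
  have -> : #|GG|%:R * (p ^+ m * (1 - p) ^+ (#|PT| - m)) = \sum_(H in GG) wgt p PT H.
    rewrite (eq_bigr (fun=> p ^+ m * (1 - p) ^+ (#|PT| - m))); last first.
      by move=> H /GGP[sH cH]; rewrite wgt_card // cH.
    by rewrite sumr_const -[RHS]mulr_natl.
  have S : \sum_(H : {set {set T}} | (H \subset PT) && (#|H| == m)) wgt p PT H <=
    \sum_(H in GG) wgt p PT H + (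
    \sum_(H : {set {set T}} | (H \subset PT) && ((#|H| == m) && ~~ jumbledb p eta H)) wgt p PT H +
    \sum_(H : {set {set T}} | (H \subset PT) && ~~ asym w H) wgt p PT H).
    rewrite [X in X <= _]big_mkcond [X in _ <= X + _]big_mkcond [X in _ <= _ + (X + _)]big_mkcond
      [X in _ <= _ + (_ + X)]big_mkcond -!big_split /=.
    apply: ler_sum => H _; rewrite inE.
    case: (H \subset PT) => /=; last by rewrite !addr0.
    case: (#|H| == m) => /=; last by rewrite !add0r; case: ifP.
    by case: (jumbledb p eta H); case: (asym w H) => /=; rewrite ?addr0 ?add0r // lerDl.
  rewrite /g; move: B S J1 J2 hz; lra.
have X0 := @Xcount_zero_le R T V p1 p2 p m w GG hp1 hp2 hp eta lam s g GGP _ _ n1T.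
rewrite cT cV in X0.
have {}X0 := X0 _ _ N1 nw _ s0 sL hD hw herr hl1 hl2 hl3 h1 h2 h0 hND g0 hg.
have -> : 8 * M%:R ^+ 2 * expR 2 * (n.+1%:R ^+ 2 * expR (- s)) = 4 * (n.+1%:R ^+ 2 * expR (- s)) / g.
  rewrite /g (expRN 2); field; rewrite !gt_eqF ?expR_gt0 ?exprn_gt0 //.
have eta0 : 0 <= eta by case/andP: heta => /ltW.
apply: le_trans (X0 _ _ eta0); last 2 first.
- by move=> H; rewrite inE => /and3P[_ /jumbledbP].
- by move=> H; rewrite inE => /and3P[].
rewrite (@gnp2_probE R N p1 p2 _ (fun G => ~~ [exists m : 'I_M.+1, @copies n N m G])); last first.
  by move=> FG; rewrite (mcis_ge_copies n1).
rewrite [leLHS]big_mkcondr [leRHS]big_mkcondr /=; apply: ler_sum => G _.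
case: ifPn => [hG|_]; last by case: ifP => // _; exact: ww_ge0.
suff -> : Xcount R GG G == 0 by [].
apply/eqP/big1 => f1 /injsP i1; apply: big1 => f2 /injsP i2; apply: big1 => H HG.
case: eqP => [e1|_]; last by rewrite mul0r.
case: eqP => [e2|_]; last by rewrite mulr0.
case/negP: hG; have [sH cH] := GGP _ HG.
have mM1 : (m < M.+1)%N by rewrite ltnS ltnW.
apply/existsP; exists (Ordinal mM1); apply/existsP; exists f1; apply/existsP; exists f2.
by apply/and4P; split; [exact/injectiveP|exact/injectiveP|rewrite e1 e2|rewrite e1 cH].
Qed.

End SecondMomentTheorem.

(** * The rate functions and the parameter n_N *)

Section Entropy.
Local Open Scope classical_set_scope.
Local Open Scope ring_scope.
Variable R : realType.
Implicit Types (p r a x y : R).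

Definition xlnx x : R := x * ln x.

Lemma xlnx_cont : continuous xlnx.
Proof.
move=> x; have [x0|x0|->] := ltgtP x 0.
- rewrite /continuous_at (_ : xlnx x = 0); last by rewrite /xlnx ln0 ?mulr0 // ltW.
  apply: cvg_near_cst; near=> y; rewrite /xlnx ln0 ?mulr0 // ltW //; near: y.
  exact: lt_nbhsl.
- by apply: cvgM; [exact: cvg_id|exact: continuous_ln].
- rewrite /continuous_at /xlnx mul0r; apply/cvgrPdist_le => e e0; near=> y.
  rewrite sub0r normrN; have [y0|y0] := leP y 0.
    by rewrite ln0 // mulr0 normr0 ltW.
  have hy : y <= (Num.min (e / 2) 1) ^+ 2.
    have : `|0 - y| < (Num.min (e / 2) 1) ^+ 2.
      near: y; apply: (cvgr_dist_lt (F := nbhs (0 : R)) (T := R)).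
        exact: cvg_id.
      by apply/exprn_gt0; rewrite lt_min ltr01 andbT divr_gt0.
    by rewrite sub0r normrN gtr0_norm // => /ltW.
  (* With y = z^2 the bound ln z >= 1 - 1/z gives |y ln y| <= 2z, which is why [y] was taken below
     the square of e/2. *)
  set z := Num.sqrt y; have z0 : 0 < z by rewrite sqrtr_gt0.
  have yz : y = z ^+ 2 by rewrite sqr_sqrtr // ltW.
  have m0 : 0 <= Num.min (e / 2) 1 by rewrite le_min ler01 andbT divr_ge0 // ltW.
  have zm : z <= Num.min (e / 2) 1 by rewrite yz ler_pXn2r // ?nnegrE ?ltW // in hy.
  move: zm; rewrite le_min => /andP[ze z1].
  rewrite yz lnXn // -[ln z *+ 2]mulr_natl.
  have := ln_ge_1subV z0; have l0 := ln_le0 z1.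
  rewrite ler0_norm; last by rewrite mulr_ge0_le0 ?exprn_ge0 ?mulr_ge0_le0 // ltW.
  move=> h; have := ler_wpM2l (exprn_ge0 2 (ltW z0)) h.
  have -> : z ^+ 2 * (1 - z^-1) = z ^+ 2 - z by field; rewrite gt_eqF.
  have := sqr_ge0 z; lra.
Unshelve. all: by end_near. Qed.

Lemma relentE r p : 0 < r < 1 ->
  relent r p = r * xlnx (p / r) + (1 - r) * xlnx ((1 - p) / (1 - r)).
Proof.
move=> /andP[r0 r1].
have key x c l : 0 < c -> c * (x / c * l) = x * l.
  by move=> c0; rewrite mulrA (mulrC c) divfK // gt_eqF.
by rewrite /relent /xlnx !key // subr_gt0.
Qed.

Lemma relent_cont r : 0 < r < 1 -> continuous (relent r).
Proof.
move=> hr; rewrite (_ : relent r = fun p => r * xlnx (p / r) + (1 - r) * xlnx ((1 - p) / (1 - r))); last first.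
  by apply/funext => p; exact: relentE.
move=> p; apply: cvgD; apply: cvgM; try exact: cvg_cst.
  apply: (@continuous_comp _ _ _ (fun p => p / r) xlnx); last exact: xlnx_cont.
  by apply: cvgM; [exact: cvg_id|exact: cvg_cst].
apply: (@continuous_comp _ _ _ (fun p => (1 - p) / (1 - r)) xlnx); last exact: xlnx_cont.
apply: cvgM; last exact: cvg_cst.
by apply: cvgB; [exact: cvg_cst|exact: cvg_id].
Qed.

Lemma entropy_cont : continuous (@entropy R).
Proof.
move=> p; apply: cvgN; apply: cvgD; first exact: xlnx_cont.
apply: (@continuous_comp _ _ _ (fun p => 1 - p) xlnx); last exact: xlnx_cont.
by apply: cvgB; [exact: cvg_cst|exact: cvg_id].
Qed.

(* the summand 0 * ln 0 = 0 realises the convention 0^0 = 1 *)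
Lemma mul_ln_div p c : 0 <= p -> 0 < c -> p * ln (p / c) = p * ln p - p * ln c.
Proof.
rewrite le_eqVlt => /orP[/eqP<-|p0] c0; first by rewrite !mul0r subrr.
by rewrite ln_div ?posrE // mulrBr.
Qed.

(** x ln(x/c) >= x - c for both summands, and the two lower bounds add up to zero. *)
Lemma gibbs r p : 0 < r < 1 -> 0 <= p <= 1 -> 0 <= relent r p.
Proof.
move=> /andP[r0 r1] /andP[p0 p1]; rewrite /relent.
have key x c : 0 <= x -> 0 < c -> x - c <= x * ln (x / c).
  rewrite le_eqVlt => /orP[/eqP<-|x0] c0; first by rewrite mul0r sub0r oppr_le0 ltW.
  have := ln_ge_1subV (divr_gt0 x0 c0); rewrite invf_div => h.
  have := ler_wpM2l (ltW x0) h; rewrite mulrBr mulr1 mulrCA divff ?mulr1 // gt_eqF //.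
have q0 : 0 <= 1 - p by lra.
have s0 : 0 < 1 - r by lra.
have := key _ _ p0 r0; have := key _ _ q0 s0; lra.
Qed.

(** The three-point identity of a Bregman divergence: [relent r] equals its tangent at [a] plus
    [relent a p]. Gibbs' inequality turns it into convexity. *)
Lemma relent_shift a r p : 0 < r < 1 -> 0 < a < 1 -> 0 <= p <= 1 ->
  relent r p = relent a p + relent r a + (p - a) * (ln (a / r) - ln ((1 - a) / (1 - r))).
Proof.
move=> /andP[r0 r1] /andP[a0 a1] /andP[p0 p1].
have r1' : 0 < 1 - r by lra. have a1' : 0 < 1 - a by lra. have p1' : 0 <= 1 - p by lra.
rewrite /relent !mul_ln_div ?(ltW a0) ?(ltW a1') //.
rewrite !ln_div ?posrE //; ring.
Qed.

Lemma relent_tangent a r p : 0 < r < 1 -> 0 < a < 1 -> 0 <= p <= 1 ->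
  relent r a + (p - a) * (ln (a / r) - ln ((1 - a) / (1 - r))) <= relent r p.
Proof. by move=> hr ha hp; rewrite (relent_shift hr ha hp); have := gibbs ha hp; lra. Qed.

Lemma ln_bi r p : 0 < r < 1 -> 0 <= p <= 1 -> 0 < bi r p /\ ln (bi r p) = relent r p.
Proof.
move=> /andP[r0 r1] /andP[p0 p1].
have r1' : 0 < 1 - r by lra. have p1' : 0 <= 1 - p by lra.
have key x c : 0 <= x -> 0 < c -> 0 < (x / c) `^ x.
  rewrite le_eqVlt => /orP[/eqP<-|x0] c0; first by rewrite powRr0 ltr01.
  by rewrite powR_gt0 // divr_gt0.
by rewrite /bi mulr_gt0 ?key // lnM ?posrE ?key // !ln_powR.
Qed.

Definition ratefun p1 p2 p : R := relent p1 p + relent p2 p + entropy p.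

Lemma ln_b0 p1 p2 p : 0 < p1 < 1 -> 0 < p2 < 1 -> 0 <= p <= 1 ->
  0 < b0 p1 p2 p /\ ln (b0 p1 p2 p) = ratefun p1 p2 p.
Proof.
move=> /andP[r0 r1] /andP[s0 s1] /andP[p0 p1'].
have a1 : 0 < 1 - p1 by lra. have a2 : 0 < 1 - p2 by lra. have a3 : 0 <= 1 - p by lra.
have key x c : 0 <= x -> 0 < c -> 0 < (x / c) `^ x.
  rewrite le_eqVlt => /orP[/eqP<-|x0] c0; first by rewrite powRr0 ltr01.
  by rewrite powR_gt0 // divr_gt0.
have c1 : 0 < p1 * p2 by rewrite mulr_gt0.
have c2 : 0 < (1 - p1) * (1 - p2) by rewrite mulr_gt0.
rewrite /b0 mulr_gt0 ?key // lnM ?posrE ?key // !ln_powR; split => //.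
rewrite /ratefun /relent /entropy !mul_ln_div //.
by rewrite !lnM ?posrE //; ring.
Qed.

Lemma ratefun_cont p1 p2 : 0 < p1 < 1 -> 0 < p2 < 1 -> continuous (ratefun p1 p2).
Proof.
move=> h1 h2 p; apply: cvgD; last exact: entropy_cont.
by apply: cvgD; exact: relent_cont.
Qed.

(* completing b_0 to a relative entropy with respect to p_1p_2/(p_1p_2+q_1q_2) *)
Lemma base_point p1 p2 : 0 < p1 < 1 -> 0 < p2 < 1 ->
  let Z := p1 * p2 + (1 - p1) * (1 - p2) in
  [/\ 0 < Z < 1, 0 < p1 * p2 / Z < 1 & forall p, 0 <= p <= 1 ->
     ratefun p1 p2 p = relent (p1 * p2 / Z) p - ln Z].
Proof.
move=> /andP[r0 r1] /andP[s0 s1] Z.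
have a1 : 0 < 1 - p1 by lra. have a2 : 0 < 1 - p2 by lra.
have c1 : 0 < p1 * p2 by rewrite mulr_gt0.
have c2 : 0 < (1 - p1) * (1 - p2) by rewrite mulr_gt0.
have c3 : 0 < p1 * (1 - p2) by rewrite mulr_gt0.
have c4 : 0 < (1 - p1) * p2 by rewrite mulr_gt0.
have Z0 : 0 < Z by rewrite addr_gt0.
have q : 1 - p1 * p2 / Z = (1 - p1) * (1 - p2) / Z.
  by rewrite -{1}[1](@divff _ Z) ?gt_eqF // -mulrBl /Z [_ + _ - _]addrC addKr.
have q0 : 0 < (1 - p1) * (1 - p2) / Z by rewrite divr_gt0.
split.
- by apply/andP; split => //; rewrite /Z; lra.
- by rewrite divr_gt0 //=; move: q0; rewrite -q; lra.
move=> p /andP[p0 p1']; have a3 : 0 <= 1 - p by lra.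
rewrite /ratefun /relent /entropy q !mul_ln_div ?divr_gt0 //.
by rewrite !ln_div ?posrE // !lnM ?posrE //; ring.
Qed.

Lemma ratefun_ge p1 p2 : 0 < p1 < 1 -> 0 < p2 < 1 ->
  exists2 c, 0 < c & forall p, 0 <= p <= 1 -> c <= ratefun p1 p2 p.
Proof.
move=> h1 h2; have [Z01 b01 hE] := base_point h1 h2.
move: Z01 => /andP[Z0 Z1].
exists (- ln (p1 * p2 + (1 - p1) * (1 - p2))).
  by rewrite oppr_gt0 ln_lt0 // Z0 Z1.
by move=> p hp; rewrite hE //; have := gibbs b01 hp; lra.
Qed.

Lemma continuous_max_itv (f : R -> R) : continuous f ->
  exists2 c, 0 <= c <= 1 & forall p, 0 <= p <= 1 -> f p <= f c.
Proof.
move=> cf.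
have [c hc hm] := @EVT_max R f 0 1 ler01 (continuous_subspaceT cf).
by exists c => [|p hp]; [move: hc; rewrite in_itv|apply: hm; rewrite in_itv].
Qed.

Lemma ratefun_le p1 p2 : 0 < p1 < 1 -> 0 < p2 < 1 ->
  exists2 C, 0 < C & forall p, 0 <= p <= 1 -> ratefun p1 p2 p <= C.
Proof.
move=> h1 h2; have [c _ hc] := continuous_max_itv (ratefun_cont h1 h2).
exists (`|ratefun p1 p2 c| + 1) => [|p hp]; first by rewrite ltr_wpDl.
by apply: (le_trans (hc p hp)); rewrite ler_wpDr // ler_norm.
Qed.

(* all three rates decrease towards the hull of p_1, p_2 and the minimiser of
   b_0, so projecting onto that hull can only help *)
Lemma clamp_rates p1 p2 : 0 < p1 < 1 -> 0 < p2 < 1 ->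
  exists2 d, 0 < d < 2^-1 & forall p, 0 <= p <= 1 -> exists2 p', d <= p' <= 1 - d &
    [/\ relent p1 p' <= relent p1 p, relent p2 p' <= relent p2 p &
        ratefun p1 p2 p' <= ratefun p1 p2 p].
Proof.
move=> h1 h2; have [_ ] := base_point h1 h2.
set r0 := _ / _; set Z := ln _ => h0 hE.
pose lo := Num.min r0 (Num.min p1 p2); pose hi := Num.max r0 (Num.max p1 p2).
have lo01 : 0 < lo < 1.
  by move: h0 h1 h2 => /andP[a b] /andP[c d] /andP[e f]; rewrite /lo !lt_min !gt_min a b c e.
have hi01 : 0 < hi < 1.
  by move: h0 h1 h2 => /andP[a b] /andP[c d] /andP[e f]; rewrite /hi !lt_max !gt_max a b d f.
have lohi : lo <= hi by rewrite /lo /hi ge_min le_max lexx.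
have mono r a p : 0 < r < 1 -> 0 < a < 1 -> 0 <= p <= 1 ->
    (a <= r /\ p <= a) \/ (r <= a /\ a <= p) -> relent r a <= relent r p.
  move=> hr ha hp hh; have := relent_tangent hr ha hp.
  move: (hr) (ha) => /andP[r0' r1'] /andP[a0 a1].
  suff : 0 <= (p - a) * (ln (a / r) - ln ((1 - a) / (1 - r))) by lra.
  have r1 : 0 < 1 - r by lra. have a1' : 0 < 1 - a by lra.
  rewrite !ln_div ?posrE //.
  case: hh => -[h h'].
    apply: mulr_le0; first by lra.
    have := ler_ln (x := a) (y := r); rewrite !posrE h => /(_ a0 r0') e1.
    have h'' : 1 - r <= 1 - a by lra.
    have := ler_ln (x := 1 - r) (y := 1 - a); rewrite !posrE h'' => /(_ r1 a1') e2.
    lra.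
  apply: mulr_ge0; first by lra.
  have := ler_ln (x := r) (y := a); rewrite !posrE h => /(_ r0' a0) e1.
  have h'' : 1 - a <= 1 - r by lra.
  have := ler_ln (x := 1 - a) (y := 1 - r); rewrite !posrE h'' => /(_ a1' r1) e2.
  lra.
pose d := Num.min (Num.min lo (1 - hi)) (1 / 4).
have d0 : 0 < d.
  by move: lo01 hi01 => /andP[a b] /andP[e f]; rewrite /d 2!lt_min a subr_gt0 f /=; lra.
have dlo : d <= lo by rewrite /d 2!ge_min lexx.
have dhi : hi <= 1 - d.
  have : d <= 1 - hi by rewrite /d 2!ge_min lexx orbT.
  lra.
exists d; first by rewrite d0 /= /d gt_min; apply/orP; right; lra.
have lo_le r : r \in [:: r0; p1; p2] -> lo <= r.
  by rewrite !inE => /or3P[] /eqP ->; rewrite /lo !ge_min lexx ?orbT.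
have hi_ge r : r \in [:: r0; p1; p2] -> r <= hi.
  by rewrite !inE => /or3P[] /eqP ->; rewrite /hi !le_max lexx ?orbT.
have in0 : r0 \in [:: r0; p1; p2] by rewrite !inE eqxx.
have in1 : p1 \in [:: r0; p1; p2] by rewrite !inE eqxx ?orbT.
have in2 : p2 \in [:: r0; p1; p2] by rewrite !inE eqxx ?orbT.
move=> p hp.
have lo01' : 0 <= lo <= 1 by case/andP: lo01 => /ltW -> /ltW ->.
have hi01' : 0 <= hi <= 1 by case/andP: hi01 => /ltW -> /ltW ->.
have [h|h] := ltP p lo.
  exists lo; first by rewrite dlo (le_trans lohi).
  by split; [| |rewrite !hE // lerD2r]; apply: mono => //; left; split; rewrite ?lo_le // ltW.
have [h'|h'] := ltP hi p.
  exists hi; first by rewrite dhi (le_trans dlo).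
  by split; [| |rewrite !hE // lerD2r]; apply: mono => //; right; split; rewrite ?hi_ge // ltW.
by exists p => //; rewrite (le_trans dlo) // (le_trans h').
Qed.

End Entropy.

(** * The implicit equation and its root *)

Section Root.
Local Open Scope classical_set_scope.
Local Open Scope ring_scope.
Variables (R : realType) (L : R).
Hypothesis L0 : 0 <= L.
Implicit Types (b x y : R).

(** Here [b] stands for the logarithm of the base, later a relative entropy; it may be 0. *)
Definition lnlin b x : R := ln x + b * (x - 1) / 2.

Lemma lnlin_mono b x y : 0 <= b -> 0 < x -> x < y -> lnlin b x < lnlin b y.
Proof.
move=> b0 x0 xy; have y0 : 0 < y by exact: lt_trans xy.
rewrite /lnlin; apply: ltr_leD; first by rewrite ltr_ln ?posrE.
by rewrite ler_pM2r ?invr_gt0 // ler_wpM2l // lerB // ltW.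
Qed.

Lemma lnlin_root b : 0 <= b -> exists2 x, 1 <= x & lnlin b x = 1 + L.
Proof.
move=> b0; have L0' := L0; have e1 : 1 <= expR (1 + L) by have := expR_ge1Dx (1 + L); lra.
have f1 : lnlin b 1 = 0 by rewrite /lnlin ln1 subrr mulr0 mul0r addr0.
have f2 : 1 + L <= lnlin b (expR (1 + L)).
  by rewrite /lnlin expRK lerDl divr_ge0 // mulr_ge0 // subr_ge0.
have [||x] := @IVT R (lnlin b) 1 (expR (1 + L)) (1 + L) e1.
- apply: continuous_in_subspaceT => x; rewrite inE /= in_itv /= => /andP[x1 _].
  have x0 : 0 < x by lra.
  apply: cvgD; first exact: continuous_ln.
  apply: cvgM; last exact: cvg_cst.
  by apply: cvgM; [exact: cvg_cst|apply: cvgB; [exact: cvg_id|exact: cvg_cst]].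
- by rewrite f1 ge_min le_max f2 orbT andbT; apply/orP; left; lra.
by rewrite in_itv /= => /andP[x1 _] <-; exists x.
Qed.

Lemma lnlin_inj b x y : 0 <= b -> 0 < x -> 0 < y -> lnlin b x = lnlin b y -> x = y.
Proof.
move=> b0 x0 y0 E; have [h|h|//] := ltgtP x y.
  by have := lnlin_mono b0 x0 h; rewrite E ltxx.
by have := lnlin_mono b0 y0 h; rewrite E ltxx.
Qed.

(* logarithmic form of the defining equation e N = x b^((x-1)/2), L = log N *)
Definition lnroot b : R := xget 0 [set x | 0 < x /\ lnlin b x = 1 + L].

Lemma lnrootP b : 0 <= b -> 1 <= lnroot b /\ lnlin b (lnroot b) = 1 + L.
Proof.
move=> b0; have [x x1 hx] := lnlin_root b0.
have x0 : 0 < x by lra.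
have h : exists x, 0 < x /\ lnlin b x = 1 + L by exists x.
have := @xgetPex _ 0 [set x | 0 < x /\ lnlin b x = 1 + L] h.
rewrite -/(lnroot b) => -[r0 hr]; split => //.
by rewrite (lnlin_inj b0 r0 x0) // hr hx.
Qed.

Lemma lnroot_ge b y : 0 <= b -> 0 < y -> lnlin b y <= 1 + L -> y <= lnroot b.
Proof.
move=> b0 y0 hy; have [r1 hr] := lnrootP b0.
rewrite leNgt; apply/negP => h.
have r0 : 0 < lnroot b by lra.
by have := lnlin_mono b0 r0 h; rewrite hr ltNge hy.
Qed.

Lemma lnroot_anti b b' : 0 <= b -> b <= b' -> lnroot b' <= lnroot b.
Proof.
move=> b0 bb; have [r1 hr] := lnrootP (le_trans b0 bb).
apply: lnroot_ge => //; first by lra.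
rewrite -hr /lnlin lerD2l ler_pM2r ?invr_gt0 // ler_wpM2r //; lra.
Qed.

Lemma lnroot_le b : 0 <= b -> lnroot b <= expR (1 + L).
Proof.
move=> b0; have [r1 hr] := lnrootP b0; have r0 : 0 < lnroot b by lra.
rewrite -[leLHS](@lnK R) ?posrE // ler_expR -hr /lnlin lerDl divr_ge0 // mulr_ge0 //; lra.
Qed.

(** Roots lie in [1, exp(1 + L)], where [lnlin b] has slope at least exp(-(1 + L)). The crude
    constant suffices because only continuity for fixed N is wanted. *)
Lemma lnroot_lip b b' : 0 <= b -> b <= b' -> `|lnroot b - lnroot b'| <= expR (1 + L) ^+ 2 * (b' - b).
Proof.
move=> b0 bb; have b0' := le_trans b0 bb.
have [r1 hr] := lnrootP b0; have [s1 hs] := lnrootP b0'.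
have sr := lnroot_anti b0 bb; have re := lnroot_le b0; have se := lnroot_le b0'.
set r := lnroot b in r1 hr sr re *; set s := lnroot b' in s1 hs sr se *.
set e := expR (1 + L) in re se *.
have r0 : 0 < r by lra. have s0 : 0 < s by lra.
have e0 : 0 < e by exact: expR_gt0.
rewrite ger0_norm ?subr_ge0 //.
have h1 := ln_ge_1subV (divr_gt0 r0 s0); rewrite invf_div ln_div ?posrE // in h1.
have h2 : (r - s) / e <= 1 - s / r.
  rewrite -[X in X - s / r](@divff _ r) ?gt_eqF // -mulrBl ler_wpM2l ?subr_ge0 //.
  by rewrite lef_pV2 ?posrE.
have h3 : 0 <= b * (r - s) by rewrite mulr_ge0 // subr_ge0.
have h4 : (b' - b) * (s - 1) <= (b' - b) * e by rewrite ler_wpM2l ?subr_ge0 //; lra.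
have h0 : 0 <= (b' - b) * e by rewrite mulr_ge0 ?subr_ge0 // ltW.
have h5 : (r - s) / e <= (b' - b) * e.
  move: hr; rewrite -hs /lnlin => E; move: h1 h2 h3 h4 h0 E; lra.
by move: h5; rewrite ler_pdivrMr // => h5; apply: (le_trans h5); rewrite expr2; lra.
Qed.

(** Truncation at 0 gives a function continuous on the whole line without changing the values at
    relative entropies. *)
Lemma lnroot_cont : continuous (fun b => lnroot (Num.max 0 b)).
Proof.
move=> x; apply/cvgrPdist_le => e e0; set K := expR (1 + L) ^+ 2.
have K0 : 0 < K by rewrite exprn_gt0 // expR_gt0.
near=> y.
have lip b b' : `|lnroot (Num.max 0 b) - lnroot (Num.max 0 b')| <= K * `|b - b'|.
  wlog bb : b b' / b <= b'.
    move=> H; have [h|h] := leP b b'; first exact: H.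
    by rewrite distrC [`|b - b'|]distrC; apply: H; exact: ltW.
  have m0 : 0 <= Num.max 0 b by rewrite le_max lexx.
  have mm : Num.max 0 b <= Num.max 0 b'.
    by rewrite ge_max !le_max lexx bb orbT.
  apply: (le_trans (lnroot_lip m0 mm)); rewrite ler_pM2l //.
  rewrite ler0_norm ?subr_le0 //.
  have [h|h] := leP b 0; have [h'|h'] := leP b' 0; lra.
apply: (le_trans (lip _ _)); rewrite mulrC -ler_pdivlMr //.
near: y; apply: (cvgr_dist_le (F := nbhs x) (T := R)); last by rewrite divr_gt0.
exact: cvg_id.
Unshelve. all: by end_near. Qed.

End Root.

(** * The parameters as functions of the rates; attainment of the extrema *)

Section Params.
Local Open Scope classical_set_scope.
Local Open Scope ring_scope.
Variables (R : realType) (p1 p2 : R).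
Hypotheses (hp1 : 0 < p1 < 1) (hp2 : 0 < p2 < 1).
Implicit Types (p r : R) (N : nat).

Lemma xi_lnroot r N p : 0 < r < 1 -> (0 < N)%N -> 0 <= p <= 1 ->
  xi r N p = lnroot (ln N%:R) (relent r p).
Proof.
move=> hr N0 hp; have [b0 lb] := ln_bi hr hp.
have NR : 0 < N%:R :> R by rewrite ltr0n.
rewrite /xi /lnroot; congr xget; apply/seteqP; split => x /=.
  move=> E.
  have x0 : 0 < x.
    by rewrite -(pmulr_lgt0 _ (powR_gt0 ((x - 1) / 2) b0)) -E mulr_gt0 ?expR_gt0.
  split => //; rewrite /lnlin -lb -mulrA [_ * (_ / _)]mulrC -ln_powR -lnM ?posrE ?powR_gt0 //.
  by rewrite -E lnM ?posrE ?expR_gt0 // expRK.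
move=> [x0 E]; rewrite -[LHS](@lnK R) ?posrE ?mulr_gt0 ?expR_gt0 //.
rewrite lnM ?posrE ?expR_gt0 // expRK -E /lnlin expRD lnK ?posrE //; congr (_ * _).
by rewrite -lb -mulrA [_ * (_ / _)]mulrC -ln_powR lnK // posrE powR_gt0.
Qed.

(** [b] is log b_0 and L is log N; the summand 2 ln b comes from the iterated logarithm, since
    log_{b_0} N = L/b. *)
Definition x0rate (L b : R) : R := (4 * L - 2 * ln L - 2 * ln (4 / expR 1) + 2 * ln b) / b + 1.

Lemma x0E N p : 1 < N%:R :> R -> 0 <= p <= 1 -> 0 < ratefun p1 p2 p ->
  x0 p1 p2 N p = x0rate (ln N%:R) (ratefun p1 p2 p).
Proof.
move=> N1 hp b0; have [bb lb] := ln_b0 hp1 hp2 hp.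
rewrite /x0 /log_base lb /x0rate ln_div ?posrE ?ln_gt0 //.
by ring.
Qed.

(** (A + 2 log b)/b has nonpositive derivative once A >= 2 - 2 log b; the inequality log t <= t - 1
    replaces the derivative. *)
Lemma x0rate_anti L b b' : 2 + 2 * ln (4 / expR 1) - 2 * ln b <= 4 * L - 2 * ln L ->
  0 < b -> b <= b' -> x0rate L b' <= x0rate L b.
Proof.
move=> hL b0 bb; have b0' := lt_le_trans b0 bb.
rewrite /x0rate lerD2r ler_pdivrMr // mulrAC ler_pdivlMr //.
have h := ln_le_subr1 (divr_gt0 b0' b0); rewrite ln_div ?posrE // in h.
have h' := ler_wpM2l (ltW b0) h.
rewrite (_ : b * (b' / b - 1) = b' - b) in h'; last by field; rewrite gt_eqF.
have d0 : 0 <= b' - b by lra.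
set A := 4 * L - _ - _ in hL *.
have hA : 2 - 2 * ln b <= A by rewrite /A; lra.
have := ler_wpM2l d0 hA; move: h'; lra.
Qed.

Definition fN N p : R := Num.min (x0 p1 p2 N p) (Num.min (xi p1 N p) (xi p2 N p)).

Lemma nN_spec N : 1 < N%:R :> R ->
  exists2 p, 0 <= p <= 1 & nN p1 p2 N = fN N p /\ forall q, 0 <= q <= 1 -> fN N q <= nN p1 p2 N.
Proof.
move=> N1; have L0 : 0 < ln N%:R :> R by rewrite ln_gt0.
have N0 : (0 < N)%N by rewrite -(ltr0n R); lra.
have [c c0 hc] := ratefun_ge hp1 hp2.
(* The truncations at [c] and at 0 change nothing on [0,1] but make the functions continuous
   everywhere, so that the maximum is attained. *)
pose g0 q := x0rate (ln N%:R) (Num.max c (ratefun p1 p2 q)).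
pose g1 r q := lnroot (ln N%:R) (Num.max 0 (relent r q)).
have c_g0 : continuous g0.
  move=> q; pose rf := (cst c : R -> R) \max ratefun p1 p2.
  have rfc : {for q, continuous rf}.
    by apply: continuous_max; [exact: cvg_cst|exact: ratefun_cont].
  have rf0 : 0 < rf q by rewrite /rf /= lt_max c0.
  apply: cvgD; last exact: cvg_cst.
  apply: cvgM; last by apply: cvgV; rewrite ?gt_eqF //; exact: rfc.
  apply: cvgD; first exact: cvg_cst.
  apply: cvgM; first exact: cvg_cst.
  apply: (@continuous_comp _ _ _ rf (@ln R)); first exact: rfc.
  exact: continuous_ln.
have c_g1 r : 0 < r < 1 -> continuous (g1 r).
  move=> hr q; apply: (@continuous_comp _ _ _ (relent r) (fun b => lnroot (ln N%:R) (Num.max 0 b))).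
    exact: relent_cont.
  by apply: lnroot_cont; exact: ltW.
pose g := g0 \min (g1 p1 \min g1 p2).
have cg : continuous g.
  by move=> q; apply: continuous_min; [exact: c_g0|apply: continuous_min; exact: c_g1].
have gE q : 0 <= q <= 1 -> fN N q = g q.
  move=> hq; rewrite /fN /g /= /g0 /g1.
  have h := hc _ hq.
  rewrite x0E ?(lt_le_trans c0) // !xi_lnroot // !max_r //; exact: gibbs.
have [q hq hm] := continuous_max_itv cg.
have ism : is_max [set fN N p | p in `[0, 1]] (fN N q).
  split; first by exists q => //=; rewrite in_itv.
  move=> _ [p hp <-]; move: hp; rewrite /= in_itv /= => hp.
  by rewrite !gE //; exact: hm.
have [] := @xgetPex _ 0 (is_max [set fN N p | p in `[0, 1]]) (ex_intro _ _ ism).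
rewrite -/(set_max _) -/(nN p1 p2 N) => -[p hp E] ub.
exists p; first by move: hp; rewrite /= in_itv.
split => // q' hq'; apply: ub; exists q' => //=; by rewrite in_itv.
Qed.

Definition maxrate p : R := Num.max (ratefun p1 p2 p) (Num.max (2 * relent p1 p) (2 * relent p2 p)).

Lemma min_max_log_spec :
  exists2 p, 0 <= p <= 1 & min_max_log p1 p2 = maxrate p /\
    forall q, 0 <= q <= 1 -> min_max_log p1 p2 <= maxrate q.
Proof.
have cr r : 0 < r < 1 -> continuous (fun q => 2 * relent r q).
  by move=> hr q; apply: cvgM; [exact: cvg_cst|exact: relent_cont].
pose g := ratefun p1 p2 \max ((fun q => 2 * relent p1 q) \max (fun q => 2 * relent p2 q)).
have cg : continuous g.
  move=> q; apply: continuous_max; first exact: ratefun_cont.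
  by apply: continuous_max; exact: cr.
have cgN : continuous (fun q => - g q) by move=> q; apply: cvgN; exact: cg.
have [c hc hm] := continuous_max_itv cgN.
have E q : 0 <= q <= 1 -> Num.max (ln (b0 p1 p2 q)) (Num.max (2 * ln (bi p1 q)) (2 * ln (bi p2 q))) = maxrate q.
  by move=> hq; rewrite (ln_b0 hp1 hp2 hq).2 (ln_bi hp1 hq).2 (ln_bi hp2 hq).2.
set A := [set Num.max (ln (b0 p1 p2 q)) (Num.max (2 * ln (bi p1 q)) (2 * ln (bi p2 q))) | q in `[0, 1]].
have ism : is_min A (maxrate c).
  split; first by exists c; [rewrite /= in_itv|exact: E].
  move=> _ [p hp <-]; move: hp; rewrite /= in_itv /= => hp.
  rewrite E // -lerN2; exact: hm.
have [] := @xgetPex _ 0 (is_min A) (ex_intro _ _ ism).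
rewrite -/(set_min _) -/(min_max_log p1 p2) => -[p hp Ep] lb.
move: hp; rewrite /= in_itv /= => hp; exists p => //; split; first by rewrite -E.
move=> q hq; rewrite -E //; apply: lb; exists q => //; by rewrite /= in_itv.
Qed.

Lemma maxrate_gt0 : 0 < min_max_log p1 p2.
Proof.
have [p hp [-> _]] := min_max_log_spec.
have [c c0 hc] := ratefun_ge hp1 hp2.
by rewrite /maxrate lt_max (lt_le_trans c0 (hc _ hp)).
Qed.

End Params.

(** * From the distance between n and the parameters to the exponents *)

Section Asymptotics.
Variable R : realType.
Implicit Types (L l b r n x eps K : R).

(** With l = log L, L = exp(l) >= l^5/5!, whence the 120. *)
Lemma log_power_small K : 1 <= K -> exists2 L0, 1 <= L0 & forall L, L0 <= L ->
  K <= ln L /\ K * ln L ^+ 4 <= L.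
Proof.
move=> K1; exists (expR (120 * K)); first by have := expR_ge1Dx (120 * K); lra.
move=> L hL; have L0 : 0 < L by apply: lt_le_trans hL; exact: expR_gt0.
have hl : 120 * K <= ln L by rewrite -[leLHS]expRK ler_ln ?posrE ?expR_gt0.
have l0 : 0 <= ln L by lra.
split; first by lra.
have := expR_ge1Dxn 4 l0; rewrite lnK ?posrE // => h.
have f5 : 5`!%:R = 120 :> R by [].
rewrite f5 in h.
have h4 : 0 <= ln L ^+ 4 by exact: exprn_ge0.
have := ler_wpM2r h4 hl; rewrite -exprS; lra.
Qed.

Lemma ln4e : ln (4 / expR 1) = ln 4 - 1 :> R.
Proof. by rewrite ln_div ?posrE ?expR_gt0 // expRK. Qed.

Lemma x0rate_mul L b : 0 < b ->
  x0rate L b * b = 4 * L - 2 * ln L - 2 * (ln 4 - 1) + 2 * ln b + b.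
Proof. by move=> b0; rewrite /x0rate ln4e mulrDl divfK ?gt_eqF // mul1r. Qed.

(** By Stirling the exponent is at most n times L + 1 - ln n - r(n-1)/2, and the bracket vanishes at
    the root. Beyond it by [eps] the bracket is at most -r eps/2, and the root equation with ln n <=
    L/2 gives r n >= L. *)
Lemma upper_exponent_root L r n eps lf : 0 <= r -> 0 <= L -> 0 <= eps -> 1 <= n ->
  lnroot L r + eps <= n -> ln n <= L / 2 -> n * ln n - n <= lf ->
  n * L - lf - n * (n - 1) / 2 * r <= - (L * eps / 2).
Proof.
move=> r0 L0 e0 n1 hx hln hlf.
have [x1 hE] := lnrootP L0 r0; set x := lnroot L r in hx x1 hE.
have xp : 0 < x by lra. have np : 0 < n by lra.
have xn : x <= n by lra.
have lxn : ln x <= ln n by rewrite ler_ln ?posrE.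
rewrite /lnlin in hE.
have h1 : r * (x - 1) <= r * (n - 1) by rewrite ler_wpM2l //; lra.
have h2 : r * eps <= r * (n - x) by rewrite ler_wpM2l //; lra.
have hB : L + 1 - ln n - r * (n - 1) / 2 <= - (r * eps / 2) by lra.
have h3 := ler_wpM2l (ltW np) hB.
have h4 : L <= r * n by lra.
have h5 := ler_wpM2r e0 h4.
lra.
Qed.

(** x_0 solves 4L + 2 - 2 ln n - (n-1)b = 0 with ln n replaced by ln(4L/b). The replacement costs at
    most 2l/L, which the shift l^2/L times [b] outweighs. *)
Lemma upper_exponent_rate L b n c0 al lf : 0 < c0 -> c0 <= b -> 0 < al -> 1 <= L ->
  al * L <= n -> 1 <= n -> 
  let l := ln L in
  2 * ln 4 - 2 * ln c0 <= l -> 3 * l <= L -> 4 <= c0 * l ->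
  x0rate L b + l ^+ 2 / L <= n -> n * ln n - n <= lf ->
  2 * n * L - lf - n * (n - 1) / 2 * b <= - (al * c0 / 4 * l ^+ 2).
Proof.
move=> c00 cb al0 L1 hn n1 l hl1 hl2 hl3 hx hlf.
have Lp : 0 < L by lra. have bp : 0 < b by lra. have np : 0 < n by lra.
set e := l ^+ 2 / L in hx.
have l0 : 0 <= l by rewrite ln_ge0.
have e0 : 0 <= e by rewrite divr_ge0 ?exprn_ge0 // ltW.
have lb : ln c0 <= ln b by rewrite ler_ln ?posrE.
have hxb : 4 * L - 2 * l - 2 * (ln 4 - 1) + 2 * ln b + b + e * b <= n * b.
  by have := ler_wpM2r (ltW bp) hx; rewrite mulrDl x0rate_mul // -/l.
have eb : 0 <= e * b by rewrite mulr_ge0 // ltW.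
have nb : 4 * L - 3 * l <= n * b by lra.
have nbp : 0 < n * b by rewrite mulr_gt0.
have hln : ln (4 * L / (n * b)) <= l / L.
  have q : 0 < 4 * L / (n * b) by rewrite divr_gt0 // mulr_gt0.
  apply: (le_trans (ln_le_subr1 q)).
  rewrite lerBlDr ler_pdivrMr // [leRHS]mulrDl mul1r.
  have h1 : l * 3 <= l * (n * b / L).
    by rewrite ler_wpM2l // ler_pdivlMr //; lra.
  have e1 : l / L * (n * b) = l * (n * b / L) by ring.
  rewrite e1; lra.
rewrite ln_div ?posrE ?mulr_gt0 // !lnM ?posrE // -/l in hln.
have h2 : e * c0 <= e * b by rewrite ler_wpM2l.
have hB : 4 * L + 2 - 2 * ln n - (n - 1) * b <= 2 * (l / L) - e * c0 by lra.
have h3 := ler_wpM2l (ltW np) hB.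
have eE : e = l * (l / L) by rewrite /e expr2; ring.
have lL0 : 0 <= l / L by rewrite divr_ge0 // ltW.
have h4 : 4 * (l / L) <= c0 * e.
  by rewrite eE [leRHS]mulrA ler_wpM2r.
have ec : 0 <= c0 * e by rewrite mulr_ge0 // ltW.
have h5 : n * (2 * (l / L) - e * c0) <= n * (- (c0 * e / 2)) by rewrite ler_wpM2l ?(ltW np) //; lra.
have h6 : al * L * (c0 * e) <= n * (c0 * e) by rewrite ler_wpM2r.
have h7 : al * L * (c0 * e) = al * c0 * l ^+ 2 by rewrite /e; field; rewrite gt_eqF.
rewrite h7 in h6.
lra.
Qed.

(** Below x_0 one has n b <= 4L, so replacing ln n by ln(4L/b) errs in the favourable direction and
    the full margin survives; 1 + ln n is the Stirling error. *)
Lemma lower_exponent_rate L b n c0 C0 al lf : 0 < c0 -> c0 <= b -> b <= C0 -> 0 < al -> 1 <= L ->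
  al * L <= n -> 1 <= n ->
  let l := ln L in
  2 + 2 * ln C0 + C0 <= 2 * l ->
  n + l ^+ 2 / L <= x0rate L b -> lf <= n * ln n - n + 1 + ln n ->
  n * (n - 1) / 2 * b <= 2 * n * L - lf - al * c0 / 2 * l ^+ 2 + 1 + ln n.
Proof.
move=> c00 cb bC al0 L1 hn n1 l hl1 hx hlf.
have Lp : 0 < L by lra. have bp : 0 < b by lra. have np : 0 < n by lra.
have C0p : 0 < C0 by lra.
set e := l ^+ 2 / L in hx.
have l0 : 0 <= l by rewrite ln_ge0.
have e0 : 0 <= e by rewrite divr_ge0 ?exprn_ge0 // ltW.
have lb : ln b <= ln C0 by rewrite ler_ln ?posrE.
have l40 : 0 <= ln 4 :> R by rewrite ln_ge0 // ler1n.
have hxb : n * b + e * b <= 4 * L - 2 * l - 2 * (ln 4 - 1) + 2 * ln b + b.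
  by have := ler_wpM2r (ltW bp) hx; rewrite mulrDl x0rate_mul // -/l.
have eb : 0 <= e * b by rewrite mulr_ge0 // ltW.
have nb : n * b <= 4 * L by lra.
have nbp : 0 < n * b by rewrite mulr_gt0.
have hln : ln (n * b) <= ln (4 * L) by rewrite ler_ln ?posrE ?mulr_gt0.
rewrite !lnM ?posrE // -/l in hln.
have h2 : e * c0 <= e * b by rewrite ler_wpM2l.
have hB : e * c0 <= 4 * L + 2 - 2 * ln n - (n - 1) * b by lra.
have h3 := ler_wpM2l (ltW np) hB.
have h6 : al * L * (c0 * e) <= n * (c0 * e).
  by rewrite ler_wpM2r // mulr_ge0 // ltW.
have h7 : al * L * (c0 * e) = al * c0 * l ^+ 2 by rewrite /e; field; rewrite gt_eqF.
rewrite h7 in h6.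
lra.
Qed.

(** The margin obtained from the root equation is proportional to [r], which may be tiny. For r >=
    1/A it is of order l^2; for smaller [r] the constraint is far from tight, since r(n-1) <= L
    leaves a margin of at least L/4 per vertex. *)
Lemma lower_exponent_root L r n A al lf : 0 <= r -> 0 < al -> 0 < A -> 1 <= L ->
  al * L <= n -> n <= A * L -> 1 <= n -> 
  let l := ln L in
  ln n <= L / 4 -> 2 / A * l ^+ 2 <= L ->
  n + l ^+ 2 / L <= lnroot L r -> lf <= n * ln n - n + 1 + ln n ->
  n * (n - 1) / 2 * r <= n * L - lf - al / A / 2 * l ^+ 2 + 1 + ln n.
Proof.
move=> r0 al0 A0 L1 hn hn2 n1 l hln hl2 hx hlf.
have Lp : 0 < L by lra. have np : 0 < n by lra.
have L0 : 0 <= L by lra.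
set e := l ^+ 2 / L in hx.
have e0 : 0 <= e by rewrite divr_ge0 ?sqr_ge0 // ltW.
have [x1 hE] := lnrootP L0 r0; set x := lnroot L r in hx x1 hE.
have xp : 0 < x by lra.
have lnx : ln n <= ln x by rewrite ler_ln ?posrE //; lra.
rewrite /lnlin in hE.
have h1 : r * (n + e - 1) <= r * (x - 1) by rewrite ler_wpM2l //; lra.
have hB1 : r * e / 2 <= L + 1 - ln n - r * (n - 1) / 2 by lra.
set B := L + 1 - ln n - r * (n - 1) / 2 in hB1.
suff : al / A / 2 * l ^+ 2 <= n * B.
  rewrite /B; lra.
have l2 : l ^+ 2 = L * e by rewrite /e mulrC divfK // gt_eqF.
have [h|h] := leP (1 / A) r.
  have h2 := ler_wpM2l (ltW np) hB1.
  have h3 : 1 / A * e <= r * e by rewrite ler_wpM2r.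
  have h4 : al * L * (1 / A * e) <= n * (r * e).
    apply: ler_pM => //; apply: mulr_ge0 => //; first exact: ltW.
    by rewrite divr_ge0 // ltW.
  rewrite l2; lra.
have h2 : r * (n - 1) <= 1 / A * (A * L).
  by apply: ler_pM; lra.
rewrite mul1r mulKf ?gt_eqF // in h2.
have hB : L / 4 <= B by rewrite /B; lra.
have h3 := ler_wpM2l (ltW np) hB.
have h4 : al * L * (L / 4) <= n * (L / 4) by rewrite ler_wpM2r // divr_ge0.
have h5 : al * (2 / A * l ^+ 2) <= al * L by rewrite ler_pM2l.
have h6 : al * L * 1 <= al * L * L by rewrite ler_wpM2l // mulr_ge0 // ltW.
lra.
Qed.

End Asymptotics.

Lemma min3_le (R : realType) (a b c : R) :
  [/\ Num.min a (Num.min b c) <= a, Num.min a (Num.min b c) <= b & Num.min a (Num.min b c) <= c].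
Proof. by split; rewrite !ge_min lexx ?orbT. Qed.

Lemma le_min3 (R : realType) (a b c y : R) :
  y <= a -> y <= b -> y <= c -> y <= Num.min a (Num.min b c).
Proof. by move=> h1 h2 h3; rewrite !le_min h1 h2 h3. Qed.

(** * Asymptotic size of n_N *)

Section SizeOfN.
Variables (R : realType) (p1 p2 : R).
Hypotheses (hp1 : 0 < p1 < 1) (hp2 : 0 < p2 < 1).
Let mu := min_max_log p1 p2.

Lemma relent_le r : 0 < r < 1 -> exists2 C : R, 0 < C & forall p, 0 <= p <= 1 -> relent r p <= C.
Proof.
move=> hr; have [c _ hc] := continuous_max_itv (relent_cont hr).
exists (`|relent r c| + 1) => [|p hp]; first by rewrite ltr_wpDl.
by apply: (le_trans (hc p hp)); rewrite ler_wpDr // ler_norm.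
Qed.

(** At the maximising density one of the three rates is at least [mu], and the parameter belonging
    to that rate, times [mu], is at most 4 log N + O(1). *)
Lemma nN_upper : exists2 C : R, 0 < C & forall N : nat, 1 <= ln N%:R :> R ->
  mu * nN p1 p2 N <= 4 * ln N%:R + C.
Proof.
have [c0 c00 hc0] := ratefun_ge hp1 hp2.
have [C0 C00 hC0] := ratefun_le hp1 hp2.
have [D1 D10 hD1] := relent_le hp1.
have [D2 D20 hD2] := relent_le hp2.
have mu0 : 0 < mu := maxrate_gt0 hp1 hp2.
exists (4 + 2 * `|ln C0| + C0 + 2 * D1 + 2 * D2).
  have := normr_ge0 (ln C0); lra.
move=> N L1; set L := ln N%:R in L1 *.
have N1 : 1 < N%:R :> R.
  rewrite ltNge; apply/negP => h; have := ln_le0 h; rewrite -/L; lra.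
have N0 : (0 < N)%N by rewrite -(ltr0n R); lra.
have L0 : 0 <= L by lra.
have [p hp [-> _]] := nN_spec hp1 hp2 N1.
have [_ _ [_ hmu]] := min_max_log_spec hp1 hp2.
have := hmu p hp; rewrite -/mu /maxrate !le_max => hm.
have lnL0 : 0 <= ln L by rewrite ln_ge0.
have b1 := hc0 p hp; have b2 := hC0 p hp.
have bp : 0 < ratefun p1 p2 p by lra.
have nb := normr_ge0 (ln C0).
have root r D : 0 < r < 1 -> 0 < D -> relent r p <= D -> mu <= 2 * relent r p ->
    mu * xi r N p <= 4 * L + (4 + 2 * D).
  move=> hr D0 hD hmur; rewrite xi_lnroot // -/L.
  have g := gibbs hr hp; have [x1 hx] := lnrootP L0 g.
  set x := lnroot _ _ in x1 hx *.
  have lx : 0 <= ln x by rewrite ln_ge0.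
  have x0 : 0 <= x by lra.
  have := ler_wpM2r x0 hmur; move: hx; rewrite /lnlin; lra.
have [f0 f1 f2] := min3_le (x0 p1 p2 N p) (xi p1 N p) (xi p2 N p).
rewrite -/(fN p1 p2 N p) in f0 f1 f2.
have fl q : fN p1 p2 N p <= q -> mu * fN p1 p2 N p <= mu * q by rewrite ler_pM2l.
case/or3P: hm => hm.
- apply: (le_trans (fl _ f0)) => {f0 f1 f2 fl}.
  rewrite x0E //; set b := ratefun p1 p2 p in b1 b2 bp hm *.
  have [h|h] := leP 0 (x0rate L b).
    have := ler_wpM2r h hm; rewrite [b * _]mulrC x0rate_mul //.
    have : ln b <= ln C0 by rewrite ler_ln ?posrE.
    have := ler_norm (ln C0).
    have : 0 <= ln 4 :> R by rewrite ln_ge0 // ler1n.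
    lra.
  have := mulr_ge0_le0 (ltW mu0) (ltW h); lra.
- apply: (le_trans (fl _ f1)) => {f0 f1 f2 fl}.
  have := root _ _ hp1 D10 (hD1 p hp) hm; lra.
- apply: (le_trans (fl _ f2)) => {f0 f1 f2 fl}.
  have := root _ _ hp2 D20 (hD2 p hp) hm; lra.
Qed.

Lemma nN_lower : exists C L0 : R, [/\ 0 < C, 1 <= L0 & forall N : nat, L0 <= ln N%:R :> R ->
  4 * ln N%:R - 4 * ln (ln N%:R) - C <= mu * nN p1 p2 N].
Proof.
have mu0 : 0 < mu := maxrate_gt0 hp1 hp2.
have [p hp [muE _]] := min_max_log_spec hp1 hp2.
have [c0 c00 hc0] := ratefun_ge hp1 hp2.
set b := ratefun p1 p2 p.
have bp : 0 < b by have := hc0 p hp; rewrite -/b; lra.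
have l4 : 0 <= ln 4 :> R by rewrite ln_ge0 // ler1n.
pose C := 4 * `|ln (4 / mu)| + 2 * `|ln b| + 2 * ln 4 + 1.
have C1 : 1 <= C.
  by have := normr_ge0 (ln (4 / mu)); have := normr_ge0 (ln b); rewrite /C; lra.
have [|L0 L01 hL0] := @log_power_small R (C + mu + 10); first by lra.
exists C, L0; split => //; first by lra.
move=> N hN; set L := ln N%:R in hN *.
have [hl1 hl2] := hL0 L hN.
have L1 : 1 <= L by lra. have Lp : 0 < L by lra. have L0' : 0 <= L by lra.
have N1 : 1 < N%:R :> R.
  rewrite ltNge; apply/negP => h; have := ln_le0 h; rewrite -/L; lra.
have N0 : (0 < N)%N by rewrite -(ltr0n R); lra.
set l := ln L in hl1 hl2 *.
have lp : 1 <= l by lra.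
have ll4 : l <= l ^+ 4 by rewrite ler_eXnr.
have hl3 : (C + mu + 10) * l <= L.
  by apply: le_trans hl2; rewrite ler_pM2l //; lra.
have hl4 : C + mu + 10 <= (C + mu + 10) * l by rewrite ler_peMr //; lra.
have hl5 : 10 * l <= (C + mu + 10) * l by rewrite ler_wpM2r //; lra.
(* Evaluated at the minimiser of [maxrate]. In the root equation the linear term is at most (Y -
   mu)/4, so 4l is what compensates ln(Y/mu), about l; the parameter x_0 would need only 2l. *)
set Y := 4 * L - 4 * l - C.
have Ymu : mu <= Y by rewrite /Y; lra.
have [_ _ [_ ub]] := nN_spec hp1 hp2 N1.
have := ub p hp; rewrite -(ler_pM2l mu0); apply: le_trans.
have -> : Y = mu * (Y / mu) by rewrite mulrC divfK // gt_eqF.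
rewrite ler_pM2l //.
have y1 : 1 <= Y / mu by rewrite ler_pdivlMr // mul1r.
have [m1 [m2 m3]] : b <= mu /\ 2 * relent p1 p <= mu /\ 2 * relent p2 p <= mu.
  by rewrite /mu muE /maxrate !le_max !lexx !orbT.
have root r : 0 < r < 1 -> 2 * relent r p <= mu -> Y / mu <= xi r N p.
  move=> hr hm; rewrite xi_lnroot // -/L; have g := gibbs hr hp.
  apply: lnroot_ge => //; first by lra.
  have Yp : 0 < Y by lra.
  have h1 : relent r p * (Y / mu - 1) <= mu / 2 * (Y / mu - 1).
    by rewrite ler_wpM2r //; lra.
  have h2 : mu / 2 * (Y / mu - 1) = Y / 2 - mu / 2 by field; rewrite gt_eqF.
  have h3 : ln (Y / mu) <= l + ln (4 / mu).
    rewrite -lnM ?posrE ?divr_gt0 // ler_ln ?posrE ?mulr_gt0 ?divr_gt0 ?invr_gt0 //.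
    by rewrite mulrA ler_pM2r ?invr_gt0 // /Y; lra.
  have := ler_norm (ln (4 / mu)); have := normr_ge0 (ln b).
  rewrite /lnlin; move: h1 h3; rewrite h2 /Y /C; lra.
apply: (@le_min3 _ (x0 p1 p2 N p)); [|exact: root|exact: root].
rewrite x0E // -/b -/L {ub root}.
have hb : Y <= x0rate L b * b.
  rewrite x0rate_mul // -/l.
  have := ler_norm (- ln b); rewrite normrN; have := normr_ge0 (ln (4 / mu)).
  rewrite /Y /C; lra.
have Y0 : 0 <= Y by lra.
rewrite ler_pdivrMr //; apply: (le_trans hb).
have x0p : 0 <= x0rate L b by rewrite -(pmulr_lge0 _ bp); lra.
by rewrite ler_wpM2l.
Qed.

End SizeOfN.

(** * Upper tail *)

Section Continuity.
Variable R : realType.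
Implicit Types (p q r d : R).

Lemma expn_le_ffact (n N : nat) : (2 * n ^ 2 <= N)%N -> N%:R ^+ n <= 2 * (N ^_ n)%:R :> R.
Proof.
move=> hN.
case: (posnP n) => [->|n0]; first by rewrite expr0 ffactn0; lra.
have nN : (n <= N)%N by nia.
have N0 : 0 < N%:R :> R by rewrite ltr0n; lia.
(* A form of (N)_k/N^k >= 1 - k^2/N that is proved by induction; at k = n the bracket is at least
   N/2. *)
have key k : (k <= n)%N -> N%:R ^+ k * (N%:R - k%:R ^+ 2) <= N%:R * (N ^_ k)%:R :> R.
  elim: k => [|k IH] kn; first by rewrite expr0 ffactn0 expr0n /= subr0 mul1r mulr1.
  have kN : (k <= N)%N by lia.
  have := IH (ltnW kn); rewrite ffactnSr natrM natrB // [N%:R ^+ k.+1]exprS.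
  set X := N%:R ^+ k; set F := (N ^_ k)%:R; rewrite -[k.+1%:R]natr1 => h.
  have X0 : 0 <= X by rewrite exprn_ge0.
  have d0 : 0 <= N%:R - k%:R :> R by rewrite subr_ge0 ler_nat.
  have := ler_wpM2r d0 h; rewrite [X in _ <= X -> _](_ : _ = N%:R * (F * (N%:R - k%:R))); last by ring.
  apply: le_trans.
  have k0 : 0 <= k%:R :> R by [].
  rewrite [leRHS](_ : _ = N%:R * X * (N%:R - (k%:R + 1) ^+ 2) + X * (N%:R * (k%:R + 1) + k%:R ^+ 3)); last by ring.
  by rewrite lerDl mulr_ge0 // addr_ge0 ?exprn_ge0 // mulr_ge0 ?addr_ge0 // ltW.
have := key n (leqnn n); have h2 : 2 * n%:R ^+ 2 <= N%:R :> R by rewrite -natrX -natrM ler_nat.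
set F := (N ^_ n)%:R => h.
have X0 : 0 <= N%:R ^+ n :> R by rewrite exprn_ge0 // ltW.
have h3 : N%:R ^+ n * (N%:R / 2) <= N%:R ^+ n * (N%:R - n%:R ^+ 2) :> R.
  by rewrite ler_wpM2l //; lra.
have := le_trans h3 h.
rewrite mulrA [_ * N%:R]mulrC -mulrA ler_pM2l // ler_pdivrMr //; lra.
Qed.

Lemma ln_abs_le d p : 0 < d -> d <= p -> p <= 1 -> `|ln p| <= - ln d.
Proof.
move=> d0 dp p1; have p0 : 0 < p by lra.
have l : ln d <= ln p by rewrite ler_ln ?posrE.
by rewrite ler0_norm ?ln_le0 // lerN2.
Qed.

Lemma slope_le d q r : 0 < d -> d <= q <= 1 - d -> d <= r <= 1 - d ->
  `|ln (q / r) - ln ((1 - q) / (1 - r))| <= 4 * - ln d.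
Proof.
move=> d0 /andP[q0 q1] /andP[r0 r1].
rewrite !ln_div ?posrE; try lra.
have b1 := @ln_abs_le d q d0 q0.
have b2 := @ln_abs_le d r d0 r0.
have b3 := @ln_abs_le d (1 - q) d0.
have b4 := @ln_abs_le d (1 - r) d0.
have {}b1 : `|ln q| <= - ln d by apply: b1; lra.
have {}b2 : `|ln r| <= - ln d by apply: b2; lra.
have {}b3 : `|ln (1 - q)| <= - ln d by apply: b3; lra.
have {}b4 : `|ln (1 - r)| <= - ln d by apply: b4; lra.
apply: (le_trans (ler_normB _ _)).
apply: (le_trans (lerD (ler_normB _ _) (ler_normB _ _))); lra.
Qed.

Lemma slope_le1 d q : 0 < d -> d <= q <= 1 - d -> `|ln q - ln (1 - q)| <= 4 * - ln d.
Proof.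
move=> d0 /andP[q0 q1].
have b1 : `|ln q| <= - ln d by apply: ln_abs_le => //; lra.
have b3 : `|ln (1 - q)| <= - ln d by apply: ln_abs_le => //; lra.
apply: (le_trans (ler_normB _ _)); have := normr_ge0 (ln q); lra.
Qed.

(** The tangent is taken at the new density [q], where the slope is controlled, so that convexity
    bounds [relent r q] from above. *)
Lemma relent_close lam r p q : 0 < r < 1 -> 0 < q < 1 -> 0 <= p <= 1 ->
  `|ln (q / r) - ln ((1 - q) / (1 - r))| <= lam ->
  relent r q <= relent r p + `|p - q| * lam.
Proof.
move=> hr hq hp hl; have := relent_tangent hr hq hp.
set X := ln (q / r) - _ in hl *.
have : - ((p - q) * X) <= `|p - q| * `|X| by rewrite -normrM -normrN ler_norm.
have : `|p - q| * `|X| <= `|p - q| * lam by rewrite ler_wpM2l.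
lra.
Qed.

(** Entropy is concave, but entropy p + relent q p is affine in [p]. Expanding both relative
    entropies at [q] yields two copies of relent q p: one linearises the entropy, the other is
    nonnegative. *)
Lemma ratefun_close lam p1 p2 p q : 0 < p1 < 1 -> 0 < p2 < 1 -> 0 < q < 1 -> 0 <= p <= 1 ->
  `|ln (q / p1) - ln ((1 - q) / (1 - p1))| <= lam ->
  `|ln (q / p2) - ln ((1 - q) / (1 - p2))| <= lam ->
  `|ln q - ln (1 - q)| <= lam ->
  ratefun p1 p2 q <= ratefun p1 p2 p + `|p - q| * (3 * lam).
Proof.
move=> h1 h2 hq hp l1 l2 l3.
rewrite /ratefun (relent_shift h1 hq hp) (relent_shift h2 hq hp).
have hE : entropy p + relent q p = entropy q - (p - q) * (ln q - ln (1 - q)).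
  move: (hq) hp => /andP[q0 q1] /andP[p0 p1'].
  have p1'' : 0 <= 1 - p by lra. have q1' : 0 < 1 - q by lra.
  rewrite /entropy /relent !mul_ln_div //; ring.
set X1 := ln (q / p1) - _ in l1 *; set X2 := ln (q / p2) - _ in l2 *; set X3 := ln q - _ in l3 hE *.
have g := gibbs hq hp.
have b X : `|X| <= lam -> - (`|p - q| * lam) <= (p - q) * X /\ (p - q) * X <= `|p - q| * lam.
  move=> hX; have h : `|(p - q) * X| <= `|p - q| * lam by rewrite normrM ler_wpM2l.
  by move: h; rewrite ler_norml => /andP[].
have [b1 _] := b _ l1; have [b2 _] := b _ l2; have [_ b3] := b _ l3.
lra.
Qed.

Lemma min3_or (a b c y : R) : Num.min a (Num.min b c) <= y -> [\/ a <= y, b <= y | c <= y].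
Proof. by rewrite !ge_min => /or3P. Qed.

End Continuity.

Section Tails.
Variables (R : realType) (p1 p2 : R).
Hypotheses (hp1 : 0 < p1 < 1) (hp2 : 0 < p2 < 1).
Let mu := min_max_log p1 p2.

(** n_N is asymptotic to 4L/mu; the constants 2 and 5 leave room for lower-order terms. *)
Lemma nN_size K : exists L0 : R, forall N : nat, L0 <= ln N%:R :> R ->
  let L := ln N%:R in let l := ln L in
  [/\ K <= l, K * l ^+ 4 <= L, 1 < N%:R :> R &
      2 / mu * L <= nN p1 p2 N /\ nN p1 p2 N <= 5 / mu * L].
Proof.
have mu0 : 0 < mu := maxrate_gt0 hp1 hp2.
have [C C0 hC] := nN_upper hp1 hp2.
have [C' [L1 [C'0 L11 hC']]] := nN_lower hp1 hp2.
pose K' := `|K| + C + C' + 10.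
have K'1 : 1 <= K' by have := normr_ge0 K; rewrite /K'; lra.
have [L2 L21 hL2] := log_power_small K'1.
exists (L1 + L2) => N hN L l.
have hL1 : L1 <= L by rewrite /L; lra.
have hL2' : L2 <= L by rewrite /L; lra.
have Lge1 : 1 <= L by lra.
have [k1 k2] := hL2 L hL2'; rewrite -/l in k1 k2.
have nK := normr_ge0 K; have nK2 := ler_norm K.
have lp : 1 <= l by lra.
have l4 : l <= l ^+ 4 by rewrite ler_eXnr.
have l40 : 0 <= l ^+ 4 by lra.
have e1 : K * l ^+ 4 <= K' * l ^+ 4 by rewrite ler_wpM2r // /K'; lra.
have e2 : K' * l <= K' * l ^+ 4 by rewrite ler_pM2l //; lra.
have e3 : 10 * l <= K' * l by rewrite ler_wpM2r /K' //; lra.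
have e4 : (C + C') * 1 <= K' * l by apply: ler_pM; rewrite /K'; lra.
have N1 : 1 < N%:R :> R.
  rewrite ltNge; apply/negP => h; have := ln_le0 h; rewrite -/L; lra.
have u1 := hC N Lge1; have u2 := hC' N hL1.
rewrite -/L in u1 u2; rewrite -/l -/mu in u2; rewrite -/mu in u1.
split => //; [by rewrite /K' in k1; lra|by lra|].
rewrite -[_ / mu * L]mulrAC -[5 / mu * L]mulrAC !ler_pdivrMr // ?ler_pdivlMr //.
rewrite ![nN _ _ _ * mu]mulrC.
move: u1 u2; set y := mu * _; split; lra.
Qed.

End Tails.

Lemma upper_tail (R : realType) (p1 p2 : R) (hp1 : 0 < p1 < 1) (hp2 : 0 < p2 < 1) :
  exists L0 : R, forall N : nat, L0 <= ln N%:R :> R ->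
  forall n : nat, nN p1 p2 N + epsN R N < n%:R -> n%:R <= nN p1 p2 N + epsN R N + 1 ->
  @gnp2_prob R N p1 p2 (fun FG => (n <= mcis FG.1 FG.2)%N) <= (ln N%:R)^-1.
Proof.
have mu0 := maxrate_gt0 hp1 hp2.
set mu := min_max_log p1 p2 in mu0.
have [c0 c00 hc0] := ratefun_ge hp1 hp2.
pose al := 1 / mu; pose A := 6 / mu.
have al0 : 0 < al by rewrite divr_gt0.
have A0 : 0 < A by rewrite divr_gt0.
(* The two entries are the coefficients of l^2 in [upper_exponent_root] at eps = l^2/L and in
   [upper_exponent_rate]. *)
pose kap := Num.min (1 / 2) (al * c0 / 4).
have kap0 : 0 < kap.
  rewrite lt_min; apply/andP; split; last by rewrite divr_gt0 // mulr_gt0.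
  by rewrite divr_gt0.
have kap1 : kap <= 1 / 2 by rewrite ge_min lexx.
have kap2 : kap <= al * c0 / 4 by rewrite ge_min lexx orbT.
have l4 : 0 <= ln 4 :> R by rewrite ln_ge0 // ler1n.
pose K := 100 + `|ln A| + 2 / al + 2 * `|ln c0| + 2 * ln 4 + 4 / c0 + A ^+ 2 + 4 / kap.
have [K100 [KA [Kal [Kc [Kc0 [KA2 Kk]]]]]] :
  100 <= K /\ `|ln A| <= K /\ 2 / al <= K /\ 2 * `|ln c0| + 2 * ln 4 <= K /\
  4 / c0 <= K /\ A ^+ 2 + 1 <= K /\ 4 / kap <= K.
  have q1 := normr_ge0 (ln A). have q2 := normr_ge0 (ln c0).
  have q3 : 0 < 2 / al by rewrite divr_gt0.
  have q5 : 0 < 4 / c0 by rewrite divr_gt0.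
  have q6 : 0 < A ^+ 2 by rewrite exprn_gt0.
  have q7 : 0 < 4 / kap by rewrite divr_gt0.
  by rewrite /K; move: l4 q1 q2 q3 q5 q6 q7; clear; do !split; lra.
have alE0 : 2 / mu = 2 * al by rewrite /al; clear; ring.
have aE0 : 5 / mu = 5 * al by rewrite /al; clear; ring.
have AE : A = 6 * al by rewrite /al /A; clear; ring.
have [L0 hL0] := nN_size hp1 hp2 K.
exists L0 => N hN n hn1 hn2.
have [hl hl4 N1 [nlo nhi]] := hL0 N hN.
rewrite -/mu alE0 in nlo; rewrite -/mu aE0 in nhi.
move: hL0 hN alE0 aE0 => _ _ _ _.
clearbody K kap al A; clear mu mu0.
set L := ln N%:R in hl hl4 nlo nhi *; set l := ln L in hl hl4.
have l100 : 100 <= l by exact: le_trans hl.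
have l0 : 0 <= l by move: l100; clear; lra.
have l2l4 : l ^+ 2 <= l ^+ 4 by rewrite ler_weXn2l //; move: l100; clear; lra.
have ll2 : l <= l ^+ 2 by rewrite expr2 ler_peMr //; move: l100; clear; lra.
have l20 : 0 <= l ^+ 2 by exact: sqr_ge0.
have K0 : 0 <= K by move: K100; clear; lra.
have hKl2 : K * l ^+ 2 <= L by apply: le_trans hl4; rewrite ler_wpM2l.
have hKl : K * l <= L by apply: le_trans hKl2; rewrite ler_wpM2l.
have h100 : 100 * l ^+ 2 <= L by apply: le_trans hKl2; rewrite ler_wpM2r.
have L1 : 1 <= L by move: l100 ll2 h100; clear; lra.
have Lp : 0 < L by move: L1; clear; lra.
have eE : epsN R N = l ^+ 2 / L by [].
set e := l ^+ 2 / L in eE.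
have e0 : 0 <= e by rewrite divr_ge0 // ltW.
have e1 : e <= 1.
  by rewrite ler_pdivrMr //; move: l20 h100; clear; lra.
rewrite eE in hn1 hn2.
have KL : K <= L.
  by apply: le_trans hKl; rewrite ler_peMr //; move: l100; clear; lra.
have alL : 2 <= al * L by rewrite mulrC -ler_pdivrMr //; exact: le_trans KL.
have nal : al * L <= n%:R.
  by apply: ltW; apply: le_lt_trans hn1; move: nlo e0 alL; clear; lra.
have nA : n%:R <= A * L.
  by apply: (le_trans hn2); rewrite AE; move: nhi e1 alL; clear; lra.
have n2 : 2 <= n%:R :> R by exact: le_trans nal.
have n1 : (1 < n)%N by rewrite -(ler_nat R).
have n1r : 1 <= n%:R :> R by rewrite ler1n ltnW.
have np : 0 < n%:R :> R by rewrite ltr0n ltnW.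
have lnn : ln n%:R <= 2 * l.
  have : ln n%:R <= ln (A * L) by rewrite ler_ln ?posrE //; exact: mulr_gt0.
  rewrite lnM ?posrE // -/l; move: (ler_norm (ln A)) KA hl; clear; lra.
have lf1 := @ln_fact_ge R n (ltnW n1).
have N0 : (0 < N)%N by rewrite -(ltr0n R); exact: lt_trans N1.
apply: (le_trans (@first_moment R n N p1 p2 hp1 hp2 n1 N0 (kap * l ^+ 2) _)).
  move=> m mM q.
  have M0 : 0 < 'C(n, 2)%:R :> R by rewrite ltr0n bin_gt0.
  have hq : 0 <= q <= 1.
    by rewrite /q divr_ge0 //= ler_pdivrMr // mul1r ler_nat.
  have [_ _ [_ ub]] := nN_spec hp1 hp2 N1.
  have hf : fN p1 p2 N q + e <= n%:R.
    by apply: le_trans (ltW hn1); rewrite lerD2r; exact: ub.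
  have {hf} : Num.min (x0 p1 p2 N q) (Num.min (xi p1 N q) (xi p2 N q)) <= n%:R - e.
    by rewrite lerBrDr.
  move=> {ub hn1 hn2 nlo nhi} /min3_or hor.
  have k1 : kap * l ^+ 2 <= 1 / 2 * l ^+ 2 by rewrite ler_wpM2r.
  have k2 : kap * l ^+ 2 <= al * c0 / 4 * l ^+ 2 by rewrite ler_wpM2r.
  have eL : L * e = l ^+ 2 by rewrite /e mulrC divfK // gt_eqF.
  have root r : 0 < r < 1 -> xi r N q <= n%:R - e ->
     n%:R * L - ln n`!%:R - 'C(n, 2)%:R * relent r q <= - (kap * l ^+ 2).
    move=> hr; rewrite xi_lnroot // -/L => hx; rewrite bin2R.
    have g := gibbs hr hq.
    have hx' : lnroot L (relent r q) + e <= n%:R by rewrite -lerBrDr.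
    have lnL : ln n%:R <= L / 2 by move: lnn ll2 h100 l0; clear; lra.
    apply: (le_trans (@upper_exponent_root R L (relent r q) n%:R e _ g (ltW Lp) e0 n1r hx' lnL lf1)).
    by rewrite lerN2 eL; move: k1; clear; lra.
  case: hor => h.
  - constructor 1; rewrite bin2R -/(ratefun p1 p2 q) -/L.
    have b0 := hc0 q hq.
    rewrite x0E // -/L in h; last exact: lt_le_trans b0.
    have hx : x0rate L (ratefun p1 p2 q) + l ^+ 2 / L <= n%:R by rewrite -lerBrDr.
    apply: (le_trans (@upper_exponent_rate R L (ratefun p1 p2 q) n%:R c0 al _ c00 b0 al0 L1 nal n1r _ _ _ hx lf1)).
    + by rewrite -/l; move: (ler_norm (- ln c0)) l4 Kc hl; rewrite normrN; clear; lra.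
    + by rewrite -/l; move: ll2 h100 l0; clear; lra.
    + by rewrite -/l mulrC -ler_pdivrMr //; exact: le_trans hl.
    + by rewrite -/l lerN2.
  - by constructor 2; apply: root.
  - by constructor 3; apply: root.
have M1 : ('C(n, 2)).+1%:R <= A ^+ 2 * L ^+ 2 + L ^+ 2.
  rewrite -natr1 bin2R -exprMn; apply: lerD; last by rewrite exprn_ege1.
  have : n%:R ^+ 2 <= (A * L) ^+ 2 by rewrite ler_pXn2r // nnegrE ltW // mulr_gt0.
  by move: (sqr_ge0 n%:R : 0 <= n%:R ^+ 2 :> R) np; rewrite expr2; clear; lra.
(* The union over edge numbers costs at most L^3; since kap l >= 4, the product with exp(-kap l^2)
   is at most exp(-l) = 1/L. *)
have M2 : ('C(n, 2)).+1%:R <= expR (3 * l).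
  apply: (le_trans M1).
  have -> : expR (3 * l) = L * L ^+ 2.
    by rewrite expRM_natl lnK ?posrE // -exprS.
  by rewrite -[X in _ + X]mul1r -mulrDl ler_wpM2r ?exprn_ge0 ?(ltW Lp) // (le_trans KA2).
apply: (le_trans (ler_wpM2r (expR_ge0 _) M2)).
rewrite -expRD -[leRHS](@lnK R) ?posrE ?invr_gt0 // ler_expR lnV ?posrE // -/l.
have kl : 4 <= kap * l by rewrite mulrC -ler_pdivrMr //; exact: le_trans hl.
have := ler_wpM2r l0 kl; rewrite expr2; clear; lra.
Qed.

(** * Lower tail *)

Section Sqrt.
Variable R : realType.

(** Supplies [w]: the overlap count needs n <= w^2, while w log n must stay small compared with log
    N. *)
Lemma sqrt_cover (n : nat) (x : R) : n%:R <= x -> 1 <= x ->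
  exists w : nat, [/\ (0 < w)%N, (n <= w * w)%N & w%:R ^+ 2 <= 4 * x].
Proof.
move=> nx x1; have x0 : 0 <= x by lra.
exists (Num.truncn (Num.sqrt x)).+1.
have := truncn_itv (sqrtr_ge0 x); set w := (Num.truncn _).+1 => /andP[h1 h2].
have s1 : 1 <= Num.sqrt x by rewrite -[1]sqrtr1 ler_sqrt.
split => //.
  rewrite -(ler_nat R) natrM; apply: (le_trans nx).
  by rewrite -[leLHS](sqr_sqrtr x0) expr2 ler_pM // ?sqrtr_ge0 // ltW.
have wE : w%:R <= 2 * Num.sqrt x by rewrite /w -natr1; lra.
have := ler_pM (ler0n _ _) (ler0n _ _) wE wE.
rewrite -!expr2 exprMn sqr_sqrtr //; lra.
Qed.

End Sqrt.

(** * Numerical conditions for n of order log N *)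

Section Large.
Variable R : realType.
Implicit Types (al A K L d lam kap del eta c : R) (n N w : nat).

(* "L is large in terms of K, and n is of order L", with L = log N *)
Definition large al A K L n : Prop :=
  [/\ K <= ln L, K * ln L ^+ 4 <= L, al * L <= n%:R & n%:R <= A * L].

Lemma large_le al A K K' L n : 0 <= L -> K' <= K -> large al A K L n -> large al A K' L n.
Proof.
move=> L0 KK [h1 h2 h3 h4]; split => //; first exact: le_trans KK h1.
apply: le_trans h2; apply: ler_wpM2r => //.
by rewrite (exprM _ 2 2) sqr_ge0.
Qed.

Definition K0 al A : R := 100 + `|ln A| + 20 / al + 1 / A.

Lemma large_basics al A K L n : 0 < al -> 0 < A -> K0 al A <= K -> 0 <= L -> large al A K L n ->
  let l := ln L in
  [/\ 100 <= l, 1 <= L, 1 <= A * L & 20 <= n%:R :> R] /\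
  [/\ 0 <= ln n%:R :> R, ln n%:R <= 2 * l & forall x, 0 <= x -> x <= K ->
     [/\ x <= l, x <= L, x * l <= L & x * l ^+ 2 <= L]].
Proof.
move=> al0 A0 KK L0 [hl hl4 nal nA] l.
have q1 := normr_ge0 (ln A). have q2 : 0 < 20 / al by rewrite divr_gt0.
have q3 : 0 < 1 / A by rewrite divr_gt0.
have K100 : 100 <= K by apply: le_trans KK; rewrite /K0; lra.
have KA : `|ln A| <= K by apply: le_trans KK; rewrite /K0; lra.
have Kal : 20 / al <= K by apply: le_trans KK; rewrite /K0; lra.
have KA1 : 1 / A <= K by apply: le_trans KK; rewrite /K0; lra.
rewrite -/l in hl hl4; move: KK q1 q2 q3 => _ _ _ _.
have l100 : 100 <= l by lra.
have Kp : 0 < K by lra.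
have l2l4 : l ^+ 2 <= l ^+ 4 by rewrite ler_weXn2l //; lra.
have ll2 : l <= l ^+ 2 by rewrite expr2 ler_peMr //; lra.
have hKl2 : K * l ^+ 2 <= L by apply: le_trans hl4; rewrite ler_pM2l.
have hKl : K * l <= L by apply: le_trans hKl2; rewrite ler_pM2l.
have KL : K <= L by apply: le_trans hKl; rewrite ler_peMr //; lra.
have l0 : 0 <= l by lra.
have L1 : 1 <= L by lra.
have Lp : 0 < L by lra.
have n20 : 20 <= n%:R :> R.
  by apply: le_trans nal; rewrite mulrC -ler_pdivrMr //; exact: le_trans Kal KL.
have np : 0 < n%:R :> R by lra.
split; split => //.
- by rewrite mulrC -ler_pdivrMr //; exact: le_trans KA1 KL.
- by rewrite ln_ge0 //; lra.
- have : ln n%:R <= ln (A * L) by rewrite ler_ln ?posrE //; exact: mulr_gt0.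
  rewrite lnM ?posrE // -/l; have := ler_norm (ln A); lra.
- move=> x x0 xK; have l20 : 0 <= l ^+ 2 by exact: sqr_ge0.
  split.
  + exact: le_trans xK hl.
  + exact: le_trans xK KL.
  + by apply: le_trans hKl; rewrite ler_wpM2r.
  + by apply: le_trans hKl2; rewrite ler_wpM2r.
Qed.

Lemma K0_le al A x : 0 <= x -> K0 al A <= K0 al A + x /\ (0 < al -> 0 < A -> x <= K0 al A + x).
Proof.
move=> x0; split; first by rewrite lerDl.
move=> al0 A0; rewrite lerDr /K0.
have q2 : 0 < 20 / al by rewrite divr_gt0.
have q3 : 0 < 1 / A by rewrite divr_gt0.
have := normr_ge0 (ln A); lra.
Qed.

Lemma move_const (x y z : R) : 0 < x -> y / x <= z -> y <= x * z.
Proof. by move=> x0; rewrite ler_pdivrMr // mulrC. Qed.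

Lemma large_sqrt al A del : 0 < al -> 0 < A -> 0 < del -> exists K, forall L n,
  0 <= L -> large al A K L n -> exists w, [/\ (0 < w)%N, (n <= w * w)%N & w%:R * ln L <= del * L].
Proof.
move=> al0 A0 del0; have d20 : 0 < del ^+ 2 by rewrite exprn_gt0.
have q : 0 <= 4 * A / del ^+ 2 by rewrite divr_ge0 ?ltW // mulr_gt0.
have [k1 k2] := K0_le al A q.
exists (K0 al A + 4 * A / del ^+ 2) => L n L0 hL.
have [[l100 L1 AL1 n20] [_ _ use]] := large_basics al0 A0 k1 L0 hL.
have [_ _ _ nA] := hL.
have [w [w0 nw ww]] := sqrt_cover nA AL1.
have [_ _ _ h] := use _ q (k2 al0 A0).
exists w; split => //; set l := ln L in l100 h *.
have l20 : 0 <= l ^+ 2 by exact: sqr_ge0.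
have l0 : 0 <= l by lra.
have dL0 : 0 <= del * L by rewrite mulr_ge0 // ltW.
rewrite -ler_sqr ?nnegrE //; last by rewrite mulr_ge0.
rewrite !exprMn.
apply: (le_trans (ler_wpM2r l20 ww)).
have h3 : 4 * A * l ^+ 2 <= del ^+ 2 * L by apply: move_const => //; rewrite mulrAC.
have := ler_wpM2r L0 h3; rewrite -[del ^+ 2 * L * L]mulrA -expr2; lra.
Qed.

Lemma large_fact al A kap : 0 < al -> 0 < A -> 0 < kap -> exists K, forall L n,
  0 <= L -> large al A K L n ->
  kap * ln L ^+ 2 <= L / 8 /\ (ln n`!%:R + kap * ln L ^+ 2) / n%:R <= L / 16.
Proof.
move=> al0 A0 kap0.
have q1 : 0 < kap / al by rewrite divr_gt0.
have q : 0 <= 8 * kap + kap / al by lra.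
have [k1 k2] := K0_le al A q; have {}k2 := k2 al0 A0.
exists (K0 al A + (8 * kap + kap / al)) => L n L0 hL.
have [[l100 L1 AL1 n20] [ln0 ln2 use]] := large_basics al0 A0 k1 L0 hL.
have [_ _ nal nA] := hL.
have K100 : 100 <= K0 al A.
  have q2 : 0 < 20 / al by rewrite divr_gt0.
  have q3 : 0 < 1 / A by rewrite divr_gt0.
  have := normr_ge0 (ln A); rewrite /K0; lra.
set l := ln L in l100 ln2 use *.
have [_ _ _ u1] : [/\ 8 * kap <= l, 8 * kap <= L, 8 * kap * l <= L & 8 * kap * l ^+ 2 <= L].
  by apply: use; lra.
have [_ _ u2 _] : [/\ kap / al <= l, kap / al <= L, kap / al * l <= L & kap / al * l ^+ 2 <= L].
  by apply: use; lra.
have [_ _ u3 _] : [/\ 100 <= l, 100 <= L, 100 * l <= L & 100 * l ^+ 2 <= L].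
  by apply: use; lra.
move: use k1 k2 K100 q q1 hL => _ _ _ _ _ _ _.
have np : 0 < n%:R :> R by lra.
have n1 : (0 < n)%N by rewrite -(ltr0n R).
have l0 : 0 <= l by lra.
split; first by lra.
rewrite ler_pdivrMr //.
have h1 := @ln_fact_le R n n1; have h2 := ln_le_subr1 np.
have h3 : n%:R * ln n%:R <= n%:R * (2 * l) by rewrite ler_wpM2l // ltW.
have h5 : kap * l <= al * L by apply: move_const => //; rewrite mulrAC.
have h6 : kap * l ^+ 2 <= n%:R * l.
  by rewrite expr2 mulrA ler_wpM2r //; exact: le_trans h5 nal.
have h8 : n%:R * (100 * l) <= n%:R * L by rewrite ler_wpM2l // ltW.
have h10 : 0 <= n%:R * l by rewrite mulr_ge0 // ltW.
move: h1 h2 h3 h6 h8 h10; clear; lra.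
Qed.

Lemma large_ffact al A : 0 < al -> 0 < A -> exists K, forall n N,
  1 < N%:R :> R -> large al A K (ln N%:R) n -> N%:R ^+ n <= 2 * (N ^_ n)%:R :> R.
Proof.
move=> al0 A0.
have q : 0 <= 12 * A ^+ 2 by rewrite mulr_ge0 // sqr_ge0.
have [k1 k2] := K0_le al A q; have {}k2 := k2 al0 A0.
exists (K0 al A + 12 * A ^+ 2) => n N N1 hL.
have L0 : 0 <= ln N%:R :> R by rewrite ln_ge0 // ltW.
have NE : N%:R = expR (ln N%:R) :> R by rewrite lnK // posrE; lra.
have [[l100 L1 AL1 n20] [ln0 ln2 use]] := large_basics al0 A0 k1 L0 hL.
have [_ _ nal nA] := hL.
have [_ u _ _] := use _ q k2.
apply: expn_le_ffact; rewrite -(ler_nat R) natrM natrX NE.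
set L := ln N%:R in L0 L1 AL1 nA u *.
have h1 : n%:R ^+ 2 <= A ^+ 2 * L ^+ 2.
  by rewrite -exprMn; apply: lerXn2r; rewrite ?nnegrE //; apply: mulr_ge0 => //; exact: ltW.
have h2 := @expR_ge1Dxn R L 2 L0.
have f3 : 3`!%:R = 6 :> R by [].
rewrite f3 in h2.
have h4 := ler_wpM2r (sqr_ge0 L) u.
rewrite -[L * L ^+ 2]exprS in h4; lra.
Qed.

Lemma large_misc al A lam kap d : 0 < al -> 0 < A -> 0 <= lam -> 0 < kap -> 0 < d ->
  exists K, forall L n, 0 <= L -> large al A K L n ->
  [/\ ln n%:R <= L / 4, 1 + ln n%:R + 3 * lam <= kap * ln L ^+ 2 & 4 / d <= 'C(n, 2)%:R].
Proof.
move=> al0 A0 lam0 kap0 d0.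
have q1 : 0 <= 40 / kap by rewrite divr_ge0 // ltW.
have q2 : 0 <= 8 / d / al by rewrite !divr_ge0 // ltW.
have q3 : 0 <= 3 * lam by rewrite mulr_ge0.
have q : 0 <= 40 / kap + 3 * lam + 8 / d / al by lra.
have [k1 k2] := K0_le al A q; have {}k2 := k2 al0 A0.
exists (K0 al A + (40 / kap + 3 * lam + 8 / d / al)) => L n L0 hL.
have [[l100 L1 AL1 n20] [ln0 ln2 use]] := large_basics al0 A0 k1 L0 hL.
have [_ _ nal nA] := hL.
have K100 : 100 <= K0 al A.
  have r2 : 0 < 20 / al by rewrite divr_gt0.
  have r3 : 0 < 1 / A by rewrite divr_gt0.
  have := normr_ge0 (ln A); rewrite /K0; lra.
set l := ln L in l100 ln2 use *.
have [u1 _ _ _] : [/\ 40 / kap <= l, 40 / kap <= L, 40 / kap * l <= L & 40 / kap * l ^+ 2 <= L].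
  by apply: use; lra.
have [_ _ u3 _] : [/\ 100 <= l, 100 <= L, 100 * l <= L & 100 * l ^+ 2 <= L].
  by apply: use; lra.
have [u4 _ _ _] : [/\ 3 * lam <= l, 3 * lam <= L, 3 * lam * l <= L & 3 * lam * l ^+ 2 <= L].
  by apply: use; lra.
have [_ u5 _ _] : [/\ 8 / d / al <= l, 8 / d / al <= L, 8 / d / al * l <= L & 8 / d / al * l ^+ 2 <= L].
  by apply: use; lra.
move: use k1 k2 K100 q q1 q2 q3 hL => _ _ _ _ _ _ _ _ _.
have l0 : 0 <= l by lra.
split; first by lra.
  have h2 : 40 <= kap * l by apply: move_const.
  have := ler_wpM2r l0 h2; rewrite -[kap * l * l]mulrA -expr2; lra.
have h2 : 8 / d <= al * L by apply: move_const.
have h3 : 8 / d <= n%:R by exact: le_trans h2 nal.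
rewrite bin2R.
have h4 : n%:R * 1 <= n%:R * (n%:R - 1) :> R by rewrite ler_wpM2l //; lra.
lra.
Qed.

(** The polynomial factors are at most exp(8) n^6, and n <= L^2, so everything apart from the
    exponential decay is at most exp(10 + 12 l); kap l >= 40 is more than enough. *)
Lemma large_error al A kap : 0 < al -> 0 < A -> 0 < kap -> exists K, forall L n,
  0 <= L -> large al A K L n ->
  8 * 'C(n, 2)%:R ^+ 2 * expR 2 * (n.+1%:R ^+ 2 * expR (- (kap * ln L ^+ 2))) <= L^-1.
Proof.
move=> al0 A0 kap0.
have q : 0 <= 40 / kap by rewrite divr_ge0 // ltW.
have [k1 k2] := K0_le al A q; have {}k2 := k2 al0 A0.
exists (K0 al A + 40 / kap) => L n L0 hL.
have [[l100 L1 AL1 n20] [ln0 ln2 use]] := large_basics al0 A0 k1 L0 hL.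
have [u1 _ _ _] := use _ q k2.
move: use k1 k2 q hL AL1 => _ _ _ _ _ _.
set l := ln L in l100 ln2 u1 *.
have np : 0 < n%:R :> R by lra.
have n1 : (1 < n)%N by rewrite -(ltr_nat R); lra.
have Lp : 0 < L by lra. have l0 : 0 <= l by lra.
have M0 : 0 < 'C(n, 2)%:R :> R by rewrite ltr0n bin_gt0.
have Mn : 'C(n, 2)%:R <= n%:R ^+ 2 :> R by rewrite bin2R expr2; have := mulr_gt0 np np; lra.
have Mn2 : 'C(n, 2)%:R ^+ 2 <= (n%:R ^+ 2) ^+ 2 :> R.
  by apply: lerXn2r; rewrite ?nnegrE // ?sqr_ge0 // ltW.
have nS : n.+1%:R ^+ 2 <= (2 * n%:R) ^+ 2 :> R.
  by apply: lerXn2r; rewrite ?nnegrE // ?mulr_ge0 // -natr1; lra.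
have e5 : 5 <= expR 4 :> R by have := @expR_ge1Dx R 4; lra.
have e25 : 32 <= expR 4 * expR 4 :> R.
  have e6 : 6 <= expR 4 :> R.
    have := @expR_ge1Dxn R 4 1; have -> : 2`!%:R = 2 :> R by [].
    by move=> /(_ _); rewrite expr2 => h; have := h (ler0n _ _); lra.
  have := ler_pM (ler0n R 6) (ler0n R 6) e6 e6; lra.
have n6 : 8 * 'C(n, 2)%:R ^+ 2 * n.+1%:R ^+ 2 <= expR 4 * expR 4 * n%:R ^+ 6 :> R.
  apply: (@le_trans _ _ (8 * (n%:R ^+ 2) ^+ 2 * (2 * n%:R) ^+ 2)).
    apply: ler_pM; rewrite ?mulr_ge0 ?sqr_ge0 // ler_pM2l //.
  rewrite [leLHS](_ : _ = 32 * (n%:R ^+ 4 * n%:R ^+ 2)); last by ring.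
  by rewrite -exprD ler_wpM2r // exprn_ge0 // ltW.
rewrite [leLHS](_ : _ = 8 * 'C(n, 2)%:R ^+ 2 * n.+1%:R ^+ 2 * (expR 2 * expR (- (kap * l ^+ 2)))); last by ring.
have E0 : 0 <= expR 2 * expR (- (kap * l ^+ 2)) by rewrite mulr_ge0 ?expR_ge0.
apply: (le_trans (ler_wpM2r E0 n6)).
have nE : n%:R = expR (ln n%:R) :> R by rewrite lnK ?posrE.
rewrite [X in _ * X ^+ 6 * _]nE -expRM_natl -!expRD -[leRHS](@lnK R) ?posrE ?invr_gt0 //.
rewrite ler_expR lnV ?posrE // -/l.
have h2 : 40 <= kap * l by apply: move_const.
have := ler_wpM2r l0 h2; rewrite -[kap * l * l]mulrA -expr2; lra.
Qed.

Lemma large_eta al A lam : 0 < al -> 0 < A -> 1 <= lam -> exists2 eta, 0 < eta <= 1 &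
  forall L n, 0 <= L -> n%:R <= A * L -> 8 * (lam * eta) * (n%:R - 1) <= L.
Proof.
move=> al0 A0 lam1; have lA : 0 < 8 * lam * A by rewrite mulr_gt0 //; lra.
have eta0 : 0 < Num.min 1 (1 / (8 * lam * A)) by rewrite lt_min ltr01 /= divr_gt0.
have eta1 : Num.min 1 (1 / (8 * lam * A)) <= 1 by rewrite ge_min lexx.
have eta2 : Num.min 1 (1 / (8 * lam * A)) * (8 * lam * A) <= 1.
  by rewrite -ler_pdivlMr // ge_min lexx orbT.
exists (Num.min 1 (1 / (8 * lam * A))); first by rewrite eta0.
move: eta0 eta1 eta2; set eta := Num.min _ _ => eta0 _ eta2 L n L0 nA.
have e0 : 0 <= 8 * (lam * eta) by rewrite mulr_ge0 // mulr_ge0 // ?ltW //; lra.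
have h1 := ler_wpM2l e0 nA; have h2 := ler_wpM2r L0 eta2.
by move: e0 h1 h2; clear; lra.
Qed.

Lemma large_tail al A d eta : 0 < al -> 0 < A -> 0 < d -> 0 < eta -> exists2 del, 0 < del &
  exists K, forall L n w c, 0 <= L -> large al A K L n -> (0 < w)%N -> w%:R * ln L <= del * L ->
    d <= c ->
     let z1 := eta ^+ 2 * n%:R / 32 - ln n%:R in
     let z2 := c * n%:R / 36 - 3 * (1 + w%:R) * ln n%:R in
     [/\ 0 <= z1, 0 <= z2 &
      2 * n.+1%:R * expR (- z1) + n.+1%:R * expR (- z2) <= expR (-2) / 'C(n, 2)%:R ^+ 2 / 2].
Proof.
move=> al0 A0 d0 eta0.
have eta20 : 0 < eta ^+ 2 by rewrite exprn_gt0.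
have dal0 : 0 < d * al by rewrite mulr_gt0.
have eal0 : 0 < eta ^+ 2 * al by rewrite mulr_gt0.
(* 3(1 + w) ln n is at most 12 w l <= 12 del L, and this [del] keeps it below half of the lower
   bound d al L/36 for c n/36. *)
exists (d * al / 10 / 100); first by rewrite !divr_gt0.
have : exists2 th, 0 < th & th <= eta ^+ 2 * al / 64 /\ th <= d * al / 72.
  exists (Num.min (eta ^+ 2 * al / 64) (d * al / 72)); first by rewrite lt_min !divr_gt0.
  by rewrite !ge_min !lexx orbT.
move=> [th th0 [th1 th2]].
have q : 0 <= 100 / th by rewrite divr_ge0 // ltW.
have [k1 k2] := K0_le al A q; have {}k2 := k2 al0 A0.
exists (K0 al A + 100 / th) => L n w c L0 hL w0 wl dc z1 z2.
have [[l100 L1 AL1 n20] [ln0 ln2 use]] := large_basics al0 A0 k1 L0 hL.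
have [_ _ nal nA] := hL.
have [_ _ u1 _] := use _ q k2.
move: use k1 k2 q hL AL1 => _ _ _ _ _ _.
set l := ln L in l100 ln2 u1 wl *.
have np : 0 < n%:R :> R by lra.
have n1 : (1 < n)%N by rewrite -(ltr_nat R); lra.
have Lp : 0 < L by lra. have l0 : 0 <= l by lra.
have w1 : 1 <= w%:R :> R by rewrite ler1n.
have h100 : 100 * l <= th * L by apply: move_const => //; rewrite mulrAC.
have thL1 : th * L <= eta ^+ 2 * al / 64 * L by rewrite ler_wpM2r.
have thL2 : th * L <= d * al / 72 * L by rewrite ler_wpM2r.
have z1L : th * L <= z1.
  have h3 : eta ^+ 2 * (al * L) <= eta ^+ 2 * n%:R by rewrite ler_pM2l.
  rewrite /z1; move: h3 thL1 h100 ln2 l0; clear; lra.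
have z2L : th * L <= z2.
  have h3 : d * (al * L) <= c * n%:R.
    by apply: ler_pM => //; [exact: ltW|apply: mulr_ge0 => //; exact: ltW].
  have h4 : (1 + w%:R) * ln n%:R <= (2 * w%:R) * (2 * l).
    by apply: ler_pM => //; lra.
  have h5 : 0 <= d * (al * L) by apply: mulr_ge0; [|apply: mulr_ge0 => //]; exact: ltW.
  rewrite /z2; move: h3 h4 h5 thL2 wl; clear; lra.
have thL : 0 <= th * L by rewrite mulr_ge0 // ltW.
split; [exact: le_trans z1L|exact: le_trans z2L|].
have h1 : expR (- z1) <= expR (- (th * L)) by rewrite ler_expR lerN2.
have h2 : expR (- z2) <= expR (- (th * L)) by rewrite ler_expR lerN2.
have M0 : 0 < 'C(n, 2)%:R :> R by rewrite ltr0n bin_gt0.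
have Mn : 'C(n, 2)%:R <= n%:R ^+ 2 :> R.
  by rewrite bin2R expr2; have := mulr_gt0 np np; move: np; clear; lra.
have Mn2 : 'C(n, 2)%:R ^+ 2 <= (n%:R ^+ 2) ^+ 2 :> R.
  by apply: lerXn2r; rewrite ?nnegrE // ?sqr_ge0 // ltW.
have nS : n.+1%:R <= 2 * n%:R :> R by rewrite -natr1; move: n20; clear; lra.
move: h1 h2 z1L z2L thL1 thL2 th1 th2 => h1 h2 _ _ _ _ _ _.
set E := expR (- (th * L)) in h1 h2 *; have E0 : 0 < E by exact: expR_gt0.
have n10 : 0 <= n.+1%:R :> R by [].
have h3 := ler_wpM2l n10 h1. have h4 := ler_wpM2l n10 h2.
have h5 := ler_wpM2r (ltW E0) nS.
have h6 : 2 * n.+1%:R * expR (- z1) + n.+1%:R * expR (- z2) <= 6 * (n%:R * E).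
  by move: h3 h4 h5; clear; lra.
apply: (le_trans h6).
rewrite ler_pdivlMr // ler_pdivlMr ?exprn_gt0 //.
have nE0 : 0 <= 6 * (n%:R * E) * 2 by rewrite !mulr_ge0 // ltW.
apply: (le_trans (ler_wpM2l nE0 Mn2)).
have e12 : 12 <= expR 12 :> R by have := @expR_ge1Dx R 12; lra.
rewrite [leLHS](_ : _ = 12 * (n%:R ^+ 5 * E)); last by ring.
have nE5 : 0 <= n%:R ^+ 5 * E by rewrite mulr_ge0 ?exprn_ge0 // ltW.
apply: (le_trans (ler_wpM2r nE5 e12)).
have nE : n%:R = expR (ln n%:R) :> R by rewrite lnK ?posrE.
rewrite [X in X ^+ 5]nE -expRM_natl -!expRD ler_expR.
by move: h100 ln2 l100; clear; lra.
Qed.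

End Large.

Section Pieces.
Variable R : realType.

(** By -ln x >= 1 - x the rate is at least 2q(1-q) >= 2d(1-d) >= d. *)
Lemma collision_rate (d q : R) : 0 < d -> d <= 2^-1 -> d <= q <= 1 - d -> d <= - ln (q ^+ 2 + (1 - q) ^+ 2).
Proof.
move=> d0 d1 /andP[q0 q1].
have h : 0 < q ^+ 2 + (1 - q) ^+ 2.
  by rewrite ltr_pwDl // ?exprn_gt0 ?sqr_ge0 //; lra.
have := ln_le_subr1 h.
have a1 : 0 <= q - d by lra. have a2 : 0 <= 1 - d - q by lra.
have := mulr_ge0 a1 a2; have := sqr_ge0 d; have h3 : 0 <= d * (2^-1 - d) by rewrite mulr_ge0; lra.
rewrite !expr2; lra.
Qed.

(** Rounding p M down keeps the upper bound and moves [p] by at most 1/M <= d/4, which is why [p]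
    starts above 2d. *)
Lemma round_density (d p : R) (M : nat) : 0 < d -> 2 * d <= p -> p <= 1 - d -> 4 / d <= M%:R ->
  exists m : nat, let q := m%:R / M%:R in
   [/\ q * M%:R = m%:R, d <= q <= 1 - d & M%:R * `|p - q| <= 1].
Proof.
move=> d0 pd p1 hM; have q0 : 0 < 4 / d by rewrite divr_gt0.
have M0 : 0 < M%:R :> R by lra.
have pM : 0 <= p * M%:R by rewrite mulr_ge0 //; lra.
exists (Num.truncn (p * M%:R)) => q.
have := truncn_itv pM; rewrite -[(_.+1)%:R]natr1; set m := Num.truncn _ in q *.
have qM : q * M%:R = m%:R by rewrite /q divfK // gt_eqF.
move=> /andP[h1 h2].
have hd : 4 <= d * M%:R by rewrite mulrC -ler_pdivrMr.
split => //.
  apply/andP; split; rewrite -(ler_pM2r M0) qM; last first.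
    by apply: (le_trans h1); rewrite ler_pM2r.
  have := ler_wpM2r (ltW M0) pd; lra.
rewrite -[M%:R]gtr0_norm // -normrM ler_norml; lra.
Qed.

End Pieces.

(** All three parameters decrease in their rates, so projecting the maximiser lowers no
    parameter. *)
Lemma clamped_maximiser (R : realType) (p1 p2 : R) (hp1 : 0 < p1 < 1) (hp2 : 0 < p2 < 1) :
  exists2 d : R, 0 < d < 2^-1 & exists L0 : R, forall N : nat,
  let L := ln N%:R in L0 <= L -> exists2 p, d <= p <= 1 - d &
  [/\ nN p1 p2 N <= x0rate L (ratefun p1 p2 p), nN p1 p2 N <= lnroot L (relent p1 p) &
      nN p1 p2 N <= lnroot L (relent p2 p)].
Proof.
have [d hd clamp] := clamp_rates hp1 hp2; exists d => //.
have [c0 c00 hc0] := ratefun_ge hp1 hp2.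
have [|L0 L01 hL0] := @log_power_small R (10 + 2 * `|ln c0| + 2 * `|ln (4 / expR 1)|).
  by have := normr_ge0 (ln c0); have := normr_ge0 (ln (4 / expR 1) : R); lra.
exists L0 => N L hL.
have [k1 k2] := hL0 _ hL.
have n1 := normr_ge0 (ln c0); have n2 := normr_ge0 (ln (4 / expR 1) : R).
have L1 : 1 <= L by lra.
have L0' : 0 <= L by lra.
have l4 : ln L <= ln L ^+ 4 by rewrite ler_eXnr //; lra.
have l0 : 0 <= ln L by lra.
have k3 : 10 * ln L <= L.
  apply: le_trans k2; apply: ler_pM => //; lra.
have N1 : 1 < N%:R :> R.
  rewrite ltNge; apply/negP => h; have := ln_le0 h; rewrite -/L; lra.
have N0 : (0 < N)%N by rewrite -(ltr0n R); lra.
have [q hq [-> _]] := nN_spec hp1 hp2 N1.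
have [p hp [r1 r2 r0]] := clamp q hq.
have hp01 : 0 <= p <= 1.
  by move: hd hp => /andP[a b] /andP[e f]; apply/andP; split; lra.
exists p => //.
have bp := hc0 p hp01. have bq := hc0 q hq.
have [f0 f1 f2] := min3_le (x0 p1 p2 N q) (xi p1 N q) (xi p2 N q).
rewrite -/(fN p1 p2 N q) in f0 f1 f2.
split.
- apply: (le_trans f0); rewrite x0E // -/L; last exact: lt_le_trans c00 bq.
  apply: x0rate_anti => //; last exact: lt_le_trans c00 bp.
  have hln : ln c0 <= ln (ratefun p1 p2 p).
    by rewrite ler_ln ?posrE //; exact: lt_le_trans c00 bp.
  have := ler_norm (ln (4 / expR 1) : R); have := ler_norm (- ln c0); rewrite normrN.
  by move: hln n1 n2 k1 k3 {f0 f1 f2}; set y := ln (ratefun _ _ _); clear; lra.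
- apply: (le_trans f1); rewrite xi_lnroot // -/L.
  by apply: lnroot_anti => //; exact: gibbs.
- apply: (le_trans f2); rewrite xi_lnroot // -/L.
  by apply: lnroot_anti => //; exact: gibbs.
Qed.

Lemma lower_tail (R : realType) (p1 p2 : R) (hp1 : 0 < p1 < 1) (hp2 : 0 < p2 < 1) :
  exists L0 : R, forall N : nat, L0 <= ln N%:R :> R ->
  forall n : nat, n%:R <= nN p1 p2 N - epsN R N -> nN p1 p2 N - epsN R N < n%:R + 1 ->
  @gnp2_prob R N p1 p2 (fun FG => ~~ (n <= mcis FG.1 FG.2)%N) <= (ln N%:R)^-1.
Proof.
pose mu := min_max_log p1 p2; have mu0 : 0 < mu := maxrate_gt0 hp1 hp2.
have [c0 c00 hc0] := ratefun_ge hp1 hp2.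
have [C0 C00 hC0] := ratefun_le hp1 hp2.
have [d0 /andP[d00 d01] [L1 hL1]] := clamped_maximiser hp1 hp2.
pose al := 1 / mu; pose A := 6 / mu.
have al0 : 0 < al by rewrite divr_gt0.
have A0 : 0 < A by rewrite divr_gt0.
have alE0 : 2 / mu = 2 * al by rewrite /al; ring.
have aE0 : 5 / mu = 5 * al by rewrite /al; ring.
have AE : A = 6 * al by rewrite /al /A; ring.
clearbody al A.
(* The factor 2 leaves room for rounding the density; placing p1 and p2 in the same interval bounds
   all logarithmic slopes by [lam]. *)
have [d dp [dd0 [dp1 dp2]]] : exists2 d, 0 < d & 2 * d <= d0 /\ d <= p1 <= 1 - d /\ d <= p2 <= 1 - d.
  exists (Num.min (d0 / 2) (Num.min (Num.min p1 (1 - p1)) (Num.min p2 (1 - p2)))).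
    by move: hp1 hp2 => /andP[a b] /andP[e f]; rewrite !lt_min a e !subr_gt0 b f divr_gt0.
  set m := Num.min _ _.
  have e1 : m <= d0 / 2 by rewrite /m ge_min lexx.
  have e2 : m <= p1 by rewrite /m !ge_min lexx !orbT.
  have e3 : m <= 1 - p1 by rewrite /m !ge_min lexx !orbT.
  have e4 : m <= p2 by rewrite /m !ge_min lexx !orbT.
  have e5 : m <= 1 - p2 by rewrite /m !ge_min lexx !orbT.
  split; first by lra.
  by split; apply/andP; split; lra.
have d12 : d <= 2^-1 by lra.
pose lam := 4 * - ln d + 1.
have lnd : ln d <= 0 by rewrite ln_le0 //; lra.
have lam1 : 1 <= lam by rewrite /lam; lra.
have lam0 : 0 <= lam by lra.
(* The margins of the two lower-exponent lemmas are at least 2 kap l^2: one half becomes [s], the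
   other pays for Stirling and for rounding. *)
pose kap := Num.min (al * c0) (al / A) / 4.
have kap0 : 0 < kap.
  by rewrite divr_gt0 // lt_min; apply/andP; split; [exact: mulr_gt0|exact: divr_gt0].
have kap1 : 4 * kap <= al * c0 by rewrite /kap mulrC divfK // ge_min lexx.
have kap2 : 4 * kap <= al / A by rewrite /kap mulrC divfK // ge_min lexx orbT.
have [eta heta hetaL] := large_eta al0 A0 lam1.
have eta0 : 0 < eta by case/andP: heta.
have [del del0 [K1 hK1]] := large_tail al0 A0 dp eta0.
(* Three demands on w l: the tails of [large_tail], the bound of (4 + w) ln n by L/16, and 6(2w + 1)
   <= n. *)
have del'0 : 0 < Num.min del (Num.min (1 / 16 / 10) al).
  by rewrite !lt_min del0 al0 andbT /=; lra.
have [K2 hK2] := large_sqrt al0 A0 del'0.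
have [K3 hK3] := large_fact al0 A0 kap0.
have [K4 hK4] := large_ffact al0 A0.
have [K5 hK5] := large_misc al0 A0 lam0 kap0 dp.
have [K6 hK6] := large_error al0 A0 kap0.
pose K7 := 1 + `|ln C0| + C0 + 2 / A.
pose K := `|K1| + `|K2| + `|K3| + `|K4| + `|K5| + `|K6| + K0 al A + K7.
have K00 : 100 <= K0 al A.
  have r2 : 0 < 20 / al by rewrite divr_gt0.
  have r3 : 0 < 1 / A by rewrite divr_gt0.
  have := normr_ge0 (ln A); rewrite /K0; move: r2 r3; clear; lra.
have A2 : 0 < 2 / A by rewrite divr_gt0.
have K70 : 0 <= K7.
  by have := normr_ge0 (ln C0); rewrite /K7; move: A2 C00; clear; lra.
have [K1K [K2K [K3K [K4K [K5K [K6K [K7K K0K]]]]]]] : K1 <= K /\ K2 <= K /\ K3 <= K /\ K4 <= K /\ K5 <= K /\ K6 <= K /\ K7 <= K /\ K0 al A <= K.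
  rewrite /K; have := ler_norm K1; have := ler_norm K2; have := ler_norm K3; have := ler_norm K4.
  have := ler_norm K5; have := ler_norm K6.
  have := normr_ge0 K1; have := normr_ge0 K2; have := normr_ge0 K3; have := normr_ge0 K4.
  have := normr_ge0 K5; have := normr_ge0 K6.
  move: K00 K70; clear; do !split; lra.
have [L2 hL2] := nN_size hp1 hp2 K.
exists (Num.max L1 L2) => N; rewrite ge_max => /andP[hNL1 hNL2] n hn1 hn2.
have [hl hl4 N1 [nlo nhi]] := hL2 N hNL2; rewrite -/mu in nlo nhi.
have [p hp [m0 m1 m2]] := hL1 N hNL1.
move: hL1 hL2 hNL1 hNL2 => _ _ _ _.
set L := ln N%:R in hl hl4 nlo nhi m0 m1 m2 *; set l := ln L in hl hl4.
have L0 : 0 <= L by rewrite /L ln_ge0 // ltW.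
have eE : epsN R N = l ^+ 2 / L by [].
set y := nN p1 p2 N in nlo nhi m0 m1 m2 hn1 hn2; rewrite eE in hn1 hn2; clearbody y.
have N0 : (0 < N)%N by rewrite -(ltr0n R); move: N1; clear; lra.
have K100 : 100 <= K by exact: le_trans K00 K0K.
have l100 : 100 <= l by exact: le_trans K100 hl.
have l2l4 : l ^+ 2 <= l ^+ 4 by rewrite ler_weXn2l //; move: l100; clear; lra.
have l1l2 : l <= l ^+ 2 by rewrite expr2 ler_peMr //; move: l100; clear; lra.
have l20 : 0 <= l ^+ 2 by exact: sqr_ge0.
have K0' : 0 <= K by move: K100; clear; lra.
have KL2 : K * l ^+ 2 <= L by apply: le_trans hl4; rewrite ler_wpM2l.
have h100 : 100 * l ^+ 2 <= K * l ^+ 2 by rewrite ler_wpM2r.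
have L100 : 100 <= L by move: l100 l1l2 KL2 h100; clear; lra.
have Lp : 0 < L by move: L100; clear; lra.
have L1' : 1 <= L by move: L100; clear; lra.
have KL : K <= L.
  apply: le_trans KL2; rewrite ler_peMr //; move: l100 l1l2; clear; lra.
have e0 : 0 <= l ^+ 2 / L by rewrite divr_ge0.
have e1 : l ^+ 2 / L <= 1 by rewrite ler_pdivrMr // mul1r; move: KL2 h100 l20; clear; lra.
have alE : 2 / mu * L = 2 * (al * L) by rewrite alE0 mulrA.
have aE : 5 / mu * L = 5 * (al * L) by rewrite aE0 mulrA.
have alL : 20 <= al * L.
  rewrite mulrC -ler_pdivrMr //; apply: le_trans KL; apply: le_trans K0K.
  have r3 : 0 < 1 / A by rewrite divr_gt0.
  have := normr_ge0 (ln A); rewrite /K0; move: r3; clear; lra.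
have nal : al * L <= n%:R by move: nlo hn2 e1 alL; rewrite alE; clear; lra.
have nA : n%:R <= A * L by move: nhi hn1 e0 alL; rewrite aE AE; clear; lra.
have n1r : 1 <= n%:R :> R by move: nal alL; clear; lra.
have n1 : (1 < n)%N by rewrite -(ltr_nat R); move: nal alL; clear; lra.
have lg : large al A K L n by split.
have lg_ K' : K' <= K -> large al A K' L n by move=> h; exact: large_le L0 h lg.
have [w [w0 nw wl]] := hK2 L n L0 (lg_ _ K2K).
have [wl1 [wl2 wl3]] : w%:R * l <= del * L /\ w%:R * l <= 1 / 16 / 10 * L /\ w%:R * l <= al * L.
  by do !split; apply: (le_trans wl); rewrite ler_wpM2r // !ge_min lexx ?orbT.
have tail := fun c => hK1 L n w c L0 (lg_ _ K1K) w0 wl1.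
have [f1 f2] := hK3 L n L0 (lg_ _ K3K).
have f3 := hK4 n N N1 (lg_ _ K4K).
have [g1 g2 g3] := hK5 L n L0 (lg_ _ K5K).
have err := hK6 L n L0 (lg_ _ K6K).
have lr := hetaL L n L0 nA.
have [[_ _ _ n20] [lnn0 lnn use]] := large_basics al0 A0 K0K L0 lg.
rewrite -/l in f1 f2 g2 err lnn use.
move: hK1 hK2 hK3 hK4 hK5 hK6 hetaL lg lg_ => _ _ _ _ _ _ _ _ _.
have [dp' p1d] : 2 * d <= p /\ p <= 1 - d.
  by move: hp dd0 dp => /andP[a b]; clear - a b; move=> *; split; lra.
have [m [qM hq hMq]] := round_density dp dp' p1d g3.
set q := m%:R / _ in qM hq hMq.
have hp01 : 0 <= p <= 1 by apply/andP; move: dp' p1d dp; clear; split; lra.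
have hq01 : 0 < q < 1.
  by move: hq dp => /andP[a b]; clear - a b; move=> ?; apply/andP; split; lra.
have M0 : 0 <= 'C(n, 2)%:R :> R by [].
have sl1 : `|ln (q / p1) - ln ((1 - q) / (1 - p1))| <= lam.
  by have := slope_le dp hq dp1; rewrite /lam; move=> h; apply: (le_trans h); rewrite lerDl.
have sl2 : `|ln (q / p2) - ln ((1 - q) / (1 - p2))| <= lam.
  by have := slope_le dp hq dp2; rewrite /lam; move=> h; apply: (le_trans h); rewrite lerDl.
have sl3 : `|ln q - ln (1 - q)| <= lam.
  by have := slope_le1 dp hq; rewrite /lam; move=> h; apply: (le_trans h); rewrite lerDl.
have lf := @ln_fact_le R n (ltnW n1).
have scale (x z c : R) : 0 <= c -> x <= z + `|p - q| * c -> 'C(n, 2)%:R * x <= 'C(n, 2)%:R * z + c.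
  move=> c0' h; apply: (le_trans (ler_wpM2l M0 h)).
  by rewrite mulrDr lerD2l mulrA ler_piMl.
have hxy z : y <= z -> n%:R + l ^+ 2 / L <= z by move: hn1; clear; lra.
have root r : 0 < r < 1 -> y <= lnroot L (relent r p) ->
   `|ln (q / r) - ln ((1 - q) / (1 - r))| <= lam ->
   'C(n, 2)%:R * relent r q <= n%:R * L - ln n`!%:R - kap * l ^+ 2.
  move=> hr hy hs.
  have h1 := scale _ _ _ lam0 (relent_close hr hq01 hp01 hs).
  have h2 := lower_exponent_root (gibbs hr hp01) al0 A0 L1' nal nA n1r g1 _ (hxy _ hy) lf.
  apply: (le_trans h1); rewrite -bin2R in h2.
  have [_ _ _ u] : [/\ 2 / A <= l, 2 / A <= L, 2 / A * l <= L & 2 / A * l ^+ 2 <= L].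
    apply: use; first exact: ltW.
    apply: le_trans K7K; rewrite /K7; have := normr_ge0 (ln C0); move: C00; clear; lra.
  have {}h2 := h2 u; rewrite mulrC in h2.
  have k3 : 4 * kap * l ^+ 2 <= al / A * l ^+ 2 by rewrite ler_wpM2r.
  move: h2 k3 g2 lam0; rewrite -/l mulrC; clear; lra.
have rate : 'C(n, 2)%:R * ratefun p1 p2 q <= 2 * n%:R * L - ln n`!%:R - kap * l ^+ 2.
  have lam30 : 0 <= 3 * lam by rewrite mulr_ge0.
  have h1 := scale _ _ _ lam30 (ratefun_close hp1 hp2 hq01 hp01 sl1 sl2 sl3).
  apply: (le_trans h1).
  have h2 := lower_exponent_rate c00 (hc0 p hp01) (hC0 p hp01) al0 L1' nal n1r _ (hxy _ m0) lf.
  have {}h2 := h2 _; rewrite -bin2R -/l in h2.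
  have u : 2 + 2 * ln C0 + C0 <= 2 * l.
    have := ler_norm (ln C0); have := le_trans K7K hl; rewrite /K7; move: A2 C00 l100; clear; lra.
  have {}h2 := h2 u.
  have k3 : 4 * kap * l ^+ 2 <= al * c0 * l ^+ 2 by rewrite ler_wpM2r.
  move: h2 k3 g2; clear; lra.
have [t1 t2 t3] := tail _ (collision_rate dp d12 hq).
apply: le_trans err.
apply: (@second_moment R n N m w p1 p2 q eta lam (kap * l ^+ 2)) => //.
- rewrite -(ler_nat R) natrM natrD natrM.
  have w1 : 1 <= w%:R :> R by rewrite ler1n.
  have : 100 * w%:R <= w%:R * l by rewrite mulrC ler_wpM2l.
  by move: w1 wl3 nal; clear; lra.
- by rewrite mulr_ge0 // ltW.
- rewrite natrD.
  have : (4 + w%:R) * ln n%:R <= (5 * w%:R) * (2 * l).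
    have w1 : 1 <= w%:R :> R by rewrite ler1n.
    by apply: ler_pM => //; move: w1; clear; lra.
  by move: wl2; rewrite -/L; clear; lra.
- by apply: root.
- by apply: root.
Qed.

(** * Conclusion *)

Lemma near_ln_ge (R : realType) (K : R) : \forall N \near \oo%classic, K <= ln N%:R :> R.
Proof.
have := nbhs_infty_ger (expR K).
apply: filterS => N h; rewrite -ler_expR lnK //.
by rewrite posrE; apply: lt_le_trans h; exact: expR_gt0.
Qed.

(** If k <= y - e it is the floor of y - e. Otherwise k + 1 > y - e + 1 > y + e, so it is the floor
    of y + e. *)
Lemma floor_two_points (R : realType) (y e : R) (k : nat) : 0 <= e -> 2 * e < 1 ->
  y - e < k%:R + 1 -> k%:R <= y + e ->
  (k%:Z == Num.floor (y - e)) || (k%:Z == Num.floor (y + e)).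
Proof.
move=> e0 e1 h1 h2.
have [h|h] := leP k%:R (y - e).
  apply/orP; left; rewrite eq_sym floor_eq; apply/andP; split => //.
  by rewrite intrD.
apply/orP; right; rewrite eq_sym floor_eq; apply/andP; split => //.
by rewrite intrD /=; move: h h1 e1; rewrite -!pmulrn; clear; lra.
Qed.

Lemma two_point_prob (R : realType) (p1 p2 : R) (hp1 : 0 < p1 < 1) (hp2 : 0 < p2 < 1) :
  exists L0 : R, forall N : nat, L0 <= ln N%:R ->
  1 - 2 * (ln N%:R)^-1 <= gnp2_prob p1 p2
      (fun FG : sgraph 'I_N * sgraph 'I_N =>
         ((mcis FG.1 FG.2)%:Z == Num.floor (nN p1 p2 N - epsN R N)) ||
         ((mcis FG.1 FG.2)%:Z == Num.floor (nN p1 p2 N + epsN R N))).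
Proof.
have [L1 h1] := upper_tail hp1 hp2.
have [L2 h2] := lower_tail hp1 hp2.
have mu0 := maxrate_gt0 hp1 hp2.
set mu := min_max_log p1 p2 in mu0.
have [L3 h3] := nN_size hp1 hp2 (3 + mu).
exists (Num.max L1 (Num.max L2 L3)) => N; rewrite !ge_max => /and3P[hN1 hN2 hN3].
have [hl hl4 N1 [nlo _]] := h3 N hN3.
have {}h1 := h1 N hN1; have {}h2 := h2 N hN2.
move: h3 hN1 hN2 hN3 => _ _ _ _.
set y := nN p1 p2 N in nlo h1 h2 *.
have eE : epsN R N = ln (ln N%:R) ^+ 2 / ln N%:R by [].
set e := epsN R N in h1 h2 eE *; clearbody y e.
rewrite -/mu in nlo.
set L := ln N%:R in hl hl4 nlo h1 h2 eE *; set l := ln L in hl hl4 eE.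
clearbody mu.
have l3 : 3 <= l by move: hl mu0; clear; lra.
have l24 : l ^+ 2 <= l ^+ 4 by rewrite ler_weXn2l //; move: l3; clear; lra.
have l2 : 9 <= l ^+ 2 by rewrite expr2; move: l3; clear; nra.
have KL : (3 + mu) * l ^+ 2 <= L.
  by apply: le_trans hl4; rewrite ler_wpM2l // addr_ge0 // ltW.
have m2 : 0 <= mu * (l ^+ 2 - 1).
  by rewrite mulr_ge0 ?(ltW mu0) //; move: l2; clear; lra.
have Lp : 0 < L by move: KL l2 m2 mu0; clear; lra.
have e0 : 0 <= e by rewrite eE divr_ge0 // ?sqr_ge0 // ltW.
have e1 : 2 * e < 1.
  rewrite eE mulrA ltr_pdivrMr // mul1r; move: KL l2 m2 mu0; clear; lra.
have ye : 0 <= y - e.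
  suff : 2 <= 2 / mu * L by move: nlo e1; clear; lra.
  rewrite mulrAC ler_pdivlMr //; move: KL l2 m2; clear; lra.
have natfloor (x : R) : 0 <= x -> let n := `|Num.floor x|%N in n%:R <= x /\ x < n%:R + 1.
  move=> x0 /=; rewrite natr_absz ger0_norm ?floor_ge0 //; split; first exact: floor_le.
  by have := floorD1_gt x; rewrite intrD.
have ye' : 0 <= y + e by move: ye e0; clear; lra.
(* Nonnegativity lets the integer floors be read as natural numbers. The lower tail is used at [a],
   the upper tail at [c.+1], the first size beyond y + e. *)
have [a1 a2] := natfloor _ ye; have [c1 c2] := natfloor _ ye'.
set a := `|_|%N in a1 a2; set c := `|_|%N in c1 c2.
have {}h2 := h2 a a1 a2.
have {}h1 : gnp2_prob p1 p2 (fun FG : sgraph 'I_N * sgraph 'I_N => (c.+1 <= mcis FG.1 FG.2)%N) <= L^-1.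
  by apply: h1; rewrite -natr1 // lerD2r.
rewrite gnp2_prob_compl lerD2l lerN2.
apply: (le_trans (gnp2_prob_union hp1 hp2 (B := fun FG => (c.+1 <= mcis FG.1 FG.2)%N)
  (C := fun FG => ~~ (a <= mcis FG.1 FG.2)%N) _)).
  move=> FG /=; apply: contraR; rewrite negb_or negbK -leqNgt => /andP[hc ha].
  apply: floor_two_points => //.
    by apply: (lt_le_trans a2); rewrite lerD2r ler_nat.
  by apply: le_trans c1; rewrite ler_nat.
by rewrite mulr_natl mulr2n lerD.
Qed.

Local Open Scope classical_set_scope.
Local Open Scope ring_scope.

Theorem theorem1p3 (R : realType) (p1 p2 : R)
    (hp1 : 0 < p1 < 1) (hp2 : 0 < p2 < 1) :
  ((fun N : nat => gnp2_prob p1 p2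
      (fun FG : sgraph 'I_N * sgraph 'I_N =>
         ((mcis FG.1 FG.2)%:Z == Num.floor (nN p1 p2 N - epsN R N)) ||
         ((mcis FG.1 FG.2)%:Z == Num.floor (nN p1 p2 N + epsN R N))))
     @ \oo --> (1 : R))
  /\
  (exists2 g : nat -> R,
     g =O_\oo (fun N : nat => ln (ln N%:R) : R) &
     \forall N \near \oo,
       nN p1 p2 N = (4 * ln N%:R + g N) / min_max_log p1 p2).
Proof.
split.
  have [L0 hL0] := two_point_prob hp1 hp2.
  apply/cvgrPdist_le => e e0.
  have := near_ln_ge (Num.max L0 (2 / e)).
  apply: filterS => N; rewrite ge_max => /andP[/hL0 h1 h2].
  have L0' : 0 < ln N%:R :> R by apply: lt_le_trans h2; rewrite divr_gt0.
  rewrite ger0_norm ?subr_ge0 ?gnp2_prob_le1 // lerBlDr -lerBlDl.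
  apply: le_trans h1; rewrite lerD2l lerN2 ler_pdivrMr //.
  by rewrite mulrC -ler_pdivrMr.
have mu0 := maxrate_gt0 hp1 hp2.
have [C C0 hC] := nN_upper hp1 hp2.
have [C' [L1 [C'0 L11 hC']]] := nN_lower hp1 hp2.
exists (fun N => min_max_log p1 p2 * nN p1 p2 N - 4 * ln N%:R).
  (* 4 comes from the 4 log log N in [nN_lower]; one more multiple of log log N absorbs the
     constants. *)
  apply/eqO_exP; exists 5 => //.
  have := near_ln_ge (Num.max L1 (expR (C + C'))).
  apply: filterS => N; rewrite ge_max => /andP[h1 h2].
  have L1' : 1 <= ln N%:R :> R by exact: le_trans h1.
  have hl : C + C' <= ln (ln N%:R) :> R.
    by rewrite -ler_expR lnK // posrE; apply: lt_le_trans L1'.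
  have u := hC N L1'; have v := hC' N h1.
  rewrite (@ger0_norm _ (ln (ln N%:R))); last by apply: le_trans hl; rewrite addr_ge0 // ltW.
  rewrite ler_norml; move: u v hl C0 C'0.
  set x := _ * nN _ _ _; set l := ln (ln _); set L := ln _; clearbody x l L; clear.
  by move=> *; apply/andP; split; lra.
near=> N; rewrite addrC subrK mulrAC mulfV ?mul1r //.
by rewrite gt_eqF.
Unshelve. all: by end_near.
Qed.
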